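(* Let $\mathbb{F}$ be $\mathbb{R}$ or $\mathbb{C}$ and let $G$ be a semisimple Lie group over $\mathbb{F}$ with Lie algebra $\mathfrak{g}$ and Cartan subalgebra $\mathfrak{h}$ such that $\mathfrak{g}_0=\mathfrak{h}$ and $\mathfrak{g}=\mathrm{Ad}(G)(\mathfrak{h})=\{\mathrm{Ad}(g)H: g\in G, H\in\mathfrak{h}\}$, where $\mathrm{Ad}:G\to\mathrm{GL}(\mathfrak{g})$ is the adjoint representation. Let $\rho:G\to\mathrm{GL}(\mathbb{V})$ be a representation of $G$. Then $\rho$ is Cayley if and only if $\widetilde{d\rho}(S^3\mathfrak{h})\subseteq d\rho(\mathfrak{h})$.
   Context: A representation of a Lie group $G$ over $\mathbb{F}$ is a homomorphism $\rho: G\to\mathrm{GL}(\mathbb{V})$, $\mathbb{V}$ a finite-dimensional complex vector space, which is smooth if $\mathbb{F}=\mathbb{R}$ and complex analytic if $\mathbb{F}=\mathbb{C}$; $d\rho$ is its differential. The Cayley transform is $C(u)=(1+u)(1-u)^{-1}$, for $u\in\mathfrak{gl}(\mathbb{V})$ with $1-u$ invertible. $\rho$ is Cayley if there is an open neighbourhood $N$ of $0$ in $\mathfrak{g}$ such that $C$ is defined on $d\rho(N)$ and $C(d\rho(N))\subseteq\rho(G)$. $\widetilde{d\rho}(S^3\mathfrak{h})$ is the $\mathbb{F}$-span of the products $d\rho(x)d\rho(y)d\rho(z)$, $x,y,z\in\mathfrak{h}$ (the image of the third symmetric power $S^3\mathfrak{h}\subset S(\mathfrak{h})\simeq\mathcal{U}(\mathfrak{h})$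 under the algebra homomorphism into $\mathfrak{gl}(\mathbb{V})$ induced by $d\rho|_{\mathfrak h}$). The subalgebra $\mathfrak{g}_0$ is the zero part of the (restricted) root space decomposition of $\mathfrak{g}$: if $\mathbb{F}=\mathbb{C}$, then $\mathfrak{g}=\mathfrak{g}_0\oplus\bigoplus_{\alpha\in\Phi}\mathfrak{g}_\alpha$ with $\mathfrak{g}_0=\mathfrak{h}$; if $\mathfrak{g}$ is a compact real form of $\mathfrak{g}^{\mathbb{C}}=\mathfrak{g}\otimes\mathbb{C}$, then $\mathfrak{g}_0=\mathfrak{h}$ as well; if $\mathfrak{g}$ is a non-compact real form of $\mathfrak{g}^{\mathbb{C}}$, then $\mathfrak{g}=\mathfrak{g}_0\oplus\bigoplus_{\sigma\in\Sigma}\mathfrak{g}_\sigma$ is the restricted root space decomposition with respect to $\mathfrak{a}$, where $\mathfrak{a}$ is a maximal abelian subspace of $\mathfrak{p}$ for a Cartan decomposition $\mathfrak{g}=\mathfrak{k}\oplus\mathfrak{p}$, $\Sigma$ is the set of restricted roots, $\mathfrak{g}_0$ is the centralizer of $\mathfrak{a}$ in $\mathfrak{g}$, and $\mathfrak{h}\supseteq\mathfrak{a}$ is a Cartan subalgebra. In this last case $\mathfrak{g}_0=\mathfrak{h}$ may fail, but it holds for split real forms. *)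

(* Defs.v *)
From HB Require Import structures.
From mathcomp Require Import all_boot all_order all_algebra complex.
From mathcomp Require Import all_classical all_reals all_analysis.

Set Implicit Arguments.
Unset Strict Implicit.
Unset Printing Implicit Defensive.

Import Order.TTheory GRing.Theory Num.Theory.
Import numFieldNormedType.Exports.

Local Open Scope classical_set_scope.
Local Open Scope ring_scope.

(* A group and a topology on the same carrier; their compatibility is part of
   [lieGroup] below. *)
#[short(type="topGroupType")]
HB.structure Definition TopGroup := {G of Group G & Topological G}.

Section Smooth.
Context {F : numFieldType}.

(* For U open, [Ck k U f] says that all iterated directional derivatives of f
   of order at most k exist and are continuous on U. The derivatives are limits
   of difference quotients over F: for F the real numbers this is the usual
   class C^k, while for F the complex numbers the derivatives are complex ones,
   and for every k > 0 this says that f is holomorphic, that is, complex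
   analytic. *)
Fixpoint Ck {E W : normedModType F} (k : nat) (U : set E) (f : E -> W) : Prop :=
  (forall x, U x -> {for x, continuous f}) /\
  if k is k'.+1 then
    forall v, (forall x, U x -> derivable f x v) /\ Ck k' U ('D_v f)
  else True.

Definition smooth_on {E W : normedModType F} (U : set E) (f : E -> W) : Prop :=
  forall k, Ck k U f.

Record chart (M : topologicalType) (E : normedModType F) := Chart {
  chart_dom : set M;
  chart_map :> M -> E;
  chart_inv : E -> M;
  chart_dom_open : open chart_dom;
  chart_img_open : open (chart_map @` chart_dom);
  chart_mapK : forall p, chart_dom p -> chart_inv (chart_map p) = p;
  chart_map_continuous : forall p, chart_dom p -> {for p, continuous chart_map};
  chart_inv_continuous : forall v, (chart_map @` chart_dom) v ->
    {for v, continuous chart_inv}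
}.

Definition chart_img (M : topologicalType) (E : normedModType F)
  (c : chart M E) : set E := c @` chart_dom c.

Definition is_atlas (M : topologicalType) (E : normedModType F)
    (A : set (chart M E)) : Prop :=
  (forall p, exists2 c, A c & chart_dom c p) /\
  (forall c d, A c -> A d ->
    smooth_on (c @` (chart_dom c `&` chart_dom d)) (d \o chart_inv c)).

Definition smooth_mul (G : topGroupType) (E : normedModType F)
    (A : set (chart G E)) : Prop :=
  continuous (fun p : G * G => (p.1 * p.2)%g) /\
  (forall c d e, A c -> A d -> A e ->
    smooth_on
      [set v : E * E | [/\ chart_img c v.1, chart_img d v.2 &
        chart_dom e (chart_inv c v.1 * chart_inv d v.2)%g]]
      (fun v : E * E => e (chart_inv c v.1 * chart_inv d v.2)%g)).

Definition smooth_inv (G : topGroupType) (E : normedModType F)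
    (A : set (chart G E)) : Prop :=
  continuous (fun g : G => (g^-1)%g) /\
  (forall c d, A c -> A d ->
    smooth_on
      [set v : E | chart_img c v /\ chart_dom d ((chart_inv c v)^-1)%g]
      (fun v : E => d ((chart_inv c v)^-1)%g)).

End Smooth.

(* [lie_chart1] is any chart of the atlas around the identity; it serves to
   identify the tangent space at the identity with row vectors. *)
Record lieGroup (F : numFieldType) := LieGroup {
  lie_sort :> topGroupType;
  lie_dim : nat;
  lie_atlas : set (chart lie_sort 'rV[F]_lie_dim);
  lie_chart1 : chart lie_sort 'rV[F]_lie_dim;
  lie_hausdorff : hausdorff_space lie_sort;
  lie_second_countable : @second_countable lie_sort;
  lie_is_atlas : is_atlas lie_atlas;
  lie_chart1_atlas : lie_atlas lie_chart1;
  lie_chart1_dom : chart_dom lie_chart1 1%g;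
  lie_smooth_mul : smooth_mul lie_atlas;
  lie_smooth_inv : smooth_inv lie_atlas
}.

Arguments lie_dim {F} G : rename.
Arguments lie_atlas {F} G _ : rename.
Arguments lie_chart1 {F} G : rename.

Section LieAlgebraOfLieGroup.
Context {F : numFieldType} (G : lieGroup F).
Local Notation phi := (lie_chart1 G).
Local Notation psi := (chart_inv (lie_chart1 G)).

(* The tangent space of G at the identity, read in the chart [lie_chart1]. *)
Definition lie_alg := 'rV[F]_(lie_dim G).

(* The differential at the identity of the conjugation by g. *)
Definition Ad (g : G) (x : lie_alg) : lie_alg :=
  'D_x (fun v => phi (g * psi v * g^-1)%g) (phi 1%g).

(* [x, y] = ad x y, where ad is the differential of Ad at the identity. *)
Definition lie_bracket (x y : lie_alg) : lie_alg :=
  'D_x (fun v => Ad (psi v) y) (phi 1%g).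

End LieAlgebraOfLieGroup.

Arguments lie_bracket {F} G x y.

(* The bracket [br] below is meant to be a Lie bracket, hence bilinear. *)
Section LieAlgebra.
Context {F : numFieldType} {n : nat} (br : 'rV[F]_n -> 'rV[F]_n -> 'rV[F]_n).
Local Notation g := 'rV[F]_n.
Implicit Types U V I h a t : {vspace g}.

Definition brv U V : {vspace g} :=
  <<[seq br u v | u <- vbasis U, v <- vbasis V]>>%VS.

Definition is_subalgebra h : Prop :=
  forall x y, x \in h -> y \in h -> br x y \in h.

Definition is_ideal I : Prop := forall x y, y \in I -> br x y \in I.

Definition is_solvable I : Prop := exists k, iter k (fun U => brv U U) I = 0%VS.

Definition is_nilpotent h : Prop := exists k, iter k (brv h) h = 0%VS.

Definition is_semisimple : Prop :=
  forall I, is_ideal I -> is_solvable I -> I = 0%VS.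

Definition cartan_subalgebra h : Prop :=
  [/\ is_subalgebra h, is_nilpotent h &
      forall x, (forall y, y \in h -> br x y \in h) -> x \in h].

(* The matrix [lin1_mx (br x)] represents ad x. *)
Definition killing (x y : g) : F := \tr (lin1_mx (br x) *m lin1_mx (br y)).

(* For a real semisimple Lie algebra: it is a compact real form of its
   complexification. *)
Definition compact_form : Prop := forall x : g, x != 0 -> killing x x < 0.

(* The corresponding Cartan decomposition consists of the eigenspaces of theta
   for 1 and -1. *)
Definition cartan_involution (theta : 'End(g)) : Prop :=
  [/\ forall x, theta (theta x) = x,
      forall x y, theta (br x y) = br (theta x) (theta y) &
      forall x : g, x != 0 -> 0 < - killing x (theta x)].

Definition abelian_in_p (theta : 'End(g)) a : Prop :=
  (forall x, x \in a -> theta x = - x) /\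
  (forall x y, x \in a -> y \in a -> br x y = 0).

Definition maximal_abelian_in_p (theta : 'End(g)) a : Prop :=
  abelian_in_p theta a /\
  (forall a', abelian_in_p theta a' -> (a <= a')%VS -> a' = a).

(* The part for the zero root of the simultaneous eigenspace decomposition
   under ad t. *)
Definition zero_root_space t (g0 : {vspace g}) : Prop :=
  forall x, x \in g0 <-> forall y, y \in t -> br y x = 0.

End LieAlgebra.

Variant ground := Reals | Complexes.

Definition base_field (R : realType) (b : ground) : numFieldType :=
  match b with Reals => R | Complexes => R[i] end.

Definition scalar_to_C (R : realType) (b : ground) : base_field R b -> R[i] :=
  match b with Reals => fun x => (x%:C)%C | Complexes => id end.

(* The complex matrices as a normed space over [base_field R b]; over the real
   numbers, they are given by their real and imaginary parts. *)
Definition gl_space (R : realType) (b : ground) (m : nat) :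
    normedModType (base_field R b) :=
  match b with Reals => 'M[R]_(m, m + m) | Complexes => 'M[R[i]]_m end.

Definition gl_coord (R : realType) (b : ground) (m : nat) :
    'M[R[i]]_m -> gl_space R b m :=
  match b with
  | Reals => fun A => row_mx (map_mx (@complex.Re R) A)
                             (map_mx (@complex.Im R) A)
  | Complexes => id
  end.

Definition gl_uncoord (R : realType) (b : ground) (m : nat) :
    gl_space R b m -> 'M[R[i]]_m :=
  match b with
  | Reals => fun A => \matrix_(i, j) (lsubmx A i j +i* rsubmx A i j)%C
  | Complexes => id
  end.

Section OverGround.
Context {R : realType} {b : ground}.
Local Notation F := (base_field R b).

Section Representation.
Context (G : lieGroup F) (m : nat) (rho : G -> 'M[R[i]]_m).
Local Notation g := (lie_alg G).
Local Notation phi := (lie_chart1 G).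

(* The vector space of the representation is C^m; by [rho1] and [rhoM] the
   values of [rho] are invertible. *)
Record is_representation : Prop := IsRepresentation {
  rho1 : rho 1%g = 1%:M;
  rhoM : forall x y : G, rho (x * y)%g = rho x *m rho y;
  rho_smooth : forall c, lie_atlas G c ->
    smooth_on (chart_img c) (fun v => gl_coord b (rho (chart_inv c v)))
}.

Definition drho (x : g) : 'M[R[i]]_m :=
  gl_uncoord ('D_x (fun v => gl_coord b (rho (chart_inv phi v))) (phi 1%g)).

Definition cayley (u : 'M[R[i]]_m) : 'M[R[i]]_m :=
  (1%:M + u) *m invmx (1%:M - u).

Definition is_cayley : Prop :=
  exists N : set g, open_nbhs (0 : g) N /\
    forall x, N x -> (1%:M - drho x \in unitmx) /\ range rho (cayley (drho x)).

Definition drhoS3 (h : {vspace g}) : set 'M[R[i]]_m :=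
  [set A | exists (k : nat) (c : 'I_k -> F) (x y z : 'I_k -> g),
    (forall i, [/\ x i \in h, y i \in h & z i \in h]) /\
    A = \sum_(i < k)
          scalar_to_C (c i) *: (drho (x i) *m drho (y i) *m drho (z i))].

End Representation.

(* [g0] is the zero part of the root space decomposition of the Lie algebra of
   G: with respect to h in the complex and compact cases, and with respect to
   a maximal abelian subspace of p contained in h in the non-compact case. *)
Definition is_g0 (G : lieGroup F) (h g0 : {vspace lie_alg G}) : Prop :=
  let br := lie_bracket G in
  match b with
  | Complexes => zero_root_space br h g0
  | Reals =>
      (compact_form br /\ zero_root_space br h g0) \/
      (~ compact_form br /\
       exists (theta : 'End(lie_alg G)) (a : {vspace lie_alg G}),
         [/\ cartan_involution br theta, maximal_abelian_in_p br theta a,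
             (a <= h)%VS & zero_root_space br a g0])
  end.

End OverGround.

(* Main.v *)
(** Read C^m as R^(2 m) over the reals, and let D be the differential of the
    resulting homomorphism T from G to square matrices over F.

    Suppose D(h) is closed under triple products and x = Ad g H with H in h.
    Then S = T(g) D(h) T(g)^-1 contains A = D x and is closed under triple
    products, so for small A the equation 2 B = A + A B B can be solved in S by
    iteration, and C(B)^2 = C(A). Repeating this yields B_n in S of size 2^-n
    with C(A) = C(B_n)^(2^n). Writing 2 B_n = D(w_n) with w_n of size 2^-n, the
    powers psi(w_n)^(2^n) converge in G, and T maps their limit to C(A).

    Conversely, let C(t A) = T(g_t) for all small t > 0, where A = D x. Since G
    is second countable, there are arbitrarily small t0 such that (t0, g_t0) is
    an accumulation point of the pairs (t, g_t). Differentiating along these,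
    A (1 - t0^2 A^2)^-1 lies in the range of D, hence so does A^3 when t0 tends
    to 0, and, by polarization, every product D x D y D z with x, y, z in the
    abelian algebra h. If this product is D w, then [h, w] lies in the kernel of
    D, and Fitting's lemma moves w into h modulo this kernel, as h is its own
    normalizer. *)

From HB Require Import structures.
Require Import Defs.
From mathcomp Require Import all_boot all_order all_algebra complex ring lra.
From mathcomp Require Import all_classical all_reals all_analysis.

Set Implicit Arguments.
Unset Strict Implicit.
Unset Printing Implicit Defensive.

Import Order.TTheory GRing.Theory Num.Theory.
Import numFieldNormedType.Exports.

Local Open Scope classical_set_scope.
Local Open Scope ring_scope.

(** * Real-valued norms over both ground fields *)

(** The exponential of [G] is never constructed; everything is estimated in one chart around the
    identity. If [A = tanh a], then the Cayley transform of [A] is [exp (2 a)], so a preimage in [G]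
    should come from an odd power series in [A], and odd powers are what closure under triple
    products provides. The equation [2 B = A + A B B] is the half-argument formula of [tanh]; dyadic
    roots take the place of the logarithm.

    In the converse direction, differentiating meets two obstacles. The choice of [g_t] has no
    continuity at all, which is where second countability comes in. And [D] may have a kernel:
    [g_t0^-1 g_t] is close to the identity, but its coordinate need not be of order [t - t0], since
    it may drift along the kernel. [kernel_reduce] replaces it by a point with the same image under
    [T] and almost no kernel part, after which the linear term dominates.

    The bracket is defined as a derivative of [Ad], so its bilinearity, its Jacobi identity and its
    antisymmetry have to be proved too. *)

Section RealNorm.
Context {R : realType} {b : ground}.
Local Notation F := (base_field R b).

Definition toF : R -> F :=
  match b return R -> base_field R b with
  | Reals => id | Complexes => real_complex R end.

Definition reF : F -> R :=
  match b return base_field R b -> R with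
  | Reals => id | Complexes => @complex.Re R end.

Lemma toFD : {morph toF : x y / x + y}.
Proof. by rewrite /toF; case: b => // x y; rewrite rmorphD. Qed.

Lemma toFM : {morph toF : x y / x * y}.
Proof. by rewrite /toF; case: b => // x y; rewrite rmorphM. Qed.

Lemma toF0 : toF 0 = 0. Proof. by rewrite /toF; case: b. Qed.
Lemma toF1 : toF 1 = 1. Proof. by rewrite /toF; case: b. Qed.

HB.instance Definition _ := GRing.isNmodMorphism.Build R F toF (conj toF0 toFD).
HB.instance Definition _ :=
  GRing.isMonoidMorphism.Build R F toF (conj toF1 toFM).

Lemma le_toF x y : (toF x <= toF y) = (x <= y).
Proof. by rewrite /toF; case: b => //; rewrite lecR. Qed.

Lemma lt_toF x y : (toF x < toF y) = (x < y).
Proof. by rewrite /toF; case: b => //; rewrite ltcR. Qed.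

Lemma toFK : cancel toF reF.
Proof. by rewrite /toF /reF; case: b. Qed.

Lemma reFK (z : F) : 0 <= z -> toF (reF z) = z.
Proof.
rewrite /toF /reF; case: b z => //= -[x y].
by rewrite lecE /= => /andP[/eqP -> _].
Qed.

(** The norm of a normed module over [F] takes its values in [F] itself, which is only partially
    ordered when [F] is [R[i]]. Its real part loses nothing and lets all estimates be made in [R],
    for both ground fields at once. *)
Definition nr (V : normedModType F) (v : V) : R := reF `|v|.

Lemma toF_nr (V : normedModType F) (v : V) : toF (nr v) = `|v|.
Proof. exact: reFK. Qed.

Section Theory.
Context {V : normedModType F}.
Implicit Types u v : V.

Lemma nr_ge0 v : 0 <= nr v.
Proof. by rewrite -le_toF toF_nr rmorph0. Qed.

Lemma nr0 : nr (0 : V) = 0.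
Proof. by rewrite /nr normr0 -[0 in LHS]toF0 toFK. Qed.

Lemma nr_eq0 v : nr v = 0 -> v = 0.
Proof.
by move=> v0; apply/eqP; rewrite -normr_eq0 -toF_nr v0 rmorph0.
Qed.

Lemma nrD u v : nr (u + v) <= nr u + nr v.
Proof. by rewrite -le_toF rmorphD /= !toF_nr ler_normD. Qed.

Lemma nrN v : nr (- v) = nr v.
Proof. by rewrite /nr normrN. Qed.

Lemma nrC u v : nr (u - v) = nr (v - u).
Proof. by rewrite -nrN opprB. Qed.

Lemma nrB u v : nr (u - v) <= nr u + nr v.
Proof. by rewrite -(nrN v) nrD. Qed.

Lemma nr_tri u v w : nr (u - w) <= nr (u - v) + nr (v - w).
Proof. by apply: le_trans (nrD _ _); rewrite addrA subrK. Qed.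

Lemma nrBr u v : nr u <= nr v + nr (u - v).
Proof. by rewrite -{1}[u](subrKC v) nrD. Qed.

Lemma nrZ (c : F) v : nr (c *: v) = nr (c : F^o) * nr v.
Proof.
apply: (can_inj toFK); rewrite rmorphM /= !toF_nr normrZ //.
Qed.

Lemma nr_toF (t : R) : nr (toF t : F^o) = `|t|.
Proof.
wlog t0 : t / 0 <= t.
  move=> H; have [/H//|/ltW t0] := leP 0 t.
  rewrite -normrN -H ?oppr_ge0//; apply: (congr1 reF); rewrite rmorphN.
  exact/esym/(@normrN _ F^o).
rewrite ger0_norm// /nr ger0_norm ?toFK //.
by rewrite -[0]toF0 le_toF.
Qed.

Lemma nrZt (t : R) v : nr (toF t *: v) = `|t| * nr v.
Proof. by rewrite nrZ nr_toF. Qed.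

Lemma nr_sum (I : Type) (r : seq I) (P : pred I) (f : I -> V) :
  nr (\sum_(i <- r | P i) f i) <= \sum_(i <- r | P i) nr (f i).
Proof.
elim/big_ind2: _ => [|x1 x2 y1 y2 h1 h2|//]; first by rewrite nr0.
by apply: le_trans (nrD _ _) _; apply: lerD.
Qed.

Lemma nbhs_nrP (p : V) (A : set V) :
  nbhs p A <-> exists2 e : R, 0 < e & forall y, nr (y - p) < e -> A y.
Proof.
split.
  move=> /nbhs_ballP[e /= e0 H]; exists (reF e).
    by rewrite -lt_toF reFK ?ltW// toF0.
  move=> y; rewrite -lt_toF reFK ?ltW// toF_nr => ye; apply: H.
  by rewrite -ball_normE /= distrC.
move=> [e e0 H]; apply/nbhs_ballP; exists (toF e) => /=.
  by rewrite -[0]toF0 lt_toF.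
move=> y; rewrite -ball_normE /= distrC -toF_nr lt_toF; exact: H.
Qed.

End Theory.

Lemma nr_cvgP (V W : normedModType F) (f : V -> W) (p : V) :
  {for p, continuous f} <->
  forall e : R, 0 < e ->
    exists2 d : R, 0 < d & forall y, nr (y - p) < d -> nr (f y - f p) < e.
Proof.
split=> [fp e e0|H].
  have /fp/nbhs_nrP[d d0 H] : nbhs (f p) [set w | nr (w - f p) < e].
    by apply/nbhs_nrP; exists e.
  by exists d.
move=> A /nbhs_nrP[e e0 HA]; have [d d0 Hd] := H e e0.
by apply/nbhs_nrP; exists d => // y /Hd; exact: HA.
Qed.

(** Multiplying the difference quotient by [h] removes the division and admits [h = 0], which spares
    later estimates a case distinction. *)
Lemma derivable_nrP (V W : normedModType F) (f : V -> W) (p v : V) :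
  derivable f p v -> forall e : R, 0 < e ->
    exists2 d : R, 0 < d & forall h : F, nr (h : F^o) < d ->
      nr (f (p + h *: v) - f p - h *: 'D_v f p) <= e * nr (h : F^o).
Proof.
rewrite /derivable /derive.
set q := fun h => _; set D := lim _ => qD e e0.
have /qD : nbhs D [set w | nr (w - D) < e] by apply/nbhs_nrP; exists e.
move=> /nbhs_nrP[d d0 H]; exists d => // h hd.
have [->|h0] := eqVneq h 0.
  by rewrite !scale0r addr0 !subrr nr0 mulr_ge0 ?nr_ge0// ltW.
have /(_ _ h0) := H h; rewrite subr0 => /(_ hd) /=.
rewrite /q /shift /= => /ltW le.
rewrite [p + _]addrC -[f _ - f p]scale1r -(mulfV h0) -scalerA -scalerBr nrZ mulrC.
by rewrite ler_wpM2r ?nr_ge0.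
Qed.

Lemma nr_is_derive (V W : normedModType F) (f : V -> W) (p v : V) (D : W) :
  (forall e : R, 0 < e ->
    exists2 d : R, 0 < d & forall h : F, nr (h : F^o) < d ->
      nr (f (p + h *: v) - f p - h *: D) <= e * nr (h : F^o)) ->
  derivable f p v /\ 'D_v f p = D.
Proof.
move=> H; rewrite /derivable /derive.
set q := fun h => _.
have qD : q @ 0^' --> D.
  move=> A /nbhs_nrP[e e0 HA].
  (* Half of [e] turns the weak inequality of the hypothesis into the strict one of a
     neighbourhood. *)
  have [d d0 Hd] := H (e / 2) ltac:(by rewrite divr_gt0).
  apply/nbhs_nrP; exists d => // h; rewrite subr0 => hd h0.
  apply: HA; have h0' : 0 < nr (h : F^o).
    by rewrite lt_neqAle nr_ge0 andbT eq_sym; apply/eqP => /nr_eq0 h0'; move/eqP: h0.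
  rewrite -(ltr_pM2l h0') -nrZ scalerBr /q /= scalerA divff// scale1r.
  rewrite /shift [_ *: v + p]addrC; apply: le_lt_trans (Hd _ hd) _.
  by rewrite mulrC ltr_pM2l// gtr_pMr// invf_lt1// ltr1n.
by split; [apply/cvg_ex; exists D | apply: cvg_lim].
Qed.

End RealNorm.

(** * Differential calculus *)

Section MeanValue.
Context {R : realType} {b : ground}.
Local Notation F := (base_field R b).
Local Notation toF := (@toF R b).

(** In a general normed space there is no intermediate point to evaluate at, so the inequality is
    obtained by continuation: the supremum of the times up to which the bound with slope [M + e]
    holds must be 1. *)
Lemma path_mean_value (W : normedModType F) (g D : R -> W) (M : R) :
  (forall s, 0 <= s <= 1 -> forall e : R, 0 < e ->
    exists2 d : R, 0 < d & forall t : R, `|t| < d ->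
      nr (g (s + t) - g s - toF t *: D s) <= e * `|t|) ->
  (forall s, 0 <= s <= 1 -> nr (D s) <= M) ->
  nr (g 1 - g 0) <= M.
Proof.
move=> gD DM; apply/ler_addgt0Pr => e e0.
have near_s s : 0 <= s <= 1 -> exists2 d : R, 0 < d & forall t : R, `|t| < d ->
    nr (g (s + t) - g s) <= (M + e) * `|t|.
  move=> s01; have [d d0 H] := gD s s01 e e0; exists d => // t td.
  rewrite -(subrK (toF t *: D s) (_ - g s)) mulrDl addrC.
  apply: le_trans (nrD _ _) _; apply: lerD; last exact: H.
  by rewrite nrZt mulrC ler_wpM2r// DM.
(* Asking for the bound on all of [[0, s]] makes [S] an initial interval, so it holds at every point
   below the supremum. *)
pose S := [set s | 0 <= s <= 1 /\ forall u, 0 <= u <= s ->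
  nr (g u - g 0) <= (M + e) * u].
have S0 : S 0.
  split=> [|u]; first by rewrite lexx ler01.
  by move=> /le_anti <-; rewrite subrr nr0 mulr0.
have hS : has_sup S.
  by split; [exists 0 | exists 1 => s [/andP[]]].
pose c := sup S.
have c01 : 0 <= c <= 1.
  by rewrite sup_upper_bound//= /c; apply: ge_sup; [exists 0 | move=> s [/andP[]]].
have [d d0 Hd] := near_s c c01.
have [s Ss sc] := sup_adherent d0 hS.
have sle : s <= c by exact: sup_upper_bound.
have [s01 sb] := Ss.
have cb : nr (g c - g 0) <= (M + e) * c.
  apply: le_trans (nr_tri _ (g s) _) _.
  have -> : (M + e) * c = (M + e) * (c - s) + (M + e) * s by ring.
  apply: lerD; last by apply: sb; case/andP: s01 => -> _ /=.
  have := Hd (s - c); rewrite subrKC nrC distrC ger0_norm ?subr_ge0//.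
  by apply; rewrite ltrBlDr -ltrBlDl.
have Sc : S c.
  split=> // u /andP[u0]; rewrite le_eqVlt => /orP[/eqP->//|uc].
  have [v [v01 vb] uv] := sup_gt (ex_intro _ 0 S0) uc.
  by apply: vb; rewrite u0 ltW.
have [c1|c1] := ltP c 1; last first.
  have c1' : c = 1 by apply/le_anti; rewrite c1; case/andP: c01 => _ ->.
  by move: cb; rewrite c1' mulr1.
pose t := Num.min (d / 2) (1 - c).
have t0 : 0 < t by rewrite lt_min divr_gt0// subr_gt0.
have td : t < d by rewrite gt_min ltr_pdivrMr// ltr_pMr// ltr1n.
have tc : c + t <= 1 by rewrite -lerBrDl ge_min lexx orbT.
have : S (c + t).
  split=> [|u /andP[u0 ut]].
    by rewrite tc andbT addr_ge0 ?(ltW t0)//; case/andP: c01.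
  have [uc|cu] := leP u c; first by case: Sc => _; apply; rewrite u0.
  apply: le_trans (nr_tri _ (g c) _) _.
  have -> : (M + e) * u = (M + e) * (u - c) + (M + e) * c by ring.
  apply: lerD => //; have := Hd (u - c).
  rewrite subrKC gtr0_norm ?subr_gt0//; apply.
  by apply: le_lt_trans td; rewrite lerBlDl.
by move/(sup_upper_bound hS); rewrite -/c gerDl leNgt t0.
Qed.

(** Subtracting [D] along the segment measures the increment against a fixed vector; [D = 0] is the
    usual mean value inequality. *)
Lemma mean_value (V W : normedModType F) (f : V -> W) (p x : V) (D : W) (M : R) :
  (forall s : R, 0 <= s <= 1 -> derivable f (p + toF s *: x) x) ->
  (forall s : R, 0 <= s <= 1 -> nr ('D_x f (p + toF s *: x) - D) <= M) ->
  nr (f (p + x) - f p - D) <= M.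
Proof.
move=> df fM.
pose g (s : R) := f (p + toF s *: x) - toF s *: D.
have -> : f (p + x) - f p - D = g 1 - g 0.
  by rewrite /g rmorph1 rmorph0 !scale1r !scale0r addr0 subr0 addrAC.
apply: (@path_mean_value _ g (fun s => 'D_x f (p + toF s *: x) - D)) => // s s01 e e0.
have [d d0 H] := derivable_nrP (df s s01) e0; exists d => // t td.
have := H (toF t); rewrite nr_toF => /(_ td); congr (nr _ <= _).
rewrite /g rmorphD /= !scalerDl scalerBr addrA !opprB opprD !addrA.
rewrite [in RHS]addrAC; set A := f (_ + _ + _); set B := f _; set a := toF s *: D.
set d' := toF t *: D; rewrite [A - a - d']addrAC subrK -[RHS]addrA.
by rewrite [A - _ - B]addrAC -[RHS]addrA [- d' + _]addrCA addNr addr0.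
Qed.

Lemma derivable_scale (V W : normedModType F) (f : V -> W) (p x : V) (c : F) :
  derivable f p x -> derivable f p (c *: x) /\ 'D_(c *: x) f p = c *: 'D_x f p.
Proof.
move=> df; apply: nr_is_derive => e e0.
have c0 : 0 < nr (c : F^o) + 1 by rewrite ltr_wpDl ?nr_ge0.
have [d d0 H] := derivable_nrP df (divr_gt0 e0 c0).
exists (d / (nr (c : F^o) + 1)); first by rewrite divr_gt0.
move=> h; rewrite ltr_pdivlMr// => hd; rewrite !scalerA.
have hc : nr (h * c : F^o) = nr (h : F^o) * nr (c : F^o) by exact: nrZ.
apply: le_trans (H (h * c) _) _; rewrite hc.
  by apply: le_lt_trans hd; rewrite ler_wpM2l ?nr_ge0// lerDl.
rewrite -mulrA ler_wpM2l ?(ltW e0)// mulrC ler_pdivrMr// ler_wpM2l ?nr_ge0//.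
by rewrite lerDl.
Qed.

(** The Frechet differential. The directional derivatives of the definitions obey no chain rule by
    themselves, and even their additivity in the direction is a theorem, so linearity and
    boundedness of [L] are part of the data. *)
Record fdiff (V W : normedModType F) (f : V -> W) (p : V) (L : V -> W) : Prop :=
  FDiff {
    fdiffD : forall x y, L (x + y) = L x + L y;
    fdiffZ : forall c x, L (c *: x) = c *: L x;
    fdiff_bound : exists2 K, 0 < K & forall x, nr (L x) <= K * nr x;
    fdiff_near : forall e : R, 0 < e -> exists2 d : R, 0 < d &
      forall x, nr x < d -> nr (f (p + x) - f p - L x) <= e * nr x
  }.

(** Bases are given as data on a normed space because they serve for [E] and also for [E * E], the
    domain of the product read in charts. With maximum norms, coordinates and basis vectors are
    bounded with constant 1. *)
Record fin_basis (V : normedModType F) (n : nat) (e : 'I_n -> V)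
    (c : 'I_n -> V -> F) : Prop := FinBasis {
  fb_sum : forall x, x = \sum_i c i x *: e i;
  fb_D : forall i x y, c i (x + y) = c i x + c i y;
  fb_Z : forall i k x, c i (k *: x) = k * c i x;
  fb_c : forall i x, nr (c i x : F^o) <= nr x;
  fb_e : forall i, nr (e i) <= 1
}.

Lemma fdiff_derive (V W : normedModType F) (f : V -> W) (p : V) (L : V -> W) :
  fdiff f p L -> forall x, derivable f p x /\ 'D_x f p = L x.
Proof.
move=> [LD LZ _ H] x; apply: nr_is_derive => e e0.
have x0 : 0 < nr x + 1 by rewrite ltr_wpDl ?nr_ge0.
have [d d0 Hd] := H _ (divr_gt0 e0 x0).
exists (d / (nr x + 1)); first by rewrite divr_gt0.
move=> h; rewrite ltr_pdivlMr// => hd; rewrite -LZ.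
apply: le_trans (Hd _ _) _; rewrite nrZ.
  by apply: le_lt_trans hd; rewrite ler_wpM2l ?nr_ge0// lerDl.
rewrite -mulrA ler_wpM2l ?(ltW e0)// mulrC ler_pdivrMr// ler_wpM2l ?nr_ge0//.
by rewrite lerDl.
Qed.

Lemma fdiff_unique (V W : normedModType F) (f : V -> W) p (L1 L2 : V -> W) :
  fdiff f p L1 -> fdiff f p L2 -> L1 =1 L2.
Proof.
move=> /fdiff_derive H1 /fdiff_derive H2 x.
by rewrite -(H1 x).2 -(H2 x).2.
Qed.

Lemma fdiff_ext (V W : normedModType F) (f : V -> W) p (L1 L2 : V -> W) :
  L1 =1 L2 -> fdiff f p L1 -> fdiff f p L2.
Proof. by move=> /funext ->. Qed.

(** Continuous partial derivatives suffice: the way from [p] to [p + x] is split into legs along the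
    basis vectors, and the mean value inequality is applied on each leg. *)
Lemma C1_fdiff (V W : normedModType F) n (e : 'I_n -> V) c (f : V -> W) (p : V) :
  fin_basis e c ->
  (\forall q \near p, forall v, derivable f q v) ->
  (forall v, {for p, continuous ('D_v f)}) ->
  fdiff f p (fun x => 'D_x f p).
Proof.
move=> ec near_df Df_cont.
(* The candidate is built from partial derivatives, since [x] to ['D_x f p] is not known to be
   additive at this point. *)
pose L x := \sum_i c i x *: 'D_(e i) f p.
suff H : fdiff f p L.
  by apply: (fdiff_ext _ H) => x; rewrite (fdiff_derive H x).2.
have n0 : 0 < (n.+1%:R : R) by rewrite ltr0n.
pose K := \sum_i nr ('D_(e i) f p).
have K0 : 0 <= K by rewrite sumr_ge0// => i _; exact: nr_ge0.
split.
- move=> x y; rewrite /L -big_split; apply: eq_bigr => i _.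
  by rewrite (fb_D ec) scalerDl.
- move=> k x; rewrite /L scaler_sumr; apply: eq_bigr => i _.
  by rewrite (fb_Z ec) scalerA.
- exists (K + 1); first by rewrite ltr_wpDl.
  move=> x; apply: le_trans (nr_sum _ _ _) _.
  rewrite mulrDl mul1r ler_wpDr ?nr_ge0// mulr_suml ler_sum// => i _.
  by rewrite nrZ mulrC ler_wpM2l ?nr_ge0// (fb_c ec).
move=> eps eps0.
have near_c : nbhs p [set q | forall i,
    nr ('D_(e i) f q - 'D_(e i) f p) < eps / n.+1%:R].
  apply: (@filter_forall V 'I_n
    (fun i => [set q | nr ('D_(e i) f q - 'D_(e i) f p) < eps / n.+1%:R])) => i.
  have [d d0 Hd] := (nr_cvgP _ _).1 (Df_cont (e i)) _ (divr_gt0 eps0 n0).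
  by apply: (nbhs_nrP p _).2; exists d.
have [d d0 Hd] := (nbhs_nrP p _).1 (filterI near_df near_c).
(* Each partial sum of the coordinate expansion has norm at most [n%:R * nr x]; [n.+1] in place of
   [n] keeps the quotient meaningful in dimension 0. *)
exists (d / n.+1%:R); first by rewrite divr_gt0.
move=> x; rewrite ltr_pdivlMr// => xd.
pose y k := \sum_(i < n | (i < k)%N) c i x *: e i.
(* The weights [s i] let one bound cover the vertices of the path as well as the points inside its
   legs. *)
have ynr (t : 'I_n -> bool) (s : 'I_n -> R) : (forall i, 0 <= s i <= 1) ->
    nr (\sum_(i < n | t i) toF (s i) *: (c i x *: e i)) < d.
  move=> s01; apply: le_lt_trans xd; apply: le_trans (nr_sum _ _ _) _.
  apply: (@le_trans _ _ (\sum_(i < n) nr x)).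
    rewrite [leLHS]big_mkcond/= ler_sum// => i _; case: ifP => _; last exact: nr_ge0.
    rewrite nrZt nrZ mulrA -[leRHS]mulr1 ler_pM ?nr_ge0 ?mulr_ge0 ?nr_ge0 ?(fb_e ec)//.
    have /andP[h1 h2] := s01 i.
    by rewrite ger0_norm// -[leRHS]mul1r ler_pM ?nr_ge0 ?(fb_c ec).
  by rewrite sumr_const card_ord -[leLHS]mulr_natr ler_wpM2l ?nr_ge0// ler_nat.
have yS (i : 'I_n) : y i.+1 = y i + c i x *: e i.
  rewrite /y (bigD1 i) ?ltnSn//= addrC; congr (_ + _).
  by apply: eq_bigl => j; rewrite ltnS ltn_neqAle andbC; congr (~~ _ && _).
have yn : y n = x.
  by rewrite [RHS](fb_sum ec); apply: eq_bigl => i; rewrite ltn_ord.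
have y0 : y 0%N = 0 by rewrite /y big_pred0.
have -> : f (p + x) - f p - L x = \sum_(i < n)
    (f (p + y i + c i x *: e i) - f (p + y i) - c i x *: 'D_(e i) f p).
  rewrite sumrB -/(L x); congr (_ - _).
  have -> : f (p + x) - f p = f (p + y n) - f (p + y 0%N) by rewrite yn y0 addr0.
  have := telescope_sumr (fun k => f (p + y k)) (leq0n n).
  rewrite /= big_mkord => <-.
  by apply: eq_bigr => i _; rewrite yS addrA.
apply: le_trans (nr_sum _ _ _) _.
apply: (@le_trans _ _ (\sum_(i < n) eps / n.+1%:R * nr x)); last first.
  rewrite sumr_const card_ord -[leLHS]mulr_natr mulrAC ler_wpM2r ?nr_ge0//.
  by rewrite -mulrA ger_pMr// mulrC ler_pdivrMr// mul1r ler_nat.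
apply: ler_sum => i _.
have near_seg (s : R) : 0 <= s <= 1 ->
    nr (p + y i + toF s *: (c i x *: e i) - p) < d.
  move=> s01; rewrite addrAC [p + _]addrC addrK.
  have -> : y i + toF s *: (c i x *: e i) = \sum_(j < n | (j < i.+1)%N)
      toF (if j == i then s else 1) *: (c j x *: e j).
    rewrite (bigD1 i) ?ltnSn//= eqxx addrC; congr (_ + _).
    apply: eq_big => j; first by rewrite ltnS ltn_neqAle andbC.
    by move=> ji; rewrite -val_eqE /= ltn_eqF// rmorph1 scale1r.
  by apply: ynr => j; case: ifP => // _; rewrite ler01 lexx.
apply: mean_value => s s01.
  by have [/(_ (e i)) df _] := Hd _ (near_seg s s01); exact: (derivable_scale _ df).1.
have [/(_ (e i)) df /(_ i) Dc] := Hd _ (near_seg s s01).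
rewrite (derivable_scale _ df).2 -scalerBr nrZ mulrC.
by rewrite ler_pM ?nr_ge0 ?(fb_c ec)// ltW.
Qed.

End MeanValue.

(** * Norms of pairs and matrices, and standard bases *)

Section Norms.
Context {R : realType} {b : ground}.
Local Notation F := (base_field R b).

Lemma nr_pairl (V W : normedModType F) (u : V) (v : W) : nr u <= nr (u, v).
Proof.
rewrite -(@le_toF R b) !toF_nr [leRHS]/Num.norm /=.
by rewrite comparable_le_max ?lexx// real_comparable// normr_real.
Qed.

Lemma nr_pairr (V W : normedModType F) (u : V) (v : W) : nr v <= nr (u, v).
Proof.
rewrite -(@le_toF R b) !toF_nr [leRHS]/Num.norm /=.
by rewrite comparable_le_max ?lexx ?orbT// real_comparable// normr_real.
Qed.

Lemma nr_pair_le (V W : normedModType F) (u : V) (v : W) (M : R) :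
  nr u <= M -> nr v <= M -> nr (u, v) <= M.
Proof.
rewrite -!(@le_toF R b) !toF_nr [X in _ -> _ -> X <= _]/Num.norm /= => uM vM.
by rewrite comparable_ge_max ?uM ?vM// real_comparable// normr_real.
Qed.

Lemma nr_pair0 (V W : normedModType F) (u : V) : nr (u, 0 : W) = nr u.
Proof.
by apply/le_anti; rewrite nr_pairl andbT nr_pair_le// nr0 nr_ge0.
Qed.

Lemma nr_0pair (V W : normedModType F) (v : W) : nr (0 : V, v) = nr v.
Proof.
by apply/le_anti; rewrite nr_pairr andbT nr_pair_le// nr0 nr_ge0.
Qed.

Lemma nr_entry m n (A : 'M[F]_(m, n)) i j : nr (A i j : F^o) <= nr A.
Proof.
rewrite -(@le_toF R b) !toF_nr [leRHS]/Num.norm /= mx_normE.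
have -> : `|A i j : F^o| = (`|A i j|%:nng)%:num by [].
rewrite num_le; exact: (le_bigmax _ (fun ij => `|A ij.1 ij.2|%:nng) (i, j)).
Qed.

Lemma nr_mx_le m n (A : 'M[F]_(m, n)) (M : R) : 0 <= M ->
  (forall i j, nr (A i j : F^o) <= M) -> nr A <= M.
Proof.
move=> M0 H; have [->|A0] := eqVneq (nr A) 0; first by [].
have : mx_norm A != 0.
  by apply: contraNneq A0; rewrite /nr [`|A|]/Num.norm /= => ->; rewrite -[0]toF0 toFK.
move=> /mx_norm_neq0[[i j]] /= Aij; apply: le_trans (H i j).
by rewrite /nr [X in reF X <= _]/Num.norm /= Aij.
Qed.

Lemma nr_mulmx m n p (A : 'M[F]_(m, n)) (B : 'M[F]_(n, p)) :
  nr (A *m B) <= n%:R * (nr A * nr B).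
Proof.
apply: nr_mx_le => [|i j]; first by rewrite !mulr_ge0 ?nr_ge0.
rewrite mxE; apply: le_trans (nr_sum (V := F^o) _ _ _) _.
apply: (@le_trans _ _ (\sum_(k < n) nr A * nr B)).
  apply: ler_sum => k _; have -> : nr (A i k * B k j : F^o) =
    nr (A i k : F^o) * nr (B k j : F^o) by exact: nrZ.
  by rewrite ler_pM ?nr_ge0 ?nr_entry.
by rewrite sumr_const card_ord mulr_natl.
Qed.

Definition rv_delta n (i : 'I_n) : 'rV[F]_n := delta_mx 0 i.

Lemma rv_basis n : fin_basis (@rv_delta n) (fun i x => x 0 i).
Proof.
split.
- by move=> x; rewrite [LHS]row_sum_delta.
- by move=> i x y; rewrite mxE.
- by move=> i k x; rewrite mxE.
- by move=> i x; exact: nr_entry.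
- move=> i; apply: nr_mx_le => [|k j]; first exact: ler01.
  rewrite mxE; case: (_ && _) => /=.
    by rewrite -[1%:R](rmorph1 (@toF R b)) nr_toF normr1.
  by rewrite nr0 ler01.
Qed.

Lemma pair_basis (V W : normedModType F) n1 n2 (e1 : 'I_n1 -> V) c1
    (e2 : 'I_n2 -> W) c2 :
  fin_basis e1 c1 -> fin_basis e2 c2 ->
  fin_basis (fun i : 'I_(n1 + n2) => match fintype.split i with
      | inl j => (e1 j, 0) | inr j => (0, e2 j) end)
    (fun i x => match fintype.split i with
      | inl j => c1 j x.1 | inr j => c2 j x.2 end).
Proof.
move=> b1 b2; split.
- move=> [x y]; rewrite big_split_ord /=.
  under eq_bigr => i _ do rewrite (unsplitK (inl _ i)).
  under [X in _ + X]eq_bigr => i _ do rewrite (unsplitK (inr _ i)).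
  have lD : {morph (fun u : V => (u, 0 : W)) : u v / u + v}.
    by move=> u v; rewrite -{1}[0]addr0.
  have rD : {morph (fun v : W => (0 : V, v)) : u v / u + v}.
    by move=> u v; rewrite -{1}[0]addr0.
  transitivity ((x, 0 : W) + (0 : V, y)); first by congr (_, _); rewrite ?addr0 ?add0r.
  rewrite {1}(fb_sum b1 x) {1}(fb_sum b2 y) (big_morph _ lD erefl) (big_morph _ rD erefl).
  by congr (_ + _); apply: eq_bigr => i _; congr (_, _); rewrite ?scaler0.
- by move=> i [x y] [x' y']; case: (fintype.split i) => j /=; rewrite ?(fb_D b1) ?(fb_D b2).
- by move=> i k [x y]; case: (fintype.split i) => j /=; rewrite ?(fb_Z b1) ?(fb_Z b2).
- move=> i [x y]; case: (fintype.split i) => j /=.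
    exact: le_trans (fb_c b1 j x) (nr_pairl _ _).
  exact: le_trans (fb_c b2 j y) (nr_pairr _ _).
- move=> i; case: (fintype.split i) => j /=; first by rewrite nr_pair0 (fb_e b1).
  by rewrite nr_0pair (fb_e b2).
Qed.

Lemma lin_bounded (V W : normedModType F) n (e : 'I_n -> V) c (L : V -> W) :
  fin_basis e c -> {morph L : x y / x + y} -> (forall k x, L (k *: x) = k *: L x) ->
  exists2 K, 0 < K & forall x, nr (L x) <= K * nr x.
Proof.
move=> ec LD LZ; exists (\sum_i nr (L (e i)) + 1).
  by rewrite ltr_wpDl ?sumr_ge0// => i _; exact: nr_ge0.
move=> x; rewrite {1}(fb_sum ec x) (big_morph L LD (_ : L 0 = 0)); last first.
  by rewrite -(scale0r 0) LZ scale0r.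
apply: le_trans (nr_sum _ _ _) _.
rewrite mulrDl mul1r ler_wpDr ?nr_ge0// mulr_suml ler_sum// => i _.
by rewrite LZ nrZ mulrC ler_wpM2l ?nr_ge0// (fb_c ec).
Qed.

End Norms.

(** * Rules of Frechet differentiation *)

Section Frechet.
Context {R : realType} {b : ground}.
Local Notation F := (base_field R b).

Lemma fdiff0 (V W : normedModType F) (f : V -> W) p L : fdiff f p L -> L 0 = 0.
Proof. by move=> H; rewrite -(scale0r 0) (fdiffZ H) scale0r. Qed.

Lemma fdiff_lip (V W : normedModType F) (f : V -> W) p L : fdiff f p L ->
  exists2 K, 0 < K & exists2 d, 0 < d & forall x, nr x < d ->
    nr (f (p + x) - f p) <= K * nr x.
Proof.
move=> H; have [K K0 HK] := fdiff_bound H.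
have [d d0 Hd] := fdiff_near H ltr01.
exists (K + 1); first by rewrite addr_gt0.
exists d => // x /Hd; rewrite mul1r => Hx.
rewrite -(subrK (L x) (_ - _)) addrC mulrDl mul1r.
by apply: le_trans (nrD _ _) _; apply: lerD.
Qed.

Lemma fdiff_near_eq (V W : normedModType F) (f g : V -> W) p L :
  (\forall q \near p, f q = g q) -> fdiff f p L -> fdiff g p L.
Proof.
move=> fg [LD LZ LB H]; split=> // e e0; have [d1 d10 H1] := H e e0.
have [d2 d20 H2] := (nbhs_nrP p _).1 fg.
exists (Num.min d1 d2); first by rewrite lt_min d10.
move=> x; rewrite lt_min => /andP[x1 x2].
rewrite -(H2 (p + x)); last by rewrite addrAC subrr add0r.
by rewrite -(H2 p); [exact: H1 | rewrite subrr nr0].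
Qed.

Lemma fdiff_lin (V W : normedModType F) (L : V -> W) p :
  {morph L : x y / x + y} -> (forall k x, L (k *: x) = k *: L x) ->
  (exists2 K, 0 < K & forall x, nr (L x) <= K * nr x) -> fdiff L p L.
Proof.
move=> LD LZ LB; split=> // e e0; exists 1 => // x _.
by rewrite LD [L p + _]addrC addrK subrr nr0 mulr_ge0 ?nr_ge0// ltW.
Qed.

Lemma fdiff_cst (V W : normedModType F) (w : W) (p : V) :
  fdiff (fun _ => w) p (fun _ => 0).
Proof.
split=> [x y|c x||e e0]; rewrite ?addr0 ?scaler0//.
  by exists 1 => // x; rewrite nr0 mul1r nr_ge0.
by exists 1 => // x _; rewrite subrr subr0 nr0 mulr_ge0 ?nr_ge0// ltW.
Qed.

Lemma fdiff_id (V : normedModType F) (p : V) : fdiff id p id.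
Proof. by apply: fdiff_lin => //; exists 1 => // x; rewrite mul1r. Qed.

Lemma fdiff_add (V W : normedModType F) (f g : V -> W) p L M :
  fdiff f p L -> fdiff g p M -> fdiff (fun x => f x + g x) p (fun x => L x + M x).
Proof.
move=> Hf Hg; split.
- by move=> x y; rewrite (fdiffD Hf) (fdiffD Hg) addrACA.
- by move=> k x; rewrite (fdiffZ Hf) (fdiffZ Hg) scalerDr.
- have [K K0 HK] := fdiff_bound Hf; have [K' K'0 HK'] := fdiff_bound Hg.
  exists (K + K'); first by rewrite addr_gt0.
  by move=> x; rewrite mulrDl; apply: le_trans (nrD _ _) _; exact: lerD.
move=> e e0; have e20 : 0 < e / 2 by rewrite divr_gt0.
have [d d0 Hd] := fdiff_near Hf e20; have [d' d'0 Hd'] := fdiff_near Hg e20.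
exists (Num.min d d'); first by rewrite lt_min d0.
move=> x; rewrite lt_min => /andP[x1 x2]; rewrite [e]splitr mulrDl.
have -> : f (p + x) + g (p + x) - (f p + g p) - (L x + M x) =
    (f (p + x) - f p - L x) + (g (p + x) - g p - M x).
  by rewrite [RHS]addrACA -opprD [in RHS]addrACA -opprD.
by apply: le_trans (nrD _ _) _; apply: lerD; [exact: Hd|exact: Hd'].
Qed.

Lemma fdiff_pair (V W1 W2 : normedModType F) (f : V -> W1) (g : V -> W2) p L M :
  fdiff f p L -> fdiff g p M -> fdiff (fun x => (f x, g x)) p (fun x => (L x, M x)).
Proof.
move=> Hf Hg; split.
- by move=> x y; rewrite (fdiffD Hf) (fdiffD Hg).
- by move=> k x; rewrite (fdiffZ Hf) (fdiffZ Hg).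
- have [K K0 HK] := fdiff_bound Hf; have [K' K'0 HK'] := fdiff_bound Hg.
  exists (K + K'); first by rewrite addr_gt0.
  move=> x; rewrite mulrDl; apply: nr_pair_le.
    by apply: le_trans (HK x) _; rewrite lerDl mulr_ge0 ?nr_ge0// ltW.
  by apply: le_trans (HK' x) _; rewrite lerDr mulr_ge0 ?nr_ge0// ltW.
move=> e e0.
have [d d0 Hd] := fdiff_near Hf e0; have [d' d'0 Hd'] := fdiff_near Hg e0.
exists (Num.min d d'); first by rewrite lt_min d0.
move=> x; rewrite lt_min => /andP[x1 x2].
by apply: nr_pair_le; [exact: Hd|exact: Hd'].
Qed.

Lemma fdiff_comp (V W Z : normedModType F) (f : V -> W) (g : W -> Z) p L M :
  fdiff f p L -> fdiff g (f p) M -> fdiff (g \o f) p (M \o L).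
Proof.
move=> Hf Hg; have [K K0 HK] := fdiff_bound Hf; have [K' K'0 HK'] := fdiff_bound Hg.
split=> /=.
- by move=> x y; rewrite (fdiffD Hf) (fdiffD Hg).
- by move=> k x; rewrite (fdiffZ Hf) (fdiffZ Hg).
- exists (K' * K); first by rewrite mulr_gt0.
  move=> x; apply: le_trans (HK' _) _; rewrite -mulrA.
  by rewrite ler_wpM2l// ltW.
move=> e e0.
have [C C0 [d1 d10 H1]] := fdiff_lip Hf.
have [d2 d20 H2] := fdiff_near Hg (divr_gt0 (divr_gt0 e0 (ltr0Sn _ 1)) C0).
have [d3 d30 H3] := fdiff_near Hf (divr_gt0 (divr_gt0 e0 (ltr0Sn _ 1)) K'0).
exists (Num.min d1 (Num.min (d2 / C) d3)).
  by rewrite !lt_min d10 d30 divr_gt0.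
move=> x; rewrite !lt_min => /and3P[x1 x2 x3].
have fx : f (p + x) = f p + (f (p + x) - f p) by rewrite subrKC.
rewrite /= [in X in g X - _]fx; set y := f (p + x) - f p.
have -> : g (f p + y) - g (f p) - M (L x) =
    (g (f p + y) - g (f p) - M y) + M (y - L x).
  rewrite -[- L x]scaleN1r (fdiffD Hg) (fdiffZ Hg) scaleN1r [RHS]addrA subrK//.
have yC : nr y <= C * nr x := H1 _ x1.
rewrite [e]splitr mulrDl; apply: le_trans (nrD _ _) _; apply: lerD.
  apply: le_trans (H2 y _) _.
    by apply: le_lt_trans yC _; rewrite mulrC -ltr_pdivlMr.
  apply: (le_trans (ler_wpM2l _ yC)); first by rewrite !divr_ge0// ltW.
  by rewrite mulrA divfK// lt0r_neq0.
apply: le_trans (HK' _) _; apply: le_trans (ler_wpM2l (ltW K'0) (H3 x x3)) _.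
by rewrite mulrA [K' * _]mulrC divfK// lt0r_neq0.
Qed.

Lemma fdiff_bilin (V W1 W2 Z : normedModType F) (f : V -> W1) (g : V -> W2)
    (B : W1 -> W2 -> Z) (k : R) p L M :
  (forall u v w, B (u + v) w = B u w + B v w) ->
  (forall u v w, B u (v + w) = B u v + B u w) ->
  (forall c u v, B (c *: u) v = c *: B u v) ->
  (forall c u v, B u (c *: v) = c *: B u v) ->
  0 < k -> (forall u v, nr (B u v) <= k * (nr u * nr v)) ->
  fdiff f p L -> fdiff g p M ->
  fdiff (fun x => B (f x) (g x)) p (fun x => B (L x) (g p) + B (f p) (M x)).
Proof.
move=> BDl BDr BZl BZr k0 Bk Hf Hg.
have [K K0 HK] := fdiff_bound Hf; have [K' K'0 HK'] := fdiff_bound Hg.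
split.
- by move=> x y; rewrite (fdiffD Hf) (fdiffD Hg) BDl BDr addrACA.
- by move=> c x; rewrite (fdiffZ Hf) (fdiffZ Hg) BZl BZr scalerDr.
- exists (k * (K * (nr (g p) + 1)) + k * ((nr (f p) + 1) * K')).
    by rewrite addr_gt0 ?mulr_gt0 ?ltr_wpDl ?nr_ge0.
  move=> x; rewrite mulrDl; apply: le_trans (nrD _ _) _; apply: lerD.
    apply: le_trans (Bk _ _) _; rewrite -mulrA ler_wpM2l ?(ltW k0)// mulrAC.
    by rewrite ler_pM ?nr_ge0// lerDl.
  apply: le_trans (Bk _ _) _; rewrite -mulrA ler_wpM2l ?(ltW k0)// -mulrA.
  by rewrite ler_pM ?nr_ge0// lerDl.
move=> e e0.
have [C C0 [d1 d10 H1]] := fdiff_lip Hg.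
pose gn := nr (g p) + 1; pose fn := nr (f p) + 1.
have gn0 : 0 < gn by rewrite ltr_wpDl ?nr_ge0.
have fn0 : 0 < fn by rewrite ltr_wpDl ?nr_ge0.
have e30 : 0 < e / 3%:R by rewrite divr_gt0.
have [d2 d20 H2] := fdiff_near Hf (divr_gt0 (divr_gt0 e30 k0) gn0).
have [d3 d30 H3] := fdiff_near Hg (divr_gt0 (divr_gt0 e30 k0) fn0).
(* The bound [1 / C] keeps [nr (g (p + x))] at most [gn]; the last one makes the quadratic term
   [B (L x) z] at most a third of [e * nr x]. *)
exists (Num.min (Num.min d1 (1 / C)) (Num.min (Num.min d2 d3) (e / 3%:R / (k * (K * C))))).
  by rewrite !lt_min d10 d20 d30 !divr_gt0// !mulr_gt0.
move=> x; rewrite !lt_min => /andP[/andP[x1 xC] /andP[/andP[x2 x3] x4]].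
set y := f (p + x) - f p; set z := g (p + x) - g p.
have -> : B (f (p + x)) (g (p + x)) - B (f p) (g p) - (B (L x) (g p) + B (f p) (M x))
   = B (y - L x) (g (p + x)) + B (L x) z + B (f p) (z - M x).
  have BNl u v : B (- u) v = - B u v by rewrite -scaleN1r BZl scaleN1r.
  have BNr u v : B u (- v) = - B u v by rewrite -scaleN1r BZr scaleN1r.
  rewrite /y /z !(BDl, BDr, BNl, BNr).
  set a1 := B (f (p + x)) _; set a2 := B (f p) (g (p + x)); set a3 := B (L x) (g (p + x)).
  set a4 := B (L x) _; set a5 := B (f p) (g p); set a6 := B _ (M x).
  rewrite opprD !addrA subrK [a1 - a2 - a4]addrAC subrK.
  by rewrite [a1 - a4 - a5]addrAC.
have gx : nr (g (p + x)) <= gn.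
  apply: le_trans (nrBr _ (g p)) _; rewrite lerD2l; apply: le_trans (H1 _ x1) _; rewrite mulrC.
  by rewrite -ler_pdivlMr// ltW.
have e3 : e = e / 3%:R + e / 3%:R + e / 3%:R by field.
have zC : nr z <= C * nr x := H1 _ x1.
rewrite e3 !mulrDl; apply: le_trans (nrD _ _) _; apply: lerD; first apply: le_trans (nrD _ _) _; first apply: lerD.
- apply: le_trans (Bk _ _) _.
  apply: (@le_trans _ _ (k * ((e / 3%:R / k / gn * nr x) * gn))).
    by rewrite ler_wpM2l ?(ltW k0)// ler_pM ?nr_ge0// H2.
  by rewrite le_eqVlt; apply/orP; left; apply/eqP; field; rewrite !lt0r_neq0.
- apply: le_trans (Bk _ _) _.
  apply: (@le_trans _ _ (k * ((K * nr x) * (C * nr x)))).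
    by rewrite ler_wpM2l ?(ltW k0)// ler_pM ?nr_ge0.
  have -> : k * (K * nr x * (C * nr x)) = (nr x * (k * (K * C))) * nr x by ring.
  by rewrite ler_wpM2r ?nr_ge0// -ler_pdivlMr ?mulr_gt0// ltW.
- apply: le_trans (Bk _ _) _.
  apply: (@le_trans _ _ (k * (fn * (e / 3%:R / k / fn * nr x)))).
    by rewrite ler_wpM2l ?(ltW k0)// ler_pM ?nr_ge0 ?lerDl// H3.
  by rewrite le_eqVlt; apply/orP; left; apply/eqP; field; rewrite !lt0r_neq0.
Qed.

End Frechet.

(** * Second-order differences *)

Section SecondOrder.
Context {R : realType} {b : ground}.
Local Notation F := (base_field R b).
Local Notation toF := (@toF R b).

Lemma nbhs_nr_ball (V : normedModType F) (p q : V) (d : R) :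
  nr (q - p) < d -> nbhs q [set y | nr (y - p) < d].
Proof.
move=> qd; apply/nbhs_nrP; exists (d - nr (q - p)); first by rewrite subr_gt0.
move=> y /= yq; apply: le_lt_trans (nr_tri _ q _) _.
by rewrite -ltrBrDr.
Qed.

Lemma nr_segment (V : normedModType F) (p u v : V) (d s : R) :
  nr (u - p) < d -> nr (v - p) < d -> 0 <= s <= 1 ->
  nr (u + toF s *: (v - u) - p) < d.
Proof.
move=> ud vd /andP[s0 s1].
have -> : u + toF s *: (v - u) - p = toF (1 - s) *: (u - p) + toF s *: (v - p).
  rewrite rmorphB rmorph1 scalerBl scale1r -[RHS]addrA -scalerN -scalerDr opprB.
  by rewrite [p - u + _]addrC addrA subrK addrAC.
apply: le_lt_trans (nrD _ _) _; rewrite !nrZt !ger0_norm ?subr_ge0//.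
have [->|sn0] := eqVneq s 0; first by rewrite subr0 mul1r mul0r addr0.
have s0' : 0 < s by rewrite lt_neqAle eq_sym sn0.
rewrite [ltRHS](_ : d = (1 - s) * d + s * d); last by ring.
apply: ler_ltD.
  by rewrite ler_wpM2l ?subr_ge0// ltW.
by rewrite ltr_pM2l.
Qed.

Lemma Ck_fdiff (E W : normedModType F) n (e : 'I_n -> E) c k U (f : E -> W) p :
  fin_basis e c -> nbhs p U -> Ck k.+1 U f -> fdiff f p (fun x => 'D_x f p).
Proof.
move=> ec pU [_ Hf]; apply: (C1_fdiff ec).
  by apply: filterS pU => q Uq v; exact: (Hf v).1.
by move=> v; case: (Hf v) => _; case: k {Hf} => [|k] [Hc _]; apply: Hc; exact: nbhs_singleton.
Qed.

Lemma Ck_derive (E W : normedModType F) k U (f : E -> W) v :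
  Ck k.+1 U f -> Ck k U ('D_v f).
Proof. by case=> _ /(_ v)[]. Qed.

Lemma fdiff_shift (E W : normedModType F) (f : E -> W) p c L :
  fdiff f (p + c) L -> fdiff (fun z => f (z + c)) p L.
Proof.
move=> [LD LZ LB H]; split=> // e /H[d d0 Hd]; exists d => // x xd.
by rewrite [p + x + c]addrAC; exact: Hd.
Qed.

Lemma derive_basis (E W : normedModType F) n (e : 'I_n -> E) c (f : E -> W) p :
  fin_basis e c -> fdiff f p (fun x => 'D_x f p) ->
  forall x, 'D_x f p = \sum_i c i x *: 'D_(e i) f p.
Proof.
move=> ec Hf x; rewrite {1}(fb_sum ec x).
rewrite (big_morph _ (fdiffD Hf) (fdiff0 Hf)).
by apply: eq_bigr => i _; rewrite (fdiffZ Hf).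
Qed.

(** Two applications of the mean value inequality, one per variable, bound the mixed difference by
    the product of both increments. For the group product this says that it is addition up to a
    bilinear error. *)
Lemma mixed_difference (E W : normedModType F) n (e : 'I_n -> E) c U
    (f : E * E -> W) (o1 o2 : E) :
  fin_basis e c -> nbhs (o1, o2) U -> Ck 2 U f ->
  exists2 C : R, 0 < C & exists2 d : R, 0 < d & forall u u' v v',
    nr (u - o1) < d -> nr (u' - o1) < d -> nr (v - o2) < d -> nr (v' - o2) < d ->
    nr (f (u, v) - f (u', v) - (f (u, v') - f (u', v'))) <=
      C * (nr (u - u') * nr (v - v')).
Proof.
move=> ec pU Hf; have ee := pair_basis ec ec.
pose g i := 'D_(e i, 0 : E) f.
have Hg i : Ck 1 U (g i) by exact: Ck_derive.
(* The added 1 makes the bound strict at the base point, so that it persists nearby by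
   continuity. *)
pose K i j := nr ('D_(0 : E, e j) (g i) (o1, o2)) + 1.
have nearK : nbhs (o1, o2) [set q | forall ij : 'I_n * 'I_n,
    nr ('D_(0 : E, e ij.2) (g ij.1) q) < K ij.1 ij.2].
  apply: (@filter_forall (E * E)%type ('I_n * 'I_n)%type (fun ij => [set q |
    nr ('D_(0 : E, e ij.2) (g ij.1) q) < K ij.1 ij.2]) (nbhs (o1, o2)) _) => -[i j] /=.
  have [Hc _] := Ck_derive (0 : E, e j) (Hg i).
  have [d d0 Hd] := (nr_cvgP _ _).1 (Hc _ (nbhs_singleton pU)) _ ltr01.
  apply: (nbhs_nrP _ _).2; exists d => // q /Hd qd.
  by apply: le_lt_trans (nrBr _ ('D_(0 : E, e j) (g i) (o1, o2))) _; rewrite ltrD2l.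
have [d d0 Hd] := (nbhs_nrP _ _).1 (filterI pU nearK).
pose S := \sum_i \sum_j K i j.
have K0 i j : 0 <= K i j by rewrite addr_ge0 ?nr_ge0.
have S0 : 0 <= S by rewrite sumr_ge0// => i _; rewrite sumr_ge0.
exists (S + 1); first by rewrite ltr_wpDl.
exists d => // u u' v v' ud ud' vd vd'.
have inball (a a' : E) : nr (a - o1) < d -> nr (a' - o2) < d ->
    nr ((a, a') - (o1, o2)) < d.
  move=> ad ad'; apply: le_lt_trans (_ : Num.max (nr (a - o1)) (nr (a' - o2)) < d).
    by apply: nr_pair_le; rewrite le_max lexx ?orbT.
  by rewrite gt_max ad.
have Unbhs (q : E * E) : nr (q - (o1, o2)) < d -> nbhs q U.
  by move=> /nbhs_nr_ball; apply: filterS => y /Hd[].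
have fq (q : E * E) : nr (q - (o1, o2)) < d -> fdiff f q (fun x => 'D_x f q).
  by move=> /Unbhs qU; exact: (Ck_fdiff ee qU Hf).
have gq i (q : E * E) : nr (q - (o1, o2)) < d ->
    fdiff (g i) q (fun x => 'D_x (g i) q).
  by move=> /Unbhs qU; exact: (Ck_fdiff ee qU (Hg i)).
set x := u - u'; set y := v - v'.
have gy i a : nr (a - o1) < d ->
    nr (g i (a, v) - g i (a, v')) <= (\sum_j K i j) * nr y.
  move=> ad.
  have -> : (a, v) = (a, v') + (0, y) :> E * E.
    by apply/eqP; rewrite xpair_eqE /= addr0 subrKC !eqxx.
  rewrite -[_ - _]subr0.
  have seg (s : R) : 0 <= s <= 1 ->
      nr ((a, v') + toF s *: (0 : E, y) - (o1, o2)) < d.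
    move=> s01; have -> : (a, v') + toF s *: (0 : E, y) = (a, v' + toF s *: y).
      by apply/eqP; rewrite xpair_eqE /= scaler0 addr0 !eqxx.
    by apply: inball => //; apply: nr_segment.
  apply: mean_value => s /seg qd; first exact: (fdiff_derive (gq i _ qd) _).1.
  rewrite subr0 (derive_basis ee (gq i _ qd)) big_split_ord /=.
  rewrite big1 ?add0r => [|j _]; last first.
    by rewrite (unsplitK (inl _ j)) (_ : c j 0 = 0) ?scale0r// -(scale0r 0) (fb_Z ec) mul0r.
  apply: le_trans (nr_sum _ _ _) _; rewrite mulr_suml ler_sum// => j _.
  rewrite (unsplitK (inr _ j)) nrZ mulrC ler_pM ?nr_ge0 ?(fb_c ec)//.
  by have [_ /(_ (i, j))/ltW] := Hd _ qd.
(* The mixed difference is a difference of [G] in the first variable; the derivative of [G] there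
   consists of differences of the partial derivatives [g i], which [gy] controls. *)
pose G q := f (q + (0, y)) + - f q.
have -> : f (u, v) - f (u', v) - (f (u, v') - f (u', v')) =
    G ((u', v') + (x, 0)) - G (u', v') - 0.
  have e1 : (u', v') + (x, 0) = (u, v') :> E * E.
    by apply/eqP; rewrite xpair_eqE /= addr0 subrKC !eqxx.
  have e2 : (u, v') + (0, y) = (u, v) :> E * E.
    by apply/eqP; rewrite xpair_eqE /= addr0 subrKC !eqxx.
  have e3 : (u', v') + (0, y) = (u', v) :> E * E.
    by apply/eqP; rewrite xpair_eqE /= addr0 subrKC !eqxx.
  rewrite /G e1 e2 e3 subr0 !opprB !addrA.
  by rewrite [LHS]addrAC [X in X + _ = _]addrAC [LHS]addrAC.
have seg (s : R) : 0 <= s <= 1 -> nr (u' + toF s *: x - o1) < d.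
  by move=> s01; apply: nr_segment.
have Gd (s : R) : 0 <= s <= 1 -> let q := (u', v') + toF s *: (x, 0 : E) in
    fdiff G q (fun z => 'D_z f (q + (0, y)) + - 'D_z f q).
  move=> s01 q; have sd := seg s s01.
  have eq : q = (u' + toF s *: x, v').
    by apply/eqP; rewrite xpair_eqE /= scaler0 addr0 !eqxx.
  have eq' : q + (0, y) = (u' + toF s *: x, v).
    by apply/eqP; rewrite eq xpair_eqE /= addr0 subrKC !eqxx.
  apply: fdiff_add.
    apply: fdiff_shift; apply: fq; rewrite eq'; exact: inball.
  have qd : nr (q - (o1, o2)) < d by rewrite eq; exact: inball.
  have NL : fdiff (fun z : W => - z) (f q) (fun z : W => - z).
    apply: fdiff_lin => [a a'|k a|]; [exact: opprD | by rewrite scalerN |].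
    by exists 1 => // a; rewrite nrN mul1r.
  exact: (fdiff_comp (fq _ qd) NL).
apply: mean_value => s s01; have [dG DG] := fdiff_derive (Gd s s01) (x, 0).
  exact: dG.
rewrite DG subr0; have sd := seg s s01.
have -> : (u', v') + toF s *: (x, 0 : E) = (u' + toF s *: x, v').
  by apply/eqP; rewrite xpair_eqE /= scaler0 addr0 !eqxx.
have -> : (u' + toF s *: x, v') + (0, y) = (u' + toF s *: x, v).
  by apply/eqP; rewrite xpair_eqE /= addr0 subrKC !eqxx.
have Dx q : nr (q - (o1, o2)) < d -> 'D_(x, 0) f q = \sum_i c i x *: g i q.
  move=> qd; rewrite (derive_basis ee (fq _ qd)) big_split_ord /=.
  rewrite [X in _ + X]big1 ?addr0 => [|j _].
    by apply: eq_bigr => i _; rewrite (unsplitK (inl _ i)).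
  by rewrite (unsplitK (inr _ j)) (_ : c j 0 = 0) ?scale0r// -(scale0r 0) (fb_Z ec) mul0r.
rewrite !Dx; [|exact: inball..].
rewrite -sumrB; apply: le_trans (nr_sum _ _ _) _.
apply: (@le_trans _ _ (S * (nr x * nr y))); last first.
  by rewrite ler_wpM2r ?mulr_ge0 ?nr_ge0// lerDl.
rewrite mulr_suml ler_sum// => i _; rewrite -scalerBr nrZ mulrCA.
by rewrite ler_pM ?nr_ge0 ?(fb_c ec)// gy.
Qed.

End SecondOrder.

(** * Limits of sequences with geometric increments *)

Section Completeness.
Context {R : realType}.

(** With [r n] the tail of the geometric series, the intervals from [u n - r n] to [u n + r n] are
    nested, and the supremum of their left ends lies in all of them. *)
Lemma real_geometric_complete (u : nat -> R) (K : R) :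
  (forall n, `|u n.+1 - u n| <= K / 2 ^+ n) ->
  exists l, forall n, `|u n - l| <= 2 * K / 2 ^+ n.
Proof.
move=> H; pose r n := 2 * K / 2 ^+ n.
have K0 : 0 <= K by have := H 0%N; rewrite expr0 divr1; exact: le_trans.
have rS n : r n = K / 2 ^+ n + r n.+1.
  rewrite /r exprS; field; rewrite expf_neq0//.
have r0 n : 0 <= r n by rewrite divr_ge0 ?mulr_ge0// exprn_ge0.
have main n k : `|u (n + k)%N - u n| <= r n - r (n + k)%N.
  elim: k => [|k IH]; first by rewrite addn0 !subrr normr0.
  rewrite addnS; apply: le_trans (ler_distD (u (n + k)%N) _ _) _.
  have -> : r n - r (n + k).+1 = (r (n + k)%N - r (n + k).+1) + (r n - r (n + k)%N).
    by ring.
  apply: lerD => //; apply: le_trans (H _) _.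
  by rewrite [in leRHS]rS addrK.
have ble m n : u m - r m <= u n + r n.
  have [mn|/ltnW nm] := leqP m n.
    have := main m (n - m)%N; rewrite subnKC// ler_norml => /andP[h _].
    have := r0 n; lra.
  have := main n (m - n)%N; rewrite subnKC// ler_norml => /andP[_ h].
  have := r0 m; lra.
pose S := range (fun m => u m - r m).
have hS : has_sup S.
  by split; [exists (u 0%N - r 0%N), 0%N | exists (u 0%N + r 0%N) => _ [m _ <-]].
exists (sup S) => n; rewrite ler_distlC; apply/andP; split.
  by apply: sup_upper_bound => //; exists n.
by apply: ge_sup; [case: hS | move=> _ [m _ <-]].
Qed.

(** The factor 4 is twice the real factor 2, once for the real and once for the imaginary part. *)
Lemma scalar_geometric_complete (b : ground) (u : nat -> base_field R b) (K : R) :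
  (forall k, nr (u k.+1 - u k : (base_field R b)^o) <= K / 2 ^+ k) ->
  exists l : base_field R b,
    forall k, nr (u k - l : (base_field R b)^o) <= 4 * K / 2 ^+ k.
Proof.
move=> H; have K0 : 0 <= K.
  by have := H 0%N; rewrite expr0 divr1; apply: le_trans; exact: nr_ge0.
have half k : 2 * K / 2 ^+ k <= 4 * K / 2 ^+ k.
  by rewrite ler_wpM2r ?invr_ge0 ?exprn_ge0// ler_wpM2r// ler_nat.
case: b u H => u H.
  have [l Hl] := @real_geometric_complete u K H.
  by exists l => k; apply: le_trans (half k); exact: Hl.
have nrE (z : R[i]) : nr (z : (base_field R Complexes)^o) = Num.sqrt (complex.Re z ^+ 2 + complex.Im z ^+ 2).
  exact: (congr1 (@complex.Re R) (normc_def z)).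
have Rele (z : R[i]) : `|complex.Re z| <= nr (z : (base_field R Complexes)^o).
  by rewrite nrE -sqrtr_sqr ler_wsqrtr// lerDl sqr_ge0.
have Imle (z : R[i]) : `|complex.Im z| <= nr (z : (base_field R Complexes)^o).
  by rewrite nrE -sqrtr_sqr ler_wsqrtr// lerDr sqr_ge0.
have [x Hx] := @real_geometric_complete (fun k => complex.Re (u k)) K (fun k =>
  le_trans (eq_ind _ (fun t => `|t| <= _) (Rele _) _ (raddfB (@complex.Re R : Rcomplex R -> R) (u k.+1) (u k))) (H k)).
have [y Hy] := @real_geometric_complete (fun k => complex.Im (u k)) K (fun k =>
  le_trans (eq_ind _ (fun t => `|t| <= _) (Imle _) _ (raddfB (@complex.Im R : Rcomplex R -> R) (u k.+1) (u k))) (H k)).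
exists (x +i* y)%C => k.
have -> : 4 * K / 2 ^+ k = 2 * K / 2 ^+ k + 2 * K / 2 ^+ k by field; rewrite expf_neq0.
have sum_le (z : R[i]) : nr (z : (base_field R Complexes)^o) <= `|complex.Re z| + `|complex.Im z|.
  rewrite nrE -[leRHS]ger0_norm ?addr_ge0// -sqrtr_sqr ler_wsqrtr//.
  rewrite sqrrD !real_normK ?num_real//.
  by rewrite [leRHS]addrAC lerDl mulrn_wge0// mulr_ge0.
apply: le_trans (sum_le _) _; apply: lerD.
  by have := Hx k; case: (u k).
by have := Hy k; case: (u k).
Qed.

Lemma geometric_complete (b : ground) m n (u : nat -> 'M[base_field R b]_(m, n))
    (K : R) :
  (forall k, nr (u k.+1 - u k) <= K / 2 ^+ k) ->
  exists l, forall k, nr (u k - l) <= 4 * K / 2 ^+ k.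
Proof.
move=> H; have K0 : 0 <= K.
  by have := H 0%N; rewrite expr0 divr1; apply: le_trans; exact: nr_ge0.
have H1 i j : exists l : base_field R b,
    forall k, nr (u k i j - l : (base_field R b)^o) <= 4 * K / 2 ^+ k.
  apply: (@scalar_geometric_complete _ (fun k => u k i j)) => k.
  by apply: le_trans (H k); have := nr_entry (u k.+1 - u k) i j; rewrite !mxE.
have [l Hl] := choice (fun ij : 'I_m * 'I_n => H1 ij.1 ij.2).
exists (\matrix_(i, j) l (i, j)) => k; apply: nr_mx_le => [|i j].
  by rewrite divr_ge0 ?mulr_ge0// exprn_ge0.
by rewrite !mxE; exact: (Hl (i, j)).
Qed.

End Completeness.

(** * Square roots of Cayley transforms *)

Section MatrixNorm.
Context {R : realType} {b : ground} {N : nat}.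
Local Notation F := (base_field R b).
Local Notation M := 'M[F]_N.
Implicit Types A B P Q X Y : M.

(** The factor [N] makes the maximum norm submultiplicative. The price is that the identity matrix
    has norm [N] and not 1. *)
Definition nm A : R := N%:R * nr A.

Lemma nm_ge0 A : 0 <= nm A.
Proof. by rewrite mulr_ge0 ?nr_ge0. Qed.

Lemma nr_le_nm A : nr A <= nm A.
Proof.
rewrite /nm; case: N A => [|n] A.
  by rewrite flatmx0 nr0 mulr0.
by rewrite ler_peMl ?nr_ge0// ler1n.
Qed.

Lemma nm0 : nm 0 = 0. Proof. by rewrite /nm nr0 mulr0. Qed.

Lemma nm_eq0 A : nm A = 0 -> A = 0.
Proof.
by move=> A0; apply: nr_eq0; apply/le_anti; rewrite nr_ge0 andbT -A0 nr_le_nm.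
Qed.

Lemma nmD A B : nm (A + B) <= nm A + nm B.
Proof. by rewrite -mulrDr ler_wpM2l// nrD. Qed.

Lemma nmN A : nm (- A) = nm A.
Proof. by rewrite /nm nrN. Qed.

Lemma nmC A B : nm (A - B) = nm (B - A).
Proof. by rewrite /nm nrC. Qed.

Lemma nm_tri A B C : nm (A - C) <= nm (A - B) + nm (B - C).
Proof. by apply: le_trans (nmD _ _); rewrite addrA subrK. Qed.

Lemma nmBr A B : nm A <= nm B + nm (A - B).
Proof. by rewrite -{1}[A](subrKC B) nmD. Qed.

Lemma nmZ (t : R) A : nm (toF t *: A) = `|t| * nm A.
Proof. by rewrite /nm nrZt mulrCA. Qed.

Lemma nmM A B : nm (A *m B) <= nm A * nm B.
Proof.
apply: le_trans (ler_wpM2l _ (nr_mulmx A B)) _ => //.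
by rewrite le_eqVlt; apply/orP; left; apply/eqP; rewrite /nm; ring.
Qed.

Lemma nm_small_eq A : (forall e : R, 0 < e -> nm A <= e) -> A = 0.
Proof.
move=> H; apply: nm_eq0; apply/le_anti; rewrite nm_ge0 andbT.
by apply/ler_addgt0Pr => e e0; rewrite add0r H.
Qed.

(** A matrix [K] with [K *m (1%:M - A) = 0] satisfies [K = K *m A], hence [nm K <= nm K * nm A],
    which forces [K = 0]. No Neumann series is involved. *)
Lemma unit_1B A : nm A < 1 -> 1%:M - A \in unitmx.
Proof.
move=> A1; rewrite -row_free_unit -kermx_eq0; apply/eqP.
set K := kermx _; have : K *m (1%:M - A) = 0 by exact: mulmx_ker.
rewrite mulmxBr mulmx1 => /subr0_eq KA; apply: nm_eq0.
have := nmM K A; rewrite -KA => h.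
by have := nm_ge0 K; nra.
Qed.

Lemma nm_invmx A X : nm A <= 1 / 2 -> nm (X *m invmx (1%:M - A)) <= 2 * nm X.
Proof.
move=> A1; have Au : 1%:M - A \in unitmx by apply: unit_1B; lra.
set Y := X *m _; have XY : X = Y *m (1%:M - A) by rewrite mulmxKV.
have YX : Y - X = Y *m A.
  by rewrite [in LHS]XY mulmxBr mulmx1 opprB addrC subrK.
have := nmM Y A; have := nmBr Y X; rewrite YX => h1 h2.
by have := nm_ge0 Y; nra.
Qed.

Lemma pow_le (a : R) k : 0 <= a -> k%:R * a <= 1 / 2 ->
  (1 + a) ^+ k <= 1 + 2 * k%:R * a.
Proof.
move=> a0; elim: k => [|k IH]; first by rewrite expr0 mulr0 mul0r addr0.
rewrite exprS -natr1 mulrDl mul1r => ka.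
have k0 : 0 <= k%:R * a by rewrite mulr_ge0.
have := IH ltac:(lra).
set x := (1 + a) ^+ k => xk; set n := k%:R : R; rewrite -/n in ka k0 xk *.
have := ler_wpM2l (_ : 0 <= 1 + a) xk; rewrite addr_ge0// => /(_ isT).
by nra.
Qed.

Lemma pow_le2 (a : R) k : 0 <= a -> k%:R * a <= 1 / 2 -> (1 + a) ^+ k <= 2.
Proof. by move=> a0 ka; have := pow_le a0 ka; lra. Qed.

Fixpoint mpow A k : M := if k is k'.+1 then mpow A k' *m A else 1%:M.

Lemma mpowD A j k : mpow A (j + k) = mpow A j *m mpow A k.
Proof. by elim: k => [|k IH]; rewrite ?addn0 ?mulmx1// addnS /= IH mulmxA. Qed.

Lemma mpowM A j k : mpow A (j * k) = mpow (mpow A j) k.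
Proof. by elim: k => [|k IH]; rewrite ?muln0// mulnS addnC mpowD IH. Qed.

(** The right factor [X] keeps [nm 1%:M], which is [N], out of the estimate; the same holds for
    [nm_invmx]. *)
Lemma nm_mul_pow Q X k : nm (mpow (1%:M + Q) k *m X) <= (1 + nm Q) ^+ k * nm X.
Proof.
elim: k X => [|k IH] X /=; first by rewrite mul1mx expr0 mul1r.
rewrite -mulmxA; apply: le_trans (IH _) _.
rewrite exprSr -mulrA ler_wpM2l ?exprn_ge0 ?addr_ge0 ?nm_ge0//.
rewrite mulmxDl mul1mx mulrDl mul1r.
by apply: le_trans (nmD _ _) _; rewrite lerD2l nmM.
Qed.

(** Telescoping: [k] terms, in each of which the remaining factors are bounded since
    [(1 + a) ^+ k <= 2]. For [k = 2 ^ n] the error of the factors grows only by [4 * 2 ^ n], so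
    errors that are [o(2 ^- n)] vanish in the limit. *)
Lemma nm_pow_diff P Q (a : R) k : nm P <= a -> nm Q <= a -> k%:R * a <= 1 / 2 ->
  nm (mpow (1%:M + P) k - mpow (1%:M + Q) k) <= 4 * k%:R * nm (P - Q).
Proof.
move=> Pa Qa ka; have a0 : 0 <= a by exact: le_trans (nm_ge0 P) Pa.
have le2 j : (j <= k)%N -> (1 + a) ^+ j <= 2.
  move=> jk; apply: pow_le2 => //; apply: le_trans ka.
  by rewrite ler_wpM2r// ler_nat.
have main j : (j <= k)%N -> nm (mpow (1%:M + P) j - mpow (1%:M + Q) j) <=
    2 * j%:R * (1 + a) ^+ j * nm (P - Q).
  elim: j => [|j IH] jk; first by rewrite /= subrr nm0 mulr0 !mul0r.
  have {}IH := IH (ltnW jk); rewrite /=.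
  set X := mpow _ j in IH *; set Y := mpow (_ + Q) j in IH *.
  have -> : X *m (1%:M + P) - Y *m (1%:M + Q) = (X - Y) *m (1%:M + P) + Y *m (P - Q).
    have -> : P - Q = (1%:M + P) - (1%:M + Q) by rewrite opprD addrACA subrr add0r.
    by rewrite mulmxBl mulmxBr addrA subrK.
  apply: le_trans (nmD _ _) _.
  have h1 : nm ((X - Y) *m (1%:M + P)) <= nm (X - Y) * (1 + a).
    rewrite mulmxDr mulmx1 mulrDr mulr1; apply: le_trans (nmD _ _) _.
    by rewrite lerD2l; apply: le_trans (nmM _ _) _; rewrite ler_wpM2l ?nm_ge0.
  have h2 : nm (Y *m (P - Q)) <= 2 * (1 + a) ^+ j.+1 * nm (P - Q).
    apply: le_trans (nm_mul_pow _ _ _) _; rewrite ler_wpM2r ?nm_ge0//.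
    apply: (@le_trans _ _ ((1 + a) ^+ j)).
      by rewrite lerXn2r ?nnegrE ?addr_ge0 ?nm_ge0// lerD2l.
    have x0 : 0 <= (1 + a) ^+ j by rewrite exprn_ge0 ?addr_ge0.
    by rewrite exprS; nra.
  apply: le_trans (lerD h1 h2) _; rewrite -[j.+1%:R]natr1.
  have -> : 2 * (j%:R + 1) * (1 + a) ^+ j.+1 * nm (P - Q) =
    2 * j%:R * (1 + a) ^+ j * nm (P - Q) * (1 + a) + 2 * (1 + a) ^+ j.+1 * nm (P - Q).
    by rewrite exprS; ring.
  by rewrite lerD2r ler_wpM2r ?addr_ge0.
apply: le_trans (main k (leqnn k)) _; rewrite ler_wpM2r ?nm_ge0//.
have := le2 k (leqnn k); have : 0 <= (k%:R : R) by []; nra.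
Qed.

Lemma geometric_small (C e : R) : 0 < e -> exists n, C / 2 ^+ n < e.
Proof.
move=> e0; have [C0|C0] := ltP 0 C; last first.
  by exists 0%N; rewrite expr0 divr1; exact: le_lt_trans C0 e0.
have [n Hn] : exists n : nat, C / e < n%:R.
  by exists (Num.truncn (C / e)).+1; rewrite truncnS_gt.
exists n; rewrite ltr_pdivrMr ?exprn_gt0// mulrC -ltr_pdivrMr//.
by apply: lt_le_trans Hn _; rewrite -natrX ler_nat ltnW// ltn_expl.
Qed.

Definition cayley_mx A := (1%:M + A) *m invmx (1%:M - A).

Section HalfCayley.
Variable S : M -> Prop.
Hypothesis SD : forall A B, S A -> S B -> S (A + B).
Hypothesis SZ : forall (t : R) A, S A -> S (toF t *: A).
Hypothesis S3 : forall A B C, S A -> S B -> S C -> S (A *m B *m C).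
Hypothesis Sclosed : forall A,
  (forall e : R, 0 < e -> exists2 B, S B & nm (A - B) <= e) -> S A.

(** On the ball of radius [nm A <= 1 / 2] the map [g] is a contraction with factor [1 / 2]. It
    preserves [S], as [A *m X *m X] is a triple product, and [S] is closed. *)
Lemma half_cayley A : S A -> nm A <= 1 / 2 ->
  exists B, [/\ S B, nm B <= nm A & B + B = A + A *m B *m B].
Proof.
move=> SA A2; set a := nm A in A2 *; have a0 : 0 <= a by exact: nm_ge0.
pose g X := toF (1 / 2) *: (A + A *m X *m X).
pose u k := iter k g A.
have half0 : `|1 / 2 : R| = 1 / 2 by rewrite ger0_norm.
have uk k : S (u k) /\ nm (u k) <= a.
  elim: k => [|k [IH1 IH2]]; first by [].
  rewrite /= -/(u k) /g; split; first by apply: SZ; apply: SD => //; exact: S3.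
  rewrite nmZ half0.
  have := nmD A (A *m u k *m u k); have := nmM (A *m u k) (u k); have := nmM A (u k).
  have := nm_ge0 (u k); have := nm_ge0 (A *m u k); rewrite -/a => h1 h2 h3 h4 h5.
  have h6 : nm (A *m u k) <= a by nra.
  have h7 : nm (A *m u k *m u k) <= a by nra.
  lra.
have gdiff X Y : nm X <= a -> nm Y <= a -> nm (g X - g Y) <= 1 / 2 * nm (X - Y).
  move=> Xa Ya; rewrite /g -scalerBr nmZ half0 ler_wpM2l//.
  have -> : A + A *m X *m X - (A + A *m Y *m Y) = A *m (X *m (X - Y)) + A *m ((X - Y) *m Y).
    rewrite opprD addrACA subrr add0r !mulmxBr !mulmxBl !mulmxBr !mulmxA.
    by rewrite addrA subrK.
  have := nmD (A *m (X *m (X - Y))) (A *m ((X - Y) *m Y)).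
  have := nmM A (X *m (X - Y)); have := nmM A ((X - Y) *m Y).
  have := nmM X (X - Y); have := nmM (X - Y) Y; rewrite -/a.
  have := nm_ge0 (X *m (X - Y)); have := nm_ge0 ((X - Y) *m Y).
  have := nm_ge0 (X - Y); have := nm_ge0 X; have := nm_ge0 Y => *.
  have h1 : nm (X *m (X - Y)) <= a * nm (X - Y) by nra.
  have h2 : nm ((X - Y) *m Y) <= a * nm (X - Y) by nra.
  have h3 : a * nm (X *m (X - Y)) <= 1 / 2 * (a * nm (X - Y)) by nra.
  have h4 : a * nm ((X - Y) *m Y) <= 1 / 2 * (a * nm (X - Y)) by nra.
  by nra.
have ug k : nm (u k.+1 - u k) <= nm (u 1%N - u 0%N) / 2 ^+ k.
  elim: k => [|k IH]; first by rewrite expr0 divr1.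
  apply: le_trans (gdiff (u k.+1) (u k) (uk _).2 (uk _).2) _.
  by rewrite exprS invfM [in leRHS]mulrCA div1r ler_wpM2l.
have [l Hl] := geometric_complete (fun k => le_trans (nr_le_nm _) (ug k)).
set K := nm (u 1%N - u 0%N) in ug Hl.
have lim (e : R) : 0 < e -> exists k, nm (u k - l) <= e.
  move=> e0; have [k Hk] := geometric_small (N%:R * (4 * K)) e0.
  by exists k; apply: le_trans (ltW Hk); rewrite /nm -mulrA ler_wpM2l.
have la : nm l <= a.
  apply/ler_addgt0Pr => e /lim[k Hk]; apply: le_trans (nmBr _ (u k)) _.
  by rewrite nmC lerD// (uk k).2.
exists l; split => //.
  by apply: Sclosed => e /lim[k Hk]; exists (u k); [exact: (uk k).1 | rewrite nmC].
have gl : g l = l.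
  apply/eqP; rewrite -subr_eq0; apply/eqP; apply: nm_small_eq => e e0.
  (* Two consecutive terms are needed because [g] sends [u k'] to [u k'.+1]; the contraction then
     compares [g l] with [l]. *)
  have [k' Hk'] : exists k', nm (u k'.+1 - l) <= e / 4 /\ nm (u k' - l) <= e / 4.
    have e40 : 0 < e / 4 by rewrite divr_gt0.
    have [j Hj] := geometric_small (N%:R * (4 * K)) e40.
    have K0 : 0 <= K by exact: nm_ge0.
    exists j; split; apply: le_trans (ltW Hj); rewrite /nm -mulrA ler_wpM2l//.
    apply: le_trans (Hl j.+1) _; apply: ler_wpM2l.
      by rewrite mulr_ge0 ?nm_ge0.
    by rewrite lef_pV2 ?posrE ?exprn_gt0// exprS ler_peMl ?exprn_ge0// ler1n.
  apply: le_trans (nm_tri _ (u k'.+1) _) _.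
  have := gdiff l (u k') la (uk k').2; rewrite [nm (l - _)]nmC.
  case: Hk'; rewrite /= -/(u k'); lra.
rewrite -[in LHS]gl /g -scalerDl -rmorphD /=.
by rewrite (_ : 1 / 2 + 1 / 2 = 1) ?rmorph1 ?scale1r//; field.
Qed.

(** The hypothesis says that [(1 - A)(1 + B B) = (1 - B)^2] and [(1 + A)(1 + B B) = (1 + B)^2]. The
    identity is checked after multiplying by the invertible [1 + B B], without knowing that [A] and
    [B] commute. *)
Lemma cayley_half A B : nm A <= 1 / 2 -> nm B <= 1 / 2 ->
  B + B = A + A *m B *m B -> cayley_mx B *m cayley_mx B = cayley_mx A.
Proof.
move=> A2 B2 AB.
have uA : 1%:M - A \in unitmx by apply: unit_1B; lra.
have uB : 1%:M - B \in unitmx by apply: unit_1B; lra.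
have uBB : 1%:M + B *m B \in unitmx.
  rewrite -[B *m B]opprK; apply: unit_1B; rewrite nmN.
  by have := nmM B B; have := nm_ge0 B; nra.
have e1 : (1%:M - A) *m (1%:M + B *m B) = (1%:M - B) *m (1%:M - B).
  rewrite mulmxBl mul1mx [in LHS]mulmxDr mulmx1 mulmxA -AB.
  rewrite mulmxBl mul1mx mulmxBr mulmx1 opprB opprD !addrA.
  by rewrite [1%:M + _ - B]addrAC.
have e2 : (1%:M + A) *m (1%:M + B *m B) = (1%:M + B) *m (1%:M + B).
  rewrite mulmxDl mul1mx [in LHS]mulmxDr mulmx1 mulmxA -AB.
  rewrite mulmxDl mul1mx mulmxDr mulmx1 !addrA.
  by rewrite [1%:M + _ + B]addrAC addrAC.
have cB : cayley_mx B *m (1%:M - B) = 1%:M + B by rewrite /cayley_mx mulmxKV.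
have comm : (1%:M + B) *m (1%:M - B) = (1%:M - B) *m (1%:M + B).
  rewrite mulmxDl mulmxBl !mul1mx mulmxBr mulmxDr !mulmx1.
  by rewrite addrA subrK opprD addrA addrK.
move: (cayley_mx B) cB => C cB.
suff H : C *m C *m (1%:M - A) = 1%:M + A by rewrite /cayley_mx -H mulmxK.
apply: (can_inj (mulmxK uBB)); rewrite -[LHS]mulmxA e1 e2.
by rewrite -mulmxA [C *m ((1%:M - B) *m _)]mulmxA cB comm mulmxA cB.
Qed.

Lemma cayley_roots A : S A -> nm A <= 1 / 4 -> exists B : nat -> M,
  [/\ B 0%N = A,
      forall n, S (B n),
      forall n, nm (B n) <= 2 * nm A / 2 ^+ n,
      forall n, B n.+1 + B n.+1 = B n + B n *m B n.+1 *m B n.+1 &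
      forall n, mpow (cayley_mx (B n)) (2 ^ n) = cayley_mx A].
Proof.
move=> SA A4; set a := nm A in A4 *; have a0 : 0 <= a := nm_ge0 A.
(* The conditions on [X] stand below the existential so that [choice] yields a total function; 0 is
   a dummy value. *)
have step (X : M) : exists Y, S X -> nm X <= 1 / 2 ->
    [/\ S Y, nm Y <= nm X & Y + Y = X + X *m Y *m Y].
  have [SX|nSX] := pselect (S X); last by exists 0.
  have [X2|nX2] := leP (nm X) (1 / 2); last by exists 0.
  by have [Y HY] := half_cayley SX X2; exists Y.
have [h Hh] := choice step.
pose B n := iter n h A.
pose q n : R := (2 ^+ n)^-1.
have q0 n : 0 < q n by rewrite invr_gt0 exprn_gt0.
have q1 n : q n <= 1 by rewrite invf_le1 ?exprn_gt0// exprn_ege1// ler1n.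
have qS n : q n.+1 = q n / 2 by rewrite /q exprS invfM mulrC.
(* The bound [2 * a * q n] alone would not close the induction, as the cubic term of the recursion
   costs a little at each step. The factor [1 - q n / 2] pays for it; at [n = 0] the bound is
   exactly [a]. *)
have HB n : S (B n) /\ nm (B n) <= 2 * a * q n * (1 - q n / 2).
  elim: n => [|n [IH1 IH2]].
    split=> //; rewrite /q expr0 invr1 /= -/a; lra.
  have B2 : nm (B n) <= 1 / 2.
    have := q0 n; have := q1 n => *; apply: le_trans IH2 _.
    have : a * q n <= 1 / 4 by nra.
    have : 0 <= a * q n by nra.
    nra.
  have [SY Yle YE] := Hh (B n) IH1 B2; rewrite /= -/(B n) in SY Yle YE *.
  split=> //; set Y := h (B n) in SY Yle YE *.
  have : 2 * nm Y <= nm (B n) + nm (B n) * nm Y * nm Y.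
    have := nmD (B n) (B n *m Y *m Y); rewrite -YE.
    have -> : Y + Y = toF 2 *: Y.
      by rewrite (_ : 2 = 1 + 1 :> R)// rmorphD scalerDl rmorph1 scale1r.
    rewrite nmZ ger0_norm//; have := nmM (B n *m Y) Y; have := nmM (B n) Y.
    have := nm_ge0 Y => *; nra.
  have := nm_ge0 Y; have := q0 n; have := q1 n.
  rewrite qS; move: (nm Y) (nm (B n)) (q n) Yle IH2 B2 => y bn qn Yle IH2 B2 qn1 qn0 y0 hy.
  have bq : bn <= qn / 2 by nra.
  have yy : y * y <= qn * qn / 4 by nra.
  have h1 : bn * y * y <= bn * (qn * qn / 4) by rewrite -mulrA ler_wpM2l//; exact: le_trans Yle.
  have h2 : bn * (1 + qn * qn / 4) <= 2 * a * qn * (1 - qn / 2) * (1 + qn * qn / 4).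
    by apply: ler_wpM2r => //; nra.
  have h3 : (1 - qn / 2) * (1 + qn * qn / 4) <= 1 - qn / 4 by nra.
  have h4 : 2 * a * qn * ((1 - qn / 2) * (1 + qn * qn / 4)) <= 2 * a * qn * (1 - qn / 4).
    by apply: ler_wpM2l => //; nra.
  by nra.
have B2 n : nm (B n) <= 1 / 2.
  have [_ h1] := HB n; have := q0 n; have := q1 n => q1n q0n.
  apply: le_trans h1 _.
  have : a * q n <= 1 / 4 by nra.
  have : 0 <= a * q n by nra.
  nra.
have BS n : B n.+1 + B n.+1 = B n + B n *m B n.+1 *m B n.+1.
  by have [_ _] := Hh (B n) (HB n).1 (B2 n).
exists B; split=> //.
- by move=> n; case: (HB n).
- move=> n; case: (HB n) => _ h1; apply: le_trans h1 _.
  have aq : 0 <= a * q n * q n by rewrite -mulrA mulr_ge0// mulr_ge0 ?(ltW (q0 n)).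
  by rewrite -/(q n); lra.
elim=> [|n IH]; first by rewrite expn0 /= mul1mx.
by rewrite expnS mpowM /= mul1mx (cayley_half (B2 n) (B2 n.+1) (BS n)).
Qed.

End HalfCayley.

End MatrixNorm.

(** * Local groups *)

Section LinearSection.
Context {R : realType} {b : ground} {n N : nat}.
Local Notation F := (base_field R b).
Variable D : 'rV[F]_n -> 'M[F]_N.
Hypothesis DD : forall u v, D (u + v) = D u + D v.
Hypothesis DZ : forall c v, D (c *: v) = c *: D v.

(** The pseudo-inverse of the matrix of [D]. The composite of [D] followed by [q] is a projection
    with the same kernel as [D]. *)
Lemma linear_section : exists q : 'M[F]_N -> 'rV[F]_n,
  [/\ forall X Y, q (X + Y) = q X + q Y,
      forall c X, q (c *: X) = c *: q X,
      exists2 c, 0 < c & forall X, nr (q X) <= c * nm X &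
      forall v, D (q (D v)) = D v].
Proof.
have D0 : D 0 = 0 by rewrite -(scale0r 0) DZ scale0r.
pose m := \matrix_i mxvec (D (delta_mx 0 i)).
have Dm v : mxvec (D v) = v *m m.
  rewrite {1}(row_sum_delta v) (big_morph D DD D0) linear_sum mulmx_sum_row.
  by apply: eq_bigr => i _; rewrite DZ linearZ rowK.
exists (fun X => mxvec X *m pinvmx m); split.
- by move=> X Y; rewrite raddfD mulmxDl.
- by move=> c X; rewrite linearZ /= -scalemxAl.
- exists ((N * N)%:R * nr (pinvmx m) + 1); first by rewrite ltr_wpDl// mulr_ge0 ?nr_ge0.
  move=> X; apply: le_trans (nr_mulmx _ _) _.
  have h : nr (mxvec X) <= nr X.
    apply: nr_mx_le => [|i j]; first exact: nr_ge0.
    by rewrite (ord1 i); case/mxvec_indexP: j => i' j'; rewrite mxvecE nr_entry.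
  have h' : (N * N)%:R * (nr (mxvec X) * nr (pinvmx m)) <=
      (N * N)%:R * (nm X * nr (pinvmx m)).
    by rewrite ler_wpM2l// ler_wpM2r ?nr_ge0// (le_trans h)// nr_le_nm.
  apply: le_trans h' _; have -> : ((N * N)%:R * nr (pinvmx m) + 1) * nm X =
      (N * N)%:R * (nm X * nr (pinvmx m)) + nm X by ring.
  by rewrite lerDl nm_ge0.
- by move=> v; apply: (can_inj mxvecK); rewrite !Dm mulmxKpV ?submxMl.
Qed.

(** The preimage is [q X]: for any [v], the difference [X - D (q X)] is
    [(X - D v) + D (q (D v - X))], and both terms are small when [D v] is near [X]. *)
Lemma linear_closed_range X :
  (forall e : R, 0 < e -> exists v, nm (X - D v) <= e) -> exists v, X = D v.
Proof.
move=> H; have [q [qD qZ [c c0 qc] Dq]] := linear_section.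
exists (q X); apply/eqP; rewrite -subr_eq0; apply/eqP; apply: nm_small_eq => e e0.
have [k k0 Dk] := lin_bounded (rv_basis n) DD DZ.
have K0 : 0 < 1 + N%:R * (k * c) by rewrite ltr_wpDr// !mulr_ge0// ltW.
have [v Hv] := H (e / (1 + N%:R * (k * c))) (divr_gt0 e0 K0).
apply: le_trans (nm_tri _ (D v) _) _.
have -> : D v - D (q X) = D (q (D v - X)).
  have DN u w : D (u - w) = D u - D w by rewrite -scaleN1r DD DZ scaleN1r.
  have qN u w : q (u - w) = q u - q w by rewrite -scaleN1r qD qZ scaleN1r.
  by rewrite qN DN Dq.
have h : nm (D (q (D v - X))) <= N%:R * (k * c) * nm (X - D v).
  rewrite /nm -mulrA ler_wpM2l//; apply: le_trans (Dk _) _.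
  by rewrite -mulrA ler_wpM2l ?(ltW k0)//; apply: le_trans (qc _) _; rewrite nmC.
apply: le_trans (lerD (lexx _) h) _; rewrite -[X in X + _]mul1r -mulrDl mulrC.
by rewrite -ler_pdivlMr.
Qed.

End LinearSection.

(** * Powers, limits and tangent vectors in a local group *)

Section LocalGroup.
Context {R : realType} {b : ground} {n N : nat}.
Local Notation F := (base_field R b).
Local Notation E := 'rV[F]_n.
Local Notation M := 'M[F]_N.
(** The product of a group in a chart that sends the identity to 0, a matrix representation [r] in
    this chart and its differential [D]. The estimates of the product rest on [mu_mix]: at
    [u' = v' = 0] it compares [mu u v] with [u + v]. *)
Variables (mu : E -> E -> E) (r : E -> M) (D : E -> M) (d C : R).
Hypothesis d0 : 0 < d.
Hypothesis C0 : 0 <= C.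
Hypothesis Cd : C * d <= 1 / 2.
Hypothesis mu0l : forall v, nr v < d -> mu 0 v = v.
Hypothesis mu0r : forall u, nr u < d -> mu u 0 = u.
Hypothesis muA : forall u v w, nr u < d -> nr v < d -> nr w < d ->
  nr (mu u v) < d -> nr (mu v w) < d -> mu (mu u v) w = mu u (mu v w).
Hypothesis mu_mix : forall u u' v v', nr u < d -> nr u' < d -> nr v < d -> nr v' < d ->
  nr (mu u v - mu u' v - (mu u v' - mu u' v')) <= C * (nr (u - u') * nr (v - v')).
Hypothesis r0 : r 0 = 1%:M.
Hypothesis rmu : forall u v, nr u < d -> nr v < d -> r (mu u v) = r u *m r v.
Hypothesis rcont : forall u, nr u < d -> {for u, continuous r}.
Hypothesis rdiff : fdiff r 0 D.

Let n0 : nr (0 : E) < d. Proof. by rewrite nr0. Qed.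

Lemma mu_add u v : nr u < d -> nr v < d ->
  nr (mu u v - (u + v)) <= C * (nr u * nr v).
Proof.
move=> ud vd; have := mu_mix ud n0 vd n0.
by rewrite !mu0l// mu0r// !subr0 opprD addrA addrAC.
Qed.

(** The constant is kept in the form [1 + C * nr v] because this estimate is iterated along [steps],
    where only factors close to 1 stay bounded. [mu_lipr] enters each step additively and may lose a
    factor 2. *)
Lemma mu_lipl u u' v : nr u < d -> nr u' < d -> nr v < d ->
  nr (mu u v - mu u' v) <= (1 + C * nr v) * nr (u - u').
Proof.
move=> ud ud' vd; have := mu_mix ud ud' vd n0; rewrite !mu0r// subr0 => h.
apply: le_trans (nrBr _ (u - u')) _; rewrite mulrDl mul1r lerD2l.
by apply: le_trans h _; rewrite -mulrA [nr v * _]mulrC.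
Qed.

Lemma mu_lipr u v v' : nr u < d -> nr v < d -> nr v' < d ->
  nr (mu u v - mu u v') <= 2 * nr (v - v').
Proof.
move=> ud vd vd'; have := mu_mix ud n0 vd vd'; rewrite !mu0l// subr0 => h.
have e : mu u v - mu u v' = (v - v') + (mu u v - v - (mu u v' - v')).
  by rewrite opprB [RHS]addrACA subrKC addKr.
rewrite e; apply: le_trans (nrD _ _) _; have := nr_ge0 (v - v') => vv.
have : C * nr u <= 1 / 2 by apply: le_trans Cd; rewrite ler_wpM2l// ltW.
have := nr_ge0 u; nra.
Qed.

Fixpoint steps (w : E) k : E := if k is k'.+1 then mu (steps w k') w else 0.

Lemma steps_bound w k : 2 * k%:R * nr w < d -> nr w < d ->
  nr (steps w k) <= 2 * k%:R * nr w.
Proof.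
move=> kd wd; elim: k kd => [|k IH] kd; first by rewrite /= nr0 mulr0 mul0r.
have wn := nr_ge0 w; rewrite -natr1 in kd *.
have k0 : 0 <= (k%:R : R) by [].
have kd' : 2 * k%:R * nr w < d by nra.
have sd : nr (steps w k) < d := le_lt_trans (IH kd') kd'.
rewrite /=; apply: le_trans (nrBr _ (steps w k)) _.
have := mu_lipr sd wd n0; rewrite mu0r// subr0; have := IH kd'; nra.
Qed.

Lemma steps_lt w k : 2 * k%:R * nr w < d -> nr w < d -> nr (steps w k) < d.
Proof. by move=> kd wd; exact: le_lt_trans (steps_bound kd wd) kd. Qed.

Lemma steps_le_lt (w : E) j k : (j <= k)%N -> 2 * k%:R * nr w < d -> 2 * j%:R * nr w < d.
Proof.
move=> jk; apply: le_lt_trans; rewrite ler_wpM2r ?nr_ge0// ler_wpM2l// ler_nat//.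
Qed.

Lemma r_steps w k : 2 * k%:R * nr w < d -> nr w < d -> r (steps w k) = mpow (r w) k.
Proof.
move=> kd wd; elim: k kd => [|k IH] kd //=.
have kd' := steps_le_lt (leqnSn k) kd.
by rewrite rmu ?IH// steps_lt.
Qed.

Lemma steps_diff w w' k : 2 * k%:R * nr w < d -> 2 * k%:R * nr w' < d ->
  nr w < d -> nr w' < d ->
  nr (steps w k - steps w' k) <= 4 * k%:R * nr (w - w').
Proof.
move=> kd kd' wd wd'; set a := C * nr w.
have a0 : 0 <= a by rewrite mulr_ge0 ?nr_ge0.
have ka : k%:R * a <= 1 / 2.
  rewrite /a; have : C * (2 * k%:R * nr w) <= 1 / 2.
    by apply: le_trans Cd; rewrite ler_wpM2l// ltW.
  have : 0 <= C * (k%:R * nr w) by rewrite !mulr_ge0 ?nr_ge0.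
  lra.
have le2 j : (j <= k)%N -> (1 + a) ^+ j <= 2.
  move=> jk; apply: pow_le2 => //; apply: le_trans ka.
  by rewrite ler_wpM2r// ler_nat.
have main j : (j <= k)%N -> nr (steps w j - steps w' j) <=
    2 * j%:R * (1 + a) ^+ j * nr (w - w').
  elim: j => [|j IH] jk; first by rewrite /= subrr nr0 mulr0 !mul0r.
  have {}IH := IH (ltnW jk); rewrite /=.
  have sd := steps_lt (steps_le_lt (ltnW jk) kd) wd.
  have sd' := steps_lt (steps_le_lt (ltnW jk) kd') wd'.
  apply: le_trans (nr_tri _ (mu (steps w' j) w) _) _.
  have h1 := mu_lipl sd sd' wd; have h2 := mu_lipr sd' wd wd'.
  apply: le_trans (lerD h1 h2) _; rewrite -/a -[j.+1%:R]natr1 exprS.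
  have p1 : 1 <= (1 + a) ^+ j by rewrite exprn_ege1// lerDl.
  have h3 : (1 + a) * nr (steps w j - steps w' j) <=
     (1 + a) * (2 * j%:R * (1 + a) ^+ j * nr (w - w')).
    by rewrite ler_wpM2l// addr_ge0.
  have h4 : 2 * nr (w - w') <= 2 * ((1 + a) * (1 + a) ^+ j) * nr (w - w').
    by rewrite ler_wpM2r ?nr_ge0//; nra.
  apply: le_trans (lerD h3 h4) _; rewrite le_eqVlt; apply/orP; left; apply/eqP; ring.
apply: le_trans (main k (leqnn k)) _; rewrite ler_wpM2r ?nr_ge0//.
have := le2 k (leqnn k); have : 0 <= (k%:R : R) by []; nra.
Qed.

(** Associativity holds only while all intermediate products stay in the ball, whence the smallness
    assumptions. *)
Lemma steps_double w k : 2 * (2 * k)%:R * nr w < d -> nr w < d -> nr (mu w w) < d ->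
  steps (mu w w) k = steps w (2 * k).
Proof.
move=> kd wd wwd; elim: k kd => [|k IH] kd; first by rewrite muln0.
have e : (2 * k.+1 = (2 * k).+2)%N by rewrite mulnS.
rewrite e in kd *; rewrite /= IH; last by apply: steps_le_lt kd; rewrite !leqW.
rewrite muA//.
  by apply: steps_lt => //; apply: steps_le_lt kd; rewrite !leqW.
by apply: (@steps_lt w (2 * k).+1) => //; apply: steps_le_lt kd.
Qed.

(** Stands in for the exponential of the limit of [2 ^ k *: w k]. The square of [w k.+1] misses
    [w k] by [O(4 ^- k)], and [2 ^ k]-th powers enlarge this by [O(2 ^ k)], so the powers have
    geometric increments. The constant 16 is 4 from [steps_diff] times 4 from
    [geometric_complete]. *)
Lemma local_exp (w : nat -> E) (s kap : R) :
  (forall k, nr (w k) <= s / 2 ^+ k) ->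
  (forall k, nr (w k - (w k.+1 + w k.+1)) <= kap / 4 ^+ k) ->
  4 * s < d ->
  exists e, [/\ nr (e - w 0%N) <= 16 * (C * (s * s) + kap), nr e <= 2 * s &
    forall k, nr (steps (w k) (2 ^ k) - e) <= 16 * (C * (s * s) + kap) / 2 ^+ k].
Proof.
move=> ws wk s4; have s0 : 0 <= s.
  by have := ws 0%N; rewrite expr0 divr1; apply: le_trans; exact: nr_ge0.
have p0 k : 0 < (2 ^+ k : R) by rewrite exprn_gt0.
have p1 k : 1 <= (2 ^+ k : R) by rewrite exprn_ege1// ler1n.
have ws' k : 2 ^+ k * nr (w k) <= s by rewrite mulrC -ler_pdivlMr.
have wd k : nr (w k) < d.
  by have := ws' k; have := p1 k; have := nr_ge0 (w k); nra.
have wkd k : 2 * (2 ^ k)%:R * nr (w k) <= 2 * s.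
  by rewrite natrX -mulrA ler_wpM2l.
have mww k : nr (mu (w k) (w k)) <= 3 * nr (w k).
  apply: le_trans (nrBr _ (w k + w k)) _.
  have := nrD (w k) (w k); have := mu_add (wd k) (wd k).
  have : C * nr (w k) <= 1 / 2 by apply: le_trans Cd; rewrite ler_wpM2l// ltW.
  by have := nr_ge0 (w k); nra.
pose e k := steps (w k) (2 ^ k).
have eS k : nr (e k.+1 - e k) <= 4 * (C * (s * s) + kap) / 2 ^+ k.
  have kS : 2 ^+ k * nr (w k.+1) <= s / 2.
    by have := ws' k.+1; rewrite exprS; lra.
  have nw := nr_ge0 (w k.+1).
  have wwd : nr (mu (w k.+1) (w k.+1)) < d.
    by have := mww k.+1; have := p1 k; nra.
  have wwk : 2 * (2 ^ k)%:R * nr (mu (w k.+1) (w k.+1)) < d.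
    rewrite natrX; have := mww k.+1; have := p0 k => p m.
    have : 2 ^+ k * nr (mu (w k.+1) (w k.+1)) <= 2 ^+ k * (3 * nr (w k.+1)).
      by rewrite ler_wpM2l// ltW.
    lra.
  have wkk j : 2 * (2 ^ j)%:R * nr (w j) < d.
    by apply: le_lt_trans (wkd j) _; lra.
  rewrite /e expnS -steps_double//; last by rewrite -expnS.
  apply: le_trans (steps_diff wwk (wkk k) wwd (wd k)) _.
  rewrite natrX ler_pdivlMr//; set Y := nr _.
  have -> : 4 * 2 ^+ k * Y * 2 ^+ k = 4 * (2 ^+ k * (Y * 2 ^+ k)) by ring.
  rewrite ler_wpM2l// {}/Y.
  have h : nr (mu (w k.+1) (w k.+1) - w k) <= C * (nr (w k.+1) * nr (w k.+1)) + kap / 4 ^+ k.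
    apply: le_trans (nr_tri _ (w k.+1 + w k.+1) _) _; apply: lerD.
      exact: mu_add.
    by rewrite nrC.
  have e4 : (4 ^+ k : R) = 2 ^+ k * 2 ^+ k by rewrite -exprMn; congr (_ ^+ _); ring.
  have h' : 2 ^+ k * (nr (mu (w k.+1) (w k.+1) - w k) * 2 ^+ k) <=
      2 ^+ k * ((C * (nr (w k.+1) * nr (w k.+1)) + kap / 4 ^+ k) * 2 ^+ k).
    by rewrite ler_pM2l// ler_pM2r.
  apply: le_trans h' _.
  have -> : 2 ^+ k * ((C * (nr (w k.+1) * nr (w k.+1)) + kap / 4 ^+ k) * 2 ^+ k) =
     C * ((2 ^+ k * nr (w k.+1)) * (2 ^+ k * nr (w k.+1))) + kap.
    by rewrite e4; field; rewrite lt0r_neq0.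
  rewrite lerD2r ler_wpM2l//.
  have : 0 <= 2 ^+ k * nr (w k.+1) by rewrite mulr_ge0// ltW.
  nra.
have [l Hl] := geometric_complete eS.
have Hl' k : nr (e k - l) <= 16 * (C * (s * s) + kap) / 2 ^+ k.
  by apply: le_trans (Hl k) _; rewrite ler_wpM2r ?invr_ge0 ?(ltW (p0 k))//; lra.
exists l; split=> //.
  have := Hl' 0%N; rewrite expr0 divr1 nrC; congr (nr (_ - _) <= _).
  by rewrite /e expn0 /= mu0l.
apply/ler_addgt0Pr => x x0.
have [k Hk] := geometric_small (16 * (C * (s * s) + kap)) x0.
apply: le_trans (nrBr _ (e k)) _; apply: lerD; last by rewrite nrC (le_trans (Hl' k))// ltW.
apply: le_trans (wkd k); apply: steps_bound => //.
by apply: le_lt_trans (wkd k) _; lra.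
Qed.

(** Both [r (w k)] and the root [1 + Q k] of [X] agree with [1 + D (w k)] up to [o(2 ^- k)], so by
    [nm_pow_diff] their [2 ^ k]-th powers have the same limit. *)
Lemma local_exp_rep (w : nat -> E) (Q : nat -> M) (X : M) (s kap eta : R) :
  (forall k, nr (w k) <= s / 2 ^+ k) ->
  (forall k, nr (w k - (w k.+1 + w k.+1)) <= kap / 4 ^+ k) ->
  4 * s < d ->
  (forall k, nm (Q k) <= 1 / 4 / 2 ^+ k) ->
  (forall k, mpow (1%:M + Q k) (2 ^ k) = X) ->
  (forall k, nm (D (w k) - Q k) <= eta / 4 ^+ k) ->
  exists e, [/\ nr (e - w 0%N) <= 16 * (C * (s * s) + kap), nr e <= 2 * s & r e = X].
Proof.
move=> ws wk s4 Q4 QX DQ; have [l [l1 l2 l3]] := local_exp ws wk s4.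
exists l; split=> //.
have s0 : 0 <= s.
  by have := ws 0%N; rewrite expr0 divr1; apply: le_trans; exact: nr_ge0.
have p0 k : 0 < (2 ^+ k : R) by rewrite exprn_gt0.
have p1 k : 1 <= (2 ^+ k : R) by rewrite exprn_ege1// ler1n.
have ws' k : 2 ^+ k * nr (w k) <= s by rewrite mulrC -ler_pdivlMr.
have wd k : nr (w k) < d.
  by have := ws' k; have := p1 k; have := nr_ge0 (w k); nra.
have ld : nr l < d by lra.
apply/eqP; rewrite -subr_eq0; apply/eqP; apply: nm_small_eq => e e0.
have N1 : 0 < (N%:R + 1 : R) by rewrite ltr_wpDl.
have e20 : 0 < e / 2 / (N%:R + 1) by rewrite !divr_gt0.
have [d1 d10 H1] := (nr_cvgP _ _).1 (rcont ld) _ e20.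
(* The bound [1 / 4] gives [nm P <= (1 / 4 + 1 / 4) / 2 ^+ k], as [nm_pow_diff] requires; [e / 8]
   absorbs its factor 4 and leaves [e / 2]. *)
pose ep := Num.min (1 / 4) (e / 8).
have ep0 : 0 < ep by rewrite lt_min !divr_gt0.
have s10 : 0 < s + 1 by rewrite ltr_wpDl.
have e3 : 0 < ep / 2 / (s + 1) / (N%:R + 1) by rewrite !divr_gt0.
have [d2 d20 H2] := fdiff_near rdiff e3.
have [k1 Hk1] := geometric_small (16 * (C * (s * s) + kap)) d10.
have [k2 Hk2] := geometric_small s d20.
have [k3 Hk3] := geometric_small eta (divr_gt0 ep0 (ltr0Sn _ 1)).
have ek : 0 < ep by [].
pose k := maxn k1 (maxn k2 k3).
have geo (c x : R) j : (j <= k)%N -> 0 < x -> c / 2 ^+ j < x -> c / 2 ^+ k < x.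
  move=> jk x0 cx; have [c0|c0] := leP 0 c; last first.
    by apply: le_lt_trans x0; rewrite pmulr_lle0 ?invr_gt0// ltW.
  apply: le_lt_trans cx; rewrite ler_wpM2l// lef_pV2 ?posrE//.
  by rewrite ler_eXn2l// ltr1n.
have {Hk1} Hk1 := geo _ _ _ (leq_maxl _ _) d10 Hk1.
have {Hk2} Hk2 := geo _ _ _ (leq_trans (leq_maxl _ _) (leq_maxr _ _)) d20 Hk2.
have {Hk3} Hk3 := geo _ _ _ (leq_trans (leq_maxr _ _) (leq_maxr _ _)) (divr_gt0 ep0 (ltr0Sn _ 1)) Hk3.
apply: le_trans (nm_tri _ (r (steps (w k) (2 ^ k))) _) _.
rewrite [e]splitr; apply: lerD.
  rewrite nmC /nm.
  have := H1 _ (le_lt_trans (l3 k) Hk1); rewrite ltr_pdivlMr// => h.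
  by have := nr_ge0 (r (steps (w k) (2 ^ k)) - r l); lra.
have wkd : 2 * (2 ^ k)%:R * nr (w k) < d.
  by rewrite natrX -mulrA; have := ws' k; lra.
rewrite r_steps// -(QX k).
pose P := r (w k) - 1%:M.
have rP : r (w k) = 1%:M + P by rewrite /P addrC subrK.
have PQ : nm (P - Q k) <= ep / 2 ^+ k.
  apply: le_trans (nm_tri _ (D (w k)) _) _; rewrite [ep]splitr mulrDl; apply: lerD.
    have := H2 (w k) (le_lt_trans (ws k) Hk2); rewrite add0r r0 -/P => h.
    apply: (@le_trans _ _ (N%:R * (ep / 2 / (s + 1) / (N%:R + 1) * nr (w k)))).
      by rewrite /nm ler_wpM2l.
    have h1 : N%:R / (N%:R + 1) <= 1 :> R by rewrite ler_pdivrMr// mul1r lerDl.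
    have h2 : 2 ^+ k * nr (w k) / (s + 1) <= 1.
      by rewrite ler_pdivrMr// mul1r (le_trans (ws' k))// lerDl.
    rewrite ler_pdivlMr//.
    have -> : N%:R * (ep / 2 / (s + 1) / (N%:R + 1) * nr (w k)) * 2 ^+ k =
        ep / 2 * (N%:R / (N%:R + 1) * (2 ^+ k * nr (w k) / (s + 1))).
      by field; rewrite !lt0r_neq0.
    rewrite ger_pMr ?divr_gt0// mulr_ile1// divr_ge0 ?(ltW N1) ?(ltW s10)//.
    by rewrite mulr_ge0 ?nr_ge0// ltW.
  apply: le_trans (DQ k) _; rewrite (_ : 4 = 2 * 2) ?exprMn; last by ring.
  by rewrite invfM mulrA ler_wpM2r ?invr_ge0 ?(ltW (p0 k))// ltW.
rewrite rP.
have ka : (2 ^ k)%:R * (1 / 2 / 2 ^+ k) <= 1 / 2 :> R.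
  by rewrite natrX mulrC divfK// lt0r_neq0.
have Qa : nm (Q k) <= 1 / 2 / 2 ^+ k.
  by apply: le_trans (Q4 k) _; rewrite ler_wpM2r ?invr_ge0 ?(ltW (p0 k))//; lra.
have Pa : nm P <= 1 / 2 / 2 ^+ k.
  apply: le_trans (nmBr _ (Q k)) _; apply: le_trans (lerD (Q4 k) PQ) _.
  rewrite -mulrDl ler_wpM2r ?invr_ge0 ?(ltW (p0 k))//.
  have : ep <= 1 / 4 by rewrite ge_min lexx.
  lra.
apply: le_trans (nm_pow_diff Pa Qa ka) _; rewrite natrX.
have : ep <= e / 8 by rewrite ge_min lexx orbT.
rewrite -mulrA; have := PQ; rewrite ler_pdivlMr// mulrC; lra.
Qed.

(** * Removing the kernel of the differential *)

Section KernelReduction.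
Variables (q : M -> E) (c : R).
Hypothesis qD : forall X Y, q (X + Y) = q X + q Y.
Hypothesis qZ : forall k X, q (k *: X) = k *: q X.
Hypothesis c0 : 0 < c.
Hypothesis qc : forall X, nr (q X) <= c * nm X.
Hypothesis Dq : forall v, D (q (D v)) = D v.

(** [p] and [pi] are complementary projections, and the range of [pi] is the kernel of [D]. *)
Let p v := q (D v).
Let pi v := v - p v.

Let DN v : D (- v) = - D v.
Proof. by rewrite -scaleN1r (fdiffZ rdiff) scaleN1r. Qed.

Let pD u v : p (u + v) = p u + p v.
Proof. by rewrite /p (fdiffD rdiff) qD. Qed.

Let pN v : p (- v) = - p v.
Proof. by rewrite /p DN -scaleN1r qZ scaleN1r. Qed.

Let piD u v : pi (u + v) = pi u + pi v.
Proof. by rewrite /pi pD opprD addrACA. Qed.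

Let piN v : pi (- v) = - pi v.
Proof. by rewrite /pi pN -opprB opprK addrC. Qed.

Let Dpi v : D (pi v) = 0.
Proof. by rewrite /pi (fdiffD rdiff) DN Dq subrr. Qed.

Let ppi v : p (pi v) = 0.
Proof. by rewrite /p Dpi -(scale0r 0) qZ scale0r. Qed.

Let pipi v : pi (pi v) = pi v.
Proof. by rewrite {1}/pi ppi subr0. Qed.

Let pib : exists2 K, 0 < K & forall v, nr (p v) <= K * nr v /\ nr (pi v) <= K * nr v.
Proof.
have [K K0 DK] := fdiff_bound rdiff.
have pb v : nr (p v) <= (c * (N%:R * K)) * nr v.
  apply: le_trans (qc _) _; rewrite -!mulrA !ler_wpM2l ?(ltW c0)//.
exists (1 + c * (N%:R * K)).
  by rewrite ltr_wpDr// !mulr_ge0// ltW.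
move=> v; rewrite mulrDl mul1r; split; first by rewrite ler_wpDl ?nr_ge0.
by apply: le_trans (nrB _ _) _; rewrite lerD2l.
Qed.

(* Multiplying by [exp (- pi v)], on which [r] is trivial, removes the part of
   [v] in the kernel of [D] up to a quadratic error. *)
Let kernel_step : exists2 B, 0 < B & exists2 d1, 0 < d1 & forall v, nr v < d1 ->
  exists z, nr z <= B * (nr v * nr (pi v)) /\ r (v - pi v + z) = r v.
Proof.
have [K K0 piK] := pib.
exists (2 * C + 16 * C * K + 1).
  by rewrite ltr_wpDl// addr_ge0 ?mulr_ge0// ltW.
have K10 : 0 < 4 * (K + 1) by rewrite mulr_gt0// addr_gt0.
exists (d / (4 * (K + 1))); first by rewrite divr_gt0.
move=> v; rewrite ltr_pdivlMr// => vd.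
have nv := nr_ge0 v.
have piv : 4 * nr (pi v) < d by have := (piK v).2; nra.
have vd' : nr v < d by nra.
pose w k : E := toF (2 ^+ k)^-1 *: - pi v.
have nw k : nr (w k) = nr (pi v) / 2 ^+ k.
  by rewrite /w nrZt nrN ger0_norm ?invr_ge0 ?exprn_ge0// mulrC.
have Dw k : D (w k) = 0 by rewrite (fdiffZ rdiff) DN Dpi oppr0 scaler0.
have wS k : w k.+1 + w k.+1 = w k.
  rewrite /w -scalerDl -rmorphD /=; congr (toF _ *: _); rewrite exprS.
  by field; rewrite expf_neq0.
have [e [e1 e2 e3]] : exists e, [/\ nr (e - w 0%N) <=
    16 * (C * (nr (pi v) * nr (pi v)) + 0), nr e <= 2 * nr (pi v) & r e = 1%:M].
  apply: (@local_exp_rep w (fun=> 0) 1%:M (nr (pi v)) 0 0) => //.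
  - by move=> k; rewrite nw.
  - by move=> k; rewrite wS subrr nr0 mul0r.
  - by move=> k; rewrite nm0 divr_ge0 ?divr_ge0 ?exprn_ge0.
  - by move=> k; rewrite addr0; elim: (2 ^ k)%N => //= j ->; rewrite mulmx1.
  - by move=> k; rewrite Dw subrr nm0 mul0r.
have w0 : w 0%N = - pi v by rewrite /w expr0 invr1 rmorph1 scale1r.
have ed : nr e < d by have := nr_ge0 (pi v); lra.
exists (mu v e - (v - pi v)); split; last first.
  by rewrite subrKC rmu// e3 mulmx1.
have -> : mu v e - (v - pi v) = (mu v e - (v + e)) + (e - w 0%N).
  rewrite w0 opprK -[RHS]addrA; congr (_ + _).
  by rewrite opprB opprD -[RHS]addrA addKr addrC.
apply: le_trans (nrD _ _) _; have h1 := mu_add vd' ed.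
have h2 := (piK v).2; have h3 := nr_ge0 (pi v).
have h4 : C * (nr v * nr e) <= 2 * C * (nr v * nr (pi v)).
  rewrite [2 * C]mulrC -mulrA ler_wpM2l// mulrCA ler_wpM2l//.
have h5 : C * (nr (pi v) * nr (pi v)) <= C * (K * (nr v * nr (pi v))).
  by rewrite ler_wpM2l// mulrA ler_wpM2r.
have h6 : 0 <= nr v * nr (pi v) by rewrite mulr_ge0.
rewrite addr0 in e1; nra.
Qed.

(** Iterating [kernel_step] halves the kernel part each time while the point stays in a fixed ball.
    Finitely many steps reach any prescribed tolerance, so no limit point has to be formed. *)
Lemma kernel_reduce : exists2 A, 0 < A & exists2 d1, 0 < d1 & forall v, nr v < d1 ->
  forall e : R, 0 < e -> exists v',
    [/\ nr v' <= A * nr v, nr (v' - q (D v')) <= e & r v' = r v].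
Proof.
have [K K0 piK] := pib; have [B B0 [d1 d10 step]] := kernel_step.
have A0 : 0 < 3 * K by rewrite mulr_gt0.
(* For [L * nr x <= 1], the first summand keeps the quantity [S] below from growing and the second
   makes the kernel part shrink by half. *)
pose L := 3 * K * B + K * B * 2 + 1.
have L0 : 0 < L by rewrite ltr_wpDl// !addr_ge0 ?mulr_ge0// ltW.
pose d2 := Num.min d1 L^-1.
have d20 : 0 < d2 by rewrite lt_min d10 invr_gt0.
exists (3 * K) => //; exists (d2 / (3 * K)); first by rewrite divr_gt0.
move=> v; rewrite ltr_pdivlMr// => vd e e0.
(* The kernel part counts twice so that its decrease pays for what a step adds to [p x]. *)
pose S := nr (p v) + 2 * nr (pi v).
have Sv : S <= 3 * K * nr v.
  rewrite /S; have [] := piK v; lra.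
have Sd : S < d2 by rewrite (le_lt_trans Sv)// mulrC.
have main k : exists x, [/\ nr (p x) + 2 * nr (pi x) <= S,
    nr (pi x) <= nr (pi v) / 2 ^+ k & r x = r v].
  elim: k => [|k [x [x1 x2 x3]]].
    by exists v; rewrite expr0 divr1.
  have xS : nr x <= S.
    have -> : x = p x + pi x by rewrite /pi subrKC.
    by apply: le_trans (nrD _ _) _; have := nr_ge0 (pi x); lra.
  have xd2 := le_lt_trans xS Sd.
  have xd1 : nr x < d1 by apply: lt_le_trans xd2 _; rewrite ge_min lexx.
  have xL : L * nr x <= 1.
    have h : nr x <= L^-1 by apply: le_trans (ltW xd2) _; rewrite ge_min lexx orbT.
    by rewrite mulrC -ler_pdivlMr// mul1r.
  have [z [z1 z2]] := step x xd1.
  have [pz piz] := piK z.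
  have np := nr_ge0 (pi x); have nx := nr_ge0 x.
  have px' : p (x - pi x + z) = p x + p z by rewrite pD pD pN ppi oppr0 addr0.
  have pix' : pi (x - pi x + z) = pi z.
    by rewrite piD piD piN pipi subrr add0r.
  have KB : K * nr z <= (K * B * nr x) * nr (pi x).
    have h : K * nr z <= K * (B * (nr x * nr (pi x))) by rewrite ler_wpM2l// ltW.
    by apply: le_trans h _; rewrite !mulrA.
  have KBn : 0 <= K * B * nr x by rewrite !mulr_ge0// ltW.
  have L3 : 3 * (K * B * nr x) <= 1 by move: xL; rewrite /L; lra.
  have L2 : 2 * (K * B * nr x) <= 1 by lra.
  exists (x - pi x + z); rewrite px' pix' z2; split=> //.
    apply: le_trans x1; apply: le_trans (lerD (nrD _ _) (lexx _)) _.
    by nra.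
  rewrite exprS invfM mulrCA; nra.
have [k Hk] := geometric_small (nr (pi v)) e0.
have [x [x1 x2 x3]] := main k.
exists x; split=> //; last exact: le_trans x2 (ltW Hk).
apply: le_trans Sv; apply: le_trans x1.
have -> : nr x = nr (p x + pi x) by rewrite /pi subrKC.
by apply: le_trans (nrD _ _) _; have := nr_ge0 (pi x); lra.
Qed.

End KernelReduction.

(** The size of [v] is not controlled by [t]. After the reduction [v'] is [q (D v')] up to [|t|],
    and [D v'] is close to [t X]; hence [nr v'] is [O(|t|)], the linearization error is small
    against [t], and [D (v' / t)] approximates [X]. The range of [D] is closed. *)
Lemma tangent_in_range (X : M) :
  (forall e : R, 0 < e -> exists t : R, exists v : E,
    [/\ t != 0, nr v < e & nm (r v - 1%:M - toF t *: X) <= e * `|t|]) ->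
  exists v, X = D v.
Proof.
move=> HX; have [q [qD qZ [c c0 qc] Dq]] := linear_section (fdiffD rdiff) (fdiffZ rdiff).
have [A A0 [d1 d10 red]] := kernel_reduce qD qZ c0 qc Dq.
apply: (linear_closed_range (fdiffD rdiff) (fdiffZ rdiff)) => e e0.
pose B := 2 * (c * (nm X + 1) + 1).
have B0 : 0 < B by rewrite mulr_gt0// ltr_wpDl// mulr_ge0 ?(ltW c0)// addr_ge0 ?nm_ge0.
(* The first bound absorbs [eta * c * nr v'] into the left side of the estimate [nr v' <= B * |t|];
   the second makes the linearization error at most [e / 2 * |t|]. *)
pose eta := Num.min (1 / (2 * c)) (e / (2 * B)).
have eta0 : 0 < eta by rewrite lt_min !divr_gt0// mulr_gt0.
have N1 : 0 < (N%:R + 1 : R) by rewrite ltr_wpDl.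
have [d2 d20 near2] := fdiff_near rdiff (divr_gt0 eta0 N1).
pose ep := Num.min (Num.min 1 (e / 2)) (Num.min d1 (d2 / A)).
have ep0 : 0 < ep by rewrite !lt_min ltr01 d10 !divr_gt0.
have [t [v [t0 ve tX]]] := HX ep ep0.
have ep1 : ep <= 1 by rewrite !ge_min lexx.
have ep2 : ep <= e / 2 by rewrite !ge_min lexx orbT.
have v1 : nr v < d1 by apply: lt_le_trans ve _; rewrite !ge_min lexx !orbT.
have v2 : A * nr v < d2.
  by rewrite mulrC -ltr_pdivlMr//; apply: lt_le_trans ve _; rewrite !ge_min lexx !orbT.
have T0 : 0 < `|t| by rewrite normr_gt0.
have [v' [w1 w2 w3]] := red v v1 _ T0.
have w4 : nr v' < d2 := le_lt_trans w1 v2.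
have near' : nm (r v' - 1%:M - D v') <= eta * nr v'.
  have := near2 v' w4; rewrite add0r r0 => h.
  apply: (@le_trans _ _ (N%:R * (eta / (N%:R + 1) * nr v'))).
    by rewrite /nm ler_wpM2l.
  have -> : N%:R * (eta / (N%:R + 1) * nr v') = N%:R / (N%:R + 1) * (eta * nr v').
    by field; rewrite lt0r_neq0.
  rewrite ler_piMl ?mulr_ge0 ?nr_ge0 ?(ltW eta0)//.
  by rewrite ler_pdivrMr// mul1r lerDl.
have DX : nm (D v' - toF t *: X) <= eta * nr v' + ep * `|t|.
  apply: le_trans (nm_tri _ (r v' - 1%:M) _) _; apply: lerD; first by rewrite nmC.
  by rewrite w3.
have v'B : nr v' <= B * `|t|.
  have h1 : nr v' <= c * nm (D v') + `|t|.
    have -> : nr v' = nr (q (D v') + (v' - q (D v'))) by rewrite subrKC.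
    by apply: le_trans (nrD _ _) _; apply: lerD.
  have h2 : nm (D v') <= `|t| * nm X + (eta * nr v' + `|t|).
    apply: le_trans (nmBr _ (toF t *: X)) _; rewrite nmZ lerD2l.
    by apply: le_trans DX _; rewrite lerD2l ger_pMl.
  have h3 : eta * c <= 1 / 2.
    have : eta <= 1 / (2 * c) by rewrite ge_min lexx.
    by rewrite ler_pdivlMr ?mulr_gt0//; lra.
  have h4 : c * nm (D v') <= c * (`|t| * nm X + (eta * nr v' + `|t|)).
    by rewrite ler_wpM2l// ltW.
  have h5 : eta * c * nr v' <= 1 / 2 * nr v' by rewrite ler_wpM2r ?nr_ge0.
  rewrite /B; lra.
exists (toF t^-1 *: v'); rewrite (fdiffZ rdiff).
have -> : X - toF t^-1 *: D v' = toF t^-1 *: (toF t *: X - D v').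
  by rewrite scalerBr scalerA -rmorphM mulVf// rmorph1 scale1r.
rewrite nmZ nmC normfV mulrC ler_pdivrMr//; apply: le_trans DX _.
have h6 : eta * nr v' <= eta * (B * `|t|) by rewrite ler_wpM2l// ltW.
have h7 : eta * B <= e / 2.
  have : eta <= e / (2 * B) by rewrite ge_min lexx orbT.
  have B20 : 0 < 2 * B by rewrite mulr_gt0.
  by rewrite (ler_pdivlMr _ _ B20) => h; rewrite ler_pdivlMr//; lra.
have h8 : eta * B * `|t| <= e / 2 * `|t| by rewrite ler_wpM2r.
have h9 : ep * `|t| <= e / 2 * `|t| by rewrite ler_wpM2r.
lra.
Qed.

End LocalGroup.

(** * Lie groups *)

Section MoreFrechet.
Context {R : realType} {b : ground}.
Local Notation F := (base_field R b).

Lemma fdiff_eq (V W : normedModType F) (f g : V -> W) p L :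
  f =1 g -> fdiff f p L -> fdiff g p L.
Proof. by move=> /funext ->. Qed.

Lemma fdiff_cont (V W : normedModType F) (f : V -> W) p L :
  fdiff f p L -> {for p, continuous f}.
Proof.
move=> /fdiff_lip[K K0 [d d0 H]]; apply/nr_cvgP => e e0.
exists (Num.min d (e / K)); first by rewrite lt_min d0 divr_gt0.
move=> y; rewrite lt_min => /andP[/H yd yK]; rewrite subrKC in yd.
by apply: le_lt_trans yd _; rewrite mulrC -ltr_pdivlMr.
Qed.

Lemma fdiff_sum (V W : normedModType F) (I : Type) (s : seq I) (f : I -> V -> W)
    (L : I -> V -> W) p : (forall i, fdiff (f i) p (L i)) ->
  fdiff (fun v => \sum_(i <- s) f i v) p (fun x => \sum_(i <- s) L i x).
Proof.
move=> H; elim: s => [|i s IH].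
  have -> : (fun v => \sum_(i <- [::]) f i v) = (fun=> 0).
    by apply/funext => v; rewrite big_nil.
  have -> : (fun x => \sum_(i <- [::]) L i x) = (fun=> 0).
    by apply/funext => v; rewrite big_nil.
  exact: fdiff_cst.
have -> : (fun v => \sum_(i <- i :: s) f i v) = (fun v => f i v + \sum_(i <- s) f i v).
  by apply/funext => v; rewrite big_cons.
have -> : (fun v => \sum_(i <- i :: s) L i v) = (fun v => L i v + \sum_(i <- s) L i v).
  by apply/funext => v; rewrite big_cons.
exact: fdiff_add.
Qed.

Lemma fdiff_mull (V : normedModType F) m n p (A : 'M[F]_(m, n))
    (f : V -> 'M[F]_(n, p)) q L :
  fdiff f q L -> fdiff (fun v => A *m f v) q (fun x => A *m L x).
Proof.
move=> H; apply: (@fdiff_comp R b _ _ _ f (fun B => A *m B) q L (fun B => A *m B) H); apply: fdiff_lin.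
- by move=> B C; rewrite mulmxDr.
- by move=> k B; rewrite -scalemxAr.
exists (n%:R * nr A + 1); first by rewrite ltr_wpDl// mulr_ge0 ?nr_ge0.
move=> B; apply: le_trans (nr_mulmx _ _) _; rewrite mulrDl mul1r mulrA.
by rewrite lerDl nr_ge0.
Qed.

Lemma fdiff_mulr (V : normedModType F) m n p (A : 'M[F]_(n, p))
    (f : V -> 'M[F]_(m, n)) q L :
  fdiff f q L -> fdiff (fun v => f v *m A) q (fun x => L x *m A).
Proof.
move=> H; apply: (@fdiff_comp R b _ _ _ f (fun B => B *m A) q L (fun B => B *m A) H); apply: fdiff_lin.
- by move=> B C; rewrite mulmxDl.
- by move=> k B; rewrite -scalemxAl.
exists (n%:R * nr A + 1); first by rewrite ltr_wpDl// mulr_ge0 ?nr_ge0.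
move=> B; apply: le_trans (nr_mulmx _ _) _; rewrite mulrDl mul1r [nr B * _]mulrC mulrA.
by rewrite lerDl nr_ge0.
Qed.

Lemma fdiff_mulmx (V : normedModType F) m n p (f : V -> 'M[F]_(m, n))
    (g : V -> 'M[F]_(n, p)) q L K :
  fdiff f q L -> fdiff g q K ->
  fdiff (fun v => f v *m g v) q (fun x => L x *m g q + f q *m K x).
Proof.
apply: (@fdiff_bilin R b _ _ _ _ f g (fun X Y => X *m Y) (n%:R + 1)).
- by move=> *; rewrite mulmxDl.
- by move=> *; rewrite mulmxDr.
- by move=> *; rewrite -scalemxAl.
- by move=> *; rewrite -scalemxAr.
- by rewrite ltr_wpDl.
move=> A B; apply: le_trans (nr_mulmx _ _) _.
by rewrite ler_wpM2r ?mulr_ge0 ?nr_ge0// lerDl.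
Qed.

Lemma fdiff_trmx (V : normedModType F) m n (f : V -> 'M[F]_(m, n)) q L :
  fdiff f q L -> fdiff (fun v => (f v)^T) q (fun x => (L x)^T).
Proof.
move=> H; apply: (@fdiff_comp R b _ _ _ f (fun B => B^T) q L (fun B => B^T) H); apply: fdiff_lin.
- by move=> B C; rewrite raddfD.
- by move=> k B; rewrite linearZ.
exists 1 => // B; rewrite mul1r; apply: nr_mx_le => [|i j]; first exact: nr_ge0.
by rewrite mxE nr_entry.
Qed.

Lemma fdiff_rows (V : normedModType F) m n (f : 'I_m -> V -> 'rV[F]_n)
    (L : 'I_m -> V -> 'rV[F]_n) p : (forall i, fdiff (f i) p (L i)) ->
  fdiff (fun v => \matrix_i f i v) p (fun x => \matrix_i L i x).
Proof.
move=> H; have rows (g : 'I_m -> V -> 'rV[F]_n) :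
    (fun v => \matrix_i g i v) = (fun v => \sum_i (delta_mx i 0 : 'cV_m) *m g i v).
  apply/funext => v; apply/matrixP => i j; rewrite mxE summxE (bigD1 i)//= big1.
    by rewrite addr0 mxE big_ord1 mxE !eqxx mul1r.
  by move=> k ki; rewrite mxE big_ord1 mxE eq_sym (negPf ki) mul0r.
by rewrite !rows; apply: fdiff_sum => i; exact: fdiff_mull.
Qed.

(** The remainder is exactly [H *m H *m invmx (1%:M + H)], hence quadratic. The differentiability of
    [Ad] depends on this. *)
Lemma fdiff_invmx1 n : fdiff (@invmx F n) 1%:M (fun H => - H).
Proof.
split=> [A B|k A||e e0]; [exact: opprD | by rewrite scalerN | |].
  by exists 1 => // A; rewrite nrN mul1r.
have n1 : 0 < (n%:R + 1 : R) by rewrite ltr_wpDl.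
pose d := Num.min (1 / 2) (e / (2 * (n%:R + 1))) / (n%:R + 1).
exists d; first by rewrite divr_gt0// lt_min !divr_gt0// mulr_gt0.
move=> H; rewrite ltr_pdivlMr// => Hd.
have nH : nm H < Num.min (1 / 2) (e / (2 * (n%:R + 1))).
  by apply: le_lt_trans Hd; rewrite /nm mulrC ler_wpM2l ?nr_ge0// lerDl.
have [H1 H2] : nm H <= 1 / 2 /\ nm H <= e / (2 * (n%:R + 1)).
  by move: nH; rewrite lt_min => /andP[/ltW ? /ltW ?].
have Hu : 1%:M + H \in unitmx.
  by rewrite -[H]opprK unit_1B// nmN; lra.
have -> : invmx (1%:M + H) - invmx 1%:M - - H = (H *m H) *m invmx (1%:M - - H).
  apply: (can_inj (mulmxK Hu)); rewrite [RHS]/= opprK mulmxKV// invmx1.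
  rewrite mulmxDl mulmxBl mulVmx// mul1mx [H *m (_ + _)]mulmxDr mulmx1.
  by rewrite opprD !addrA subrr sub0r addNr add0r.
apply: le_trans (nr_le_nm _) _.
have h : nm (- H) <= 1 / 2 by rewrite nmN.
apply: le_trans (nm_invmx _ h) _.
apply: le_trans (ler_wpM2l _ (nmM _ _)) _ => //.
have : nm H * nm H <= e / (2 * (n%:R + 1)) * nm H by rewrite ler_wpM2r ?nm_ge0.
rewrite {3}/nm => h2.
have h3 : 2 * (e / (2 * (n%:R + 1)) * (n%:R * nr H)) = n%:R / (n%:R + 1) * (e * nr H).
  by field; rewrite lt0r_neq0.
have h4 : n%:R / (n%:R + 1) * (e * nr H) <= e * nr H.
  rewrite ler_piMl ?mulr_ge0 ?nr_ge0 ?(ltW e0)//.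
  by rewrite ler_pdivrMr// mul1r lerDl.
lra.
Qed.

End MoreFrechet.

(** * The adjoint action, the bracket and the local group of a Lie group *)

Section LieGroup.
Context {R : realType} {b : ground}.
Local Notation F := (base_field R b).
Variable G : lieGroup F.
Local Notation E := 'rV[F]_(lie_dim G).
Local Notation phi := (lie_chart1 G).
Local Notation psi := (chart_inv (lie_chart1 G)).
Local Notation o := (lie_chart1 G 1%g).
Local Notation A := (lie_atlas G).
Implicit Types (c d e : chart G E).

Lemma chart_imgP c v : chart_img c v ->
  chart_dom c (chart_inv c v) /\ c (chart_inv c v) = v.
Proof. by case=> p cp <-; rewrite (chart_mapK cp). Qed.

Lemma chart_img_map c p : chart_dom c p -> chart_img c (c p).
Proof. by move=> cp; exists p. Qed.

Lemma chart_img_nbhs c v : chart_img c v -> nbhs v (chart_img c).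
Proof. by move=> cv; apply: open_nbhs_nbhs; split=> //; exact: chart_img_open. Qed.

Lemma chart_dom_nbhs c p : chart_dom c p -> nbhs p (chart_dom c).
Proof. by move=> cp; apply: open_nbhs_nbhs; split=> //; exact: chart_dom_open. Qed.

Lemma chart_inv_cvg c p : chart_dom c p -> chart_inv c @ c p --> p.
Proof.
move=> cp; have : chart_inv c @ c p --> chart_inv c (c p).
  exact: (chart_inv_continuous (chart_img_map cp)).
by rewrite (chart_mapK cp).
Qed.

Lemma lie_mul_cvg (T : topologicalType) (x : T) (f g : T -> G) (p q : G) :
  f @ x --> p -> g @ x --> q -> (fun y => (f y * g y)%g) @ x --> (p * q)%g.
Proof.
move=> fp gq; have [mulc _] := lie_smooth_mul G.
exact: (@cvg_comp2 _ _ _ _ _ _ _ _ _ _ _ f g (fun a b => (a * b)%g) fp gq (mulc (p, q))).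
Qed.

Lemma phi1_dom : chart_dom phi 1%g. Proof. exact: lie_chart1_dom. Qed.

Lemma psi_o : psi o = 1%g. Proof. by rewrite chart_mapK//; exact: phi1_dom. Qed.

Let E_basis := rv_basis (R := R) (b := b) (lie_dim G).

Definition chart_mul c d e (v : E * E) : E :=
  e (chart_inv c v.1 * chart_inv d v.2)%g.

Definition chart_mul_dom c d e : set (E * E) :=
  [set v : E * E | [/\ chart_img c v.1, chart_img d v.2 &
        chart_dom e (chart_inv c v.1 * chart_inv d v.2)%g]].

Lemma chart_mul_nbhs c d e p q : chart_dom c p -> chart_dom d q ->
  chart_dom e (p * q)%g -> nbhs (c p, d q) (chart_mul_dom c d e).
Proof.
move=> cp dq epq.
have n1 : nbhs (c p, d q) [set v : E * E | chart_img c v.1].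
  exact: (@cvg_fst _ _ (nbhs (c p)) (nbhs (d q)) _ _ (chart_img_nbhs (chart_img_map cp))).
have n2 : nbhs (c p, d q) [set v : E * E | chart_img d v.2].
  exact: (@cvg_snd _ _ (nbhs (c p)) (nbhs (d q)) _ _ (chart_img_nbhs (chart_img_map dq))).
have n3 : nbhs (c p, d q) [set v : E * E |
    chart_dom e (chart_inv c v.1 * chart_inv d v.2)%g].
  have h1 : (fun v : E * E => chart_inv c v.1) @ (c p, d q) --> p.
    exact: (@cvg_comp _ _ _ (fun v : E * E => v.1) (chart_inv c) (nbhs (c p, d q))
      (nbhs (c p)) (nbhs p) (@cvg_fst _ _ (nbhs (c p)) (nbhs (d q)) _) (chart_inv_cvg cp)).
  have h2 : (fun v : E * E => chart_inv d v.2) @ (c p, d q) --> q.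
    exact: (@cvg_comp _ _ _ (fun v : E * E => v.2) (chart_inv d) (nbhs (c p, d q))
      (nbhs (d q)) (nbhs q) (@cvg_snd _ _ (nbhs (c p)) (nbhs (d q)) _) (chart_inv_cvg dq)).
  exact: (lie_mul_cvg h1 h2 (chart_dom_nbhs epq)).
by apply: filterS3 n1 n2 n3 => v h1 h2 h3; split.
Qed.

Lemma chart_mul_fdiff c d e p q : A c -> A d -> A e ->
  chart_dom c p -> chart_dom d q -> chart_dom e (p * q)%g ->
  fdiff (chart_mul c d e) (c p, d q) (fun x => 'D_x (chart_mul c d e) (c p, d q)).
Proof.
move=> Ac Ad Ae cp dq epq; have [_ /(_ c d e Ac Ad Ae 1%N) Hs] := lie_smooth_mul G.
exact: (Ck_fdiff (pair_basis E_basis E_basis) (chart_mul_nbhs cp dq epq) Hs).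
Qed.

Definition lie_conj (g : G) (v : E) : E := phi (g * psi v * g^-1)%g.

Lemma lie_conj_o g : lie_conj g o = o.
Proof. by rewrite /lie_conj psi_o mulg1 mulgV. Qed.

Lemma psi_cvg : psi @ o --> (1%g : G).
Proof. exact: chart_inv_cvg phi1_dom. Qed.

Lemma psi_conj_near g : \forall v \near o, psi (lie_conj g v) = (g * psi v * g^-1)%g.
Proof.
have h : (fun v => g * psi v * g^-1)%g @ o --> (g * 1 * g^-1)%g.
  have g1 : (fun _ : E => g) @ o --> g by exact: (@cvg_cst G g E (nbhs o)).
  have g2 : (fun _ : E => g^-1)%g @ o --> (g^-1)%g.
    exact: (@cvg_cst G (g^-1)%g E (nbhs o)).
  exact: (lie_mul_cvg (lie_mul_cvg g1 psi_cvg) g2).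
have dom1 : chart_dom phi (g * 1 * g^-1)%g by rewrite mulg1 mulgV; exact: phi1_dom.
have : nbhs o [set v | chart_dom phi (g * psi v * g^-1)%g] := h _ (chart_dom_nbhs dom1).
 apply: filterS => v /= dv.
by rewrite /lie_conj chart_mapK.
Qed.

(** As [g] may lie far from the identity, the conjugation is factored into two products, read in
    charts [c] around [g] and [d] around its inverse. Some differential exists by the chain rule,
    and it must be [Ad g], which is defined by directional derivatives. *)
Lemma lie_conj_fdiff g : fdiff (lie_conj g) o (Ad g).
Proof.
have [cov _] := lie_is_atlas G.
have [c Ac cg] := cov g; have [d Adt dg] := cov (g^-1)%g.
have Aphi := lie_chart1_atlas G.
have cg1 : chart_dom c (g * 1)%g by rewrite mulg1.
have phi1 : chart_dom phi (g * g^-1)%g by rewrite mulgV; exact: phi1_dom.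
have H1 := chart_mul_fdiff Ac Aphi Ac cg phi1_dom cg1.
have H2 := chart_mul_fdiff Ac Adt Aphi cg dg phi1.
have I1 := fdiff_comp (fdiff_pair (fdiff_cst (c g) o) (fdiff_id o)) H1.
have e1 : (chart_mul c phi c \o (fun x : E => (c g, id x))) o = c g.
  by rewrite /= /chart_mul /= chart_mapK// psi_o mulg1.
rewrite -e1 in H2.
have I2 := fdiff_comp I1 (fdiff_comp (fdiff_pair (fdiff_id _) (fdiff_cst (d (g^-1)%g) _)) H2).
have : exists L, fdiff (lie_conj g) o L.
  eexists; apply: fdiff_near_eq I2.
  have h : (fun v => g * psi v)%g @ o --> (g * 1)%g.
    have g1 : (fun _ : E => g) @ o --> g by exact: (@cvg_cst G g E (nbhs o)).
    exact: (lie_mul_cvg g1 psi_cvg).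
  have : nbhs o [set v | chart_dom c (g * psi v)%g] := h _ (chart_dom_nbhs cg1).
  apply: filterS => v /= dv.
  by rewrite /chart_mul /= !chart_mapK//.
move=> [L HL]; apply: (fdiff_ext _ HL) => x.
by rewrite -(fdiff_derive HL x).2.
Qed.

Lemma AdD (g : G) (x y : E) : Ad g (x + y) = Ad g x + Ad g y.
Proof. exact: (fdiffD (lie_conj_fdiff g)). Qed.

Lemma AdZ (g : G) k (x : E) : Ad g (k *: x) = k *: Ad g x.
Proof. exact: (fdiffZ (lie_conj_fdiff g)). Qed.

Lemma Ad1 (x : E) : Ad (1 : G)%g x = x.
Proof.
have H : fdiff (lie_conj 1%g) o id.
  apply: fdiff_near_eq (fdiff_id o).
  have := chart_img_nbhs (chart_img_map phi1_dom); apply: filterS => v dv.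
  by rewrite /lie_conj mul1g invg1 mulg1 (chart_imgP dv).2.
exact: (fdiff_unique (lie_conj_fdiff 1%g) H).
Qed.

Lemma AdM (g1 g2 : G) (x : E) : Ad (g1 * g2 : G)%g x = Ad g1 (Ad g2 x).
Proof.
have H1 := lie_conj_fdiff g1; rewrite -{1}(lie_conj_o g2) in H1.
have H := fdiff_comp (lie_conj_fdiff g2) H1.
have : fdiff (lie_conj (g1 * g2)%g) o (Ad g1 \o Ad g2).
  apply: fdiff_near_eq H; have := psi_conj_near g2; apply: filterS => v /= e.
  by rewrite {1}/lie_conj e /lie_conj invgM !mulgA.
by move=> /(fdiff_unique (lie_conj_fdiff (g1 * g2)%g)).
Qed.

(* In the chart, [psi v psi w psi v^-1 psi v = psi v psi w]; differentiating in
   [w] at the identity expresses [Ad (psi v)] through the first derivatives of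
   the product. *)
Lemma Ad_eq : \forall v \near o, forall y,
  'D_(Ad (psi v) y, 0 : E) (chart_mul phi phi phi) (o, v) =
  'D_(0 : E, y) (chart_mul phi phi phi) (v, o).
Proof.
have Aphi := lie_chart1_atlas G.
have := chart_img_nbhs (chart_img_map phi1_dom); apply: filterS => v [g dg <-{v}] y.
have dg1 : chart_dom phi (g * 1)%g by rewrite mulg1.
have d1g : chart_dom phi (1 * g)%g by rewrite mul1g.
have H1 := chart_mul_fdiff Aphi Aphi Aphi phi1_dom dg d1g.
have H2 := chart_mul_fdiff Aphi Aphi Aphi dg phi1_dom dg1.
have I2 := fdiff_comp (fdiff_pair (fdiff_cst (phi g) o) (fdiff_id o)) H2.
have J := fdiff_pair (lie_conj_fdiff g) (fdiff_cst (phi g) o).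
rewrite -{1}(lie_conj_o g) in H1.
have I1 := fdiff_comp J H1.
rewrite chart_mapK//.
suff : fdiff (chart_mul phi phi phi \o (fun x : E => (phi g, id x))) o
  ((fun x => 'D_x (chart_mul phi phi phi) (o, phi g)) \o (fun x => (Ad g x, 0))).
  by move=> /(fdiff_unique I2)/(_ y)/esym.
apply: fdiff_near_eq I1; have := psi_conj_near g; apply: filterS => w /= e.
by rewrite /chart_mul /= e chart_mapK// -mulgA mulVg mulg1.
Qed.

(** [Ad (psi v)] is itself a derivative, so its dependence on [v] needs a formula. By [Ad_eq],
    [Ad (psi v) y *m P v = Q v], where [P] and [Q] consist of first derivatives of the product and
    are differentiable; [P o] is the identity matrix, so [P v] can be inverted near [o]. *)
Lemma Ad_fdiff (y : E) : fdiff (fun v => Ad (psi v) y) o (fun x => lie_bracket G x y).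
Proof.
have Aphi := lie_chart1_atlas G.
set f := chart_mul phi phi phi; set U := chart_mul_dom phi phi phi.
have d11 : chart_dom phi (1 * 1)%g by rewrite mulg1; exact: phi1_dom.
have Un := chart_mul_nbhs phi1_dom phi1_dom d11.
have [_ /(_ phi phi phi Aphi Aphi Aphi 2%N) Hs] := lie_smooth_mul G.
rewrite -/f -/U in Hs.
have ee := pair_basis E_basis E_basis.
have H1 (w : E * E) : fdiff ('D_w f) (o, o) (fun x => 'D_x ('D_w f) (o, o)).
  exact: (Ck_fdiff ee Un (Ck_derive w Hs)).
have f00 := chart_mul_fdiff Aphi Aphi Aphi phi1_dom phi1_dom d11.
pose P v := \matrix_i ('D_(rv_delta i, 0 : E) f (o, v)).
pose Q v := 'D_(0 : E, y) f (v, o).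
have [LP HP] : exists L, fdiff P o L.
  eexists; apply: fdiff_rows => i.
  exact: (fdiff_comp (fdiff_pair (fdiff_cst o o) (fdiff_id o)) (H1 _)).
have [LQ HQ] : exists L, fdiff Q o L.
  by eexists; exact: (fdiff_comp (fdiff_pair (fdiff_id o) (fdiff_cst o o)) (H1 _)).
have fl x : 'D_(x, 0 : E) f (o, o) = x.
  have I := fdiff_comp (fdiff_pair (fdiff_id o) (fdiff_cst o o)) f00.
  have : fdiff (f \o (fun x : E => (id x, o))) o id.
    apply: fdiff_near_eq (fdiff_id o).
    have := chart_img_nbhs (chart_img_map phi1_dom); apply: filterS => v dv.
    by rewrite /= /f /chart_mul /= psi_o mulg1 (chart_imgP dv).2.
  by move=> /(fdiff_unique I)/(_ x).
have P1 : P o = 1%:M.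
  by apply/row_matrixP => i; rewrite rowK fl row1.
have HV : fdiff (fun v => invmx (P v)) o (fun x => - LP x).
  have := fdiff_invmx1 (R := R) (b := b) (lie_dim G); rewrite -{1}P1 => HV.
  exact: (fdiff_comp HP HV).
have HA := fdiff_mulmx HQ HV.
have : exists L, fdiff (fun v => Ad (psi v) y) o L.
  eexists; apply: fdiff_near_eq HA.
  have nearU : \forall v \near o, U (o, v).
    have [d d0 Hd] := (nbhs_nrP _ _).1 Un.
    apply: (nbhs_nrP _ _).2; exists d => // v vd; apply: Hd.
    suff -> : (o, v) - (o, o) = (0 : E, v - o) by rewrite nr_0pair.
    by apply/eqP; rewrite xpair_eqE /= subrr !eqxx.
  have nearP : \forall v \near o, P v \in unitmx.
    have n1 : 0 < ((lie_dim G)%:R + 1 : R) by rewrite ltr_wpDl.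
    have [d d0 Hd] := (nr_cvgP _ _).1 (fdiff_cont HP) _ (divr_gt0 ltr01 n1).
    apply: (nbhs_nrP _ _).2; exists d => // v /Hd; rewrite P1 nrC ltr_pdivlMr// => Pv.
    rewrite -[P v](subKr 1%:M) unit_1B//; apply: le_lt_trans Pv.
    by rewrite /nm mulrC ler_wpM2l ?nr_ge0// lerDl.
  apply: filterS3 Ad_eq nearU nearP => v eqv Uv Pv.
  apply: (can_inj (mulmxK Pv)); rewrite mulmxKV// /Q -eqv.
  have Uv' : fdiff f (o, v) (fun x => 'D_x f (o, v)).
    case: Uv => /= _ /chart_imgP[v1 v2]; rewrite psi_o => v3.
    by have := chart_mul_fdiff Aphi Aphi Aphi phi1_dom v1 v3; rewrite v2.
  rewrite mulmx_sum_row (derive_basis ee Uv') big_split_ord /=.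
  rewrite [X in _ + X]big1 ?addr0 => [|j _].
    by apply: eq_bigr => i _; rewrite (unsplitK (inl _ i)) rowK.
  by rewrite (unsplitK (inr _ j)) mxE scale0r.
move=> [L HL]; apply: (fdiff_ext _ HL) => x.
by rewrite -(fdiff_derive HL x).2.
Qed.

Lemma lie_bracketDl x y z :
  lie_bracket G (x + y) z = lie_bracket G x z + lie_bracket G y z.
Proof. exact: (fdiffD (Ad_fdiff z)). Qed.

Lemma lie_bracketZl k x z : lie_bracket G (k *: x) z = k *: lie_bracket G x z.
Proof. exact: (fdiffZ (Ad_fdiff z)). Qed.

Lemma lie_bracketDr x y z :
  lie_bracket G x (y + z) = lie_bracket G x y + lie_bracket G x z.
Proof.
have H := fdiff_add (Ad_fdiff y) (Ad_fdiff z).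
have : fdiff (fun v => Ad (psi v) (y + z)) o
    (fun x => lie_bracket G x y + lie_bracket G x z).
  by apply: fdiff_eq H => v; rewrite AdD.
by move=> /(fdiff_unique (Ad_fdiff (y + z))).
Qed.

Lemma lie_bracketZr k x y : lie_bracket G x (k *: y) = k *: lie_bracket G x y.
Proof.
have L : fdiff (fun z : E => k *: z) (Ad (psi o) y) (fun z => k *: z).
  apply: fdiff_lin => [u v|l u|]; first by rewrite scalerDr.
    by rewrite !scalerA mulrC.
  exists (nr (k : F^o) + 1); first by rewrite ltr_wpDl ?nr_ge0.
  by move=> u; rewrite nrZ ler_wpM2r ?nr_ge0// lerDl.
have H := fdiff_comp (Ad_fdiff y) L.
have : fdiff (fun v => Ad (psi v) (k *: y)) o (fun x => k *: lie_bracket G x y).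
  by apply: fdiff_eq H => v; rewrite AdZ.
by move=> /(fdiff_unique (Ad_fdiff (k *: y))).
Qed.

Section Hom.
Context {N : nat} (T : G -> 'M[F]_N) (D : E -> 'M[F]_N).
Hypothesis T1 : T 1%g = 1%:M.
Hypothesis TM : forall x y, T (x * y)%g = T x *m T y.
Hypothesis TD : fdiff (T \o psi) o D.

Lemma hom_Ad (g : G) (y : E) : T g *m D y = D (Ad g y) *m T g.
Proof.
have H1 := fdiff_mull (T g) TD.
have TD' := TD; rewrite -{1}(lie_conj_o g) in TD'.
have H2 := fdiff_mulr (T g) (fdiff_comp (lie_conj_fdiff g) TD').
have : fdiff (fun v => T g *m (T \o psi) v) o (fun x => D (Ad g x) *m T g).
  apply: fdiff_near_eq H2; have := psi_conj_near g; apply: filterS => v /= e.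
  by rewrite e -!TM -mulgA mulVg mulg1.
by move=> /(fdiff_unique H1)/(_ y).
Qed.

(** By [hom_Ad], [T (psi v) D y = D (Ad (psi v) y) T (psi v)]; the product rule at the identity
    gives the commutator. *)
Lemma hom_bracket x y : D (lie_bracket G x y) = D x *m D y - D y *m D x.
Proof.
have H1 := fdiff_mulr (D y) TD.
have DL : fdiff D (Ad (psi o) y) D.
  by apply: fdiff_lin (fdiffD TD) (fdiffZ TD) (fdiff_bound TD).
have H2 := fdiff_mulmx (fdiff_comp (Ad_fdiff y) DL) TD.
have : fdiff (fun v => (T \o psi) v *m D y) o (fun x =>
    D (lie_bracket G x y) *m (T \o psi) o + D (Ad (psi o) y) *m D x).
  by apply: fdiff_eq H2 => v /=; rewrite hom_Ad.
move=> /(fdiff_unique H1)/(_ x) /= ->.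
by rewrite psi_o T1 mulmx1 Ad1 addrK.
Qed.

End Hom.

(** This is [hom_bracket] for the adjoint representation. The transposes are there because row
    vectors are multiplied from the right, which reverses products. *)
Lemma lie_jacobi x y z : lie_bracket G (lie_bracket G x y) z =
  lie_bracket G x (lie_bracket G y z) - lie_bracket G y (lie_bracket G x z).
Proof.
have linE (f : E -> E) (v : E) : {morph f : a c / a + c} ->
    (forall k a, f (k *: a) = k *: f a) -> v *m \matrix_i f (rv_delta i : E) = f v.
  move=> fD fZ; have f0 : f 0 = 0 by rewrite -[X in f X](scale0r 0) fZ scale0r.
  rewrite mulmx_sum_row [in RHS](fb_sum E_basis v) (big_morph f fD f0).
  by apply: eq_bigr => i _; rewrite rowK fZ.
have [T [D [TE DE TD]]] : exists (T : G -> 'M[F]_(lie_dim G)) (D : E -> 'M[F]_(lie_dim G)),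
    [/\ forall g v, v *m (T g)^T = Ad g v,
        forall u v, v *m (D u)^T = lie_bracket G u v & fdiff (T \o psi) o D].
  exists (fun g => (\matrix_i Ad g (rv_delta i : E))^T).
  exists (fun x => (\matrix_i lie_bracket G x (rv_delta i : E))^T).
  split.
  - by move=> g v; rewrite trmxK (linE (Ad g))//; [exact: AdD | exact: AdZ].
  - move=> u v; rewrite trmxK (linE (lie_bracket G u))//.
      by move=> *; exact: lie_bracketDr.
    by move=> *; exact: lie_bracketZr.
  - by apply: fdiff_trmx; apply: fdiff_rows => i; exact: Ad_fdiff.
have ext (M1 M2 : 'M[F]_(lie_dim G)) : (forall v : E, v *m M1^T = v *m M2^T) -> M1 = M2.
  by move=> H; apply: trmx_inj; apply/row_matrixP => i; rewrite !rowE H.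
have T1 : T 1%g = 1%:M by apply: ext => v; rewrite TE Ad1 trmx1 mulmx1.
have TM g1 g2 : T (g1 * g2)%g = T g1 *m T g2.
  by apply: ext => v; rewrite trmx_mul mulmxA !TE AdM.
have := hom_bracket T1 TM TD x y; move/(congr1 (fun M => z *m M^T)).
rewrite DE => ->; rewrite linearB /= !trmx_mul mulmxBr !mulmxA.
by rewrite !DE.
Qed.

Definition local_mul (u v : E) : E := phi (psi (o + u) * psi (o + v))%g - o.

Lemma local_group : exists d C : R, [/\ [/\ 0 < d, 0 <= C & C * d <= 1 / 2],
  forall u : E, nr u < d -> chart_img phi (o + u),
  forall u v : E, nr u < d -> nr v < d ->
    psi (o + local_mul u v) = (psi (o + u) * psi (o + v))%g &
  forall u u' v v' : E, nr u < d -> nr u' < d -> nr v < d -> nr v' < d ->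
    nr (local_mul u v - local_mul u' v - (local_mul u v' - local_mul u' v'))
      <= C * (nr (u - u') * nr (v - v'))].
Proof.
have Aphi := lie_chart1_atlas G.
have d11 : chart_dom phi (1 * 1)%g by rewrite mulg1; exact: phi1_dom.
have Un := chart_mul_nbhs phi1_dom phi1_dom d11.
have [_ /(_ phi phi phi Aphi Aphi Aphi 2%N) Hs] := lie_smooth_mul G.
have [C C0 [d1 d10 mix]] := mixed_difference E_basis Un Hs.
have [d2 d20 Hd2] := (nbhs_nrP _ _).1 Un.
pose d := Num.min (Num.min d1 d2) (1 / (2 * C)).
have dd1 : d <= d1 by rewrite !ge_min lexx.
have dd2 : d <= d2 by rewrite !ge_min lexx orbT.
have inU (u v : E) : nr u < d -> nr v < d -> chart_mul_dom phi phi phi (o + u, o + v).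
  move=> ud vd; apply: Hd2.
  have -> : (o + u, o + v) - (o, o) = (u, v).
    by apply/eqP; rewrite xpair_eqE /= (addrC o u) (addrC o v) !addrK !eqxx.
  have h : nr (u, v) <= Num.max (nr u) (nr v).
    by apply: nr_pair_le; rewrite le_max lexx ?orbT.
  by apply: (le_lt_trans h); apply: lt_le_trans dd2; rewrite gt_max ud.
exists d, C; split.
- split; first by rewrite !lt_min d10 d20 divr_gt0// mulr_gt0.
    exact: ltW.
  have C20 : 0 < 2 * C by rewrite mulr_gt0.
  have : d <= 1 / (2 * C) by rewrite ge_min lexx orbT.
  rewrite (ler_pdivlMr _ _ C20); lra.
- by move=> u ud; have [] := inU u u ud ud.
- move=> u v ud vd; have [/= _ _ h] := inU u v ud vd.
  by rewrite /local_mul subrKC chart_mapK.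
- move=> u u' v v' ud ud' vd vd'.
have lt1 (w : E) : nr w < d -> nr (o + w - o) < d1.
  by move=> wd; rewrite (addrC o w) addrK; exact: lt_le_trans dd1.
have sub2 (x y : E) : (x - o) - (y - o) = x - y by rewrite opprB addrA subrK.
have sub3 (x y : E) : (o + x) - (o + y) = x - y by rewrite opprD addrACA subrr add0r.
have := mix _ _ _ _ (lt1 _ ud) (lt1 _ ud') (lt1 _ vd) (lt1 _ vd').
by rewrite /local_mul !sub2 !sub3.
Qed.

End LieGroup.

(** * Cartan subalgebras *)

Section VectorSpaces.
Context {K : fieldType} {V W : vectType K}.
Variable f : V -> W.
Hypothesis fD : forall x y, f (x + y) = f x + f y.
Hypothesis fZ : forall c x, f (c *: x) = c *: f x.

(** Differentials and brackets are plain functions with linearity laws; this turns them into linear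
    maps, so that their kernels become subspaces. *)
Lemma exists_linfun : exists g : 'Hom(V, W), forall x, g x = f x.
Proof.
have f_lin : linear f by move=> c x y; rewrite fD fZ.
pose g : {linear V -> W} := HB.pack f (GRing.isLinear.Build _ _ _ _ f f_lin).
by exists (linfun g) => x; rewrite lfunE.
Qed.

Lemma exists_ker : exists U : {vspace V}, forall x, (x \in U) = (f x == 0).
Proof.
have [g Hg] := exists_linfun.
by exists (lker g) => x; rewrite memv_ker Hg.
Qed.

End VectorSpaces.

(** * Fitting's lemma for commuting matrices *)

Section Fitting.
Context {F : fieldType}.

Lemma mx_pow_stable n (A : 'M[F]_n.+1) (U : {vspace 'rV[F]_n.+1}) p :
  (forall u, u \in U -> u *m A \in U) ->
  forall u, u \in U -> u *m horner_mx A p \in U.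
Proof.
move=> UA; elim/poly_ind: p => [|p c IH] u Uu; first by rewrite rmorph0 mulmx0 mem0v.
rewrite rmorphD rmorphM /= horner_mx_X horner_mx_C mulmxDr memvD//.
  by rewrite mulmxA UA// IH.
by rewrite mul_mx_scalar memvZ.
Qed.

(** Write the characteristic polynomial as [X^m r] with [r(0)] nonzero and [r / r(0) = 1 + X q];
    then apply Cayley-Hamilton. The factor [1 + A q(A)] differs from the identity by a multiple of
    [A], and yet its product with [A^m] vanishes. *)
Lemma fitting_poly n (A : 'M[F]_n.+1) : exists q m,
  A ^+ m * (1 + A * horner_mx A q) = 0.
Proof.
have [m [r r0 Er]] := multiplicity_XsubC (char_poly A) 0.
have c0 : char_poly A != 0 := monic_neq0 (char_poly_monic A).
rewrite c0 /= subr0 in r0 Er.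
have r00 : r.[0] != 0 by [].
have [s Es] : exists s, r = s * 'X + (r.[0])%:P.
  have : root (r - (r.[0])%:P) 0 by rewrite /root hornerD hornerN hornerC subrr.
  by case/factor_theorem=> s; rewrite subr0 => Hs; exists s; rewrite -Hs subrK.
exists (r.[0]^-1 *: s), m.
have CH := Cayley_Hamilton A; rewrite Er rmorphM rmorphXn /= horner_mx_X in CH.
have -> : 1 + A * horner_mx A (r.[0]^-1 *: s) = r.[0]^-1 *: horner_mx A r.
  rewrite {3}Es rmorphD rmorphM /= horner_mx_X horner_mx_C linearZ /= scalerDr.
  rewrite -scalemx1 scalerA mulVf// scale1r addrC; congr (_ + _).
  rewrite -scalerAr; congr (_ *: _).
  by have := comm_horner_mx2 A 'X s; rewrite /GRing.comm horner_mx_X.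
rewrite -scalerAr; apply/eqP; rewrite scaler_eq0; apply/orP; right; apply/eqP.
rewrite -[RHS]CH; have := comm_horner_mx2 A ('X^m) r.
by rewrite /GRing.comm rmorphXn /= horner_mx_X.
Qed.

(** Multiplying by [1 + A q(A)] changes the vector by an element of [U], makes it nilpotent under
    [A], and preserves nilpotency under the other matrices, as they commute with [A]. *)
Lemma fitting_seq n (s : seq 'M[F]_n.+1) (U : {vspace 'rV[F]_n.+1}) y :
  {in s &, forall A B, A * B = B * A} ->
  (forall A u, A \in s -> u \in U -> u *m A \in U) ->
  (forall A, A \in s -> y *m A \in U) ->
  exists2 y', y' - y \in U & forall A, A \in s -> exists m, y' *m (A ^+ m) = 0.
Proof.
elim: s => [|A s IH] comm US yU; first by exists y => //; rewrite subrr mem0v.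
have sA : A \in A :: s by exact: mem_head.
have ss B : B \in s -> B \in A :: s by move=> Bs; rewrite inE Bs orbT.
have [||| y1 y1U Hy1] := IH.
- by move=> B C Bs Cs; exact: comm (ss _ Bs) (ss _ Cs).
- by move=> B u Bs; apply: US; exact: ss.
- by move=> B Bs; exact: yU (ss _ Bs).
have [q [m Am]] := fitting_poly A.
have UA u : u \in U -> u *m A \in U by exact: US.
have y1A : y1 *m A \in U.
  by rewrite -(subrK y y1) mulmxDl memvD ?yU// UA.
exists (y1 *m (1 + A * horner_mx A q)).
  rewrite mulmxDr mulmx1 addrAC memvD//.
  by rewrite -mulmxE mulmxA mx_pow_stable.
move=> B; rewrite inE => /orP[/eqP->|Bs].
  exists m; rewrite -mulmxA.
  have -> : (1 + A * horner_mx A q) *m A ^+ m = A ^+ m * (1 + A * horner_mx A q).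
    rewrite mulmxE; apply: commrX; apply: commr_sym; apply: commrD; first exact: commr1.
    apply: commrM; first exact: commr_refl.
    by have := comm_horner_mx2 A 'X q; rewrite horner_mx_X.
  by rewrite Am mulmx0.
have [k Hk] := Hy1 _ Bs; exists k.
have AB : GRing.comm B A by exact: comm (ss _ Bs) sA.
have -> : y1 *m (1 + A * horner_mx A q) *m B ^+ k = y1 *m B ^+ k *m (1 + A * horner_mx A q).
  rewrite -!mulmxA; congr (_ *m _); rewrite !mulmxE; apply: commrX; apply: commr_sym; apply: commrD; first exact: commr1.
  by apply: commrM => //; exact: comm_mx_horner.
by rewrite Hk mul0mx.
Qed.

Lemma fitting_family n d (A : 'I_d -> 'M[F]_n) (U : {vspace 'rV[F]_n}) y :
  (forall i j, A i *m A j = A j *m A i) ->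
  (forall i u, u \in U -> u *m A i \in U) ->
  (forall i, y *m A i \in U) ->
  exists2 y', y' - y \in U &
    exists m : 'I_d -> nat, forall i, iter (m i) (mulmxr (A i)) y' = 0.
Proof.
(* Powers are taken in the matrix ring of size [n.+1]. The iterates of [mulmxr] in the statement
   also make sense at size 0, where all vectors vanish. *)
case: n A U y => [|n] A U y comm US yU.
  by exists y; [rewrite subrr mem0v | exists (fun=> 0%N) => i /=; rewrite thinmx0].
have [||| y' y'U Hy'] := @fitting_seq n (codom A) U y.
- by move=> _ _ /codomP[i ->] /codomP[j ->]; exact: comm.
- by move=> _ u /codomP[i ->]; exact: US.
- by move=> _ /codomP[i ->]; exact: yU.
exists y' => //; have [m Hm] := choice (fun i => Hy' (A i) (codom_f A i)).
exists m => i; rewrite -[RHS](Hm i); elim: (m i) => [|k IH]; first by rewrite mulmx1.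
by rewrite iterS IH exprSr mulmxA.
Qed.

End Fitting.

(** * Brackets, the Killing form and self-normalization *)

Section Cartan.
Context {F : numFieldType} {n : nat} (br : 'rV[F]_n -> 'rV[F]_n -> 'rV[F]_n).
Local Notation g := 'rV[F]_n.
Implicit Types (x y z u v : g) (h U a : {vspace g}).
Hypothesis brDl : forall x y z, br (x + y) z = br x z + br y z.
Hypothesis brZl : forall k x z, br (k *: x) z = k *: br x z.
Hypothesis brDr : forall x y z, br x (y + z) = br x y + br x z.
Hypothesis brZr : forall k x y, br x (k *: y) = k *: br x y.
Hypothesis jacobi : forall x y z, br (br x y) z = br x (br y z) - br y (br x z).

Let br0l z : br 0 z = 0.
Proof. by rewrite -[X in br X z](scale0r 0) brZl scale0r. Qed.

Let br0r z : br z 0 = 0.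
Proof. by rewrite -[X in br z X](scale0r 0) brZr scale0r. Qed.

Lemma brv_sub U1 U2 (W : {vspace g}) :
  (forall u v, u \in U1 -> v \in U2 -> br u v \in W) -> (brv br U1 U2 <= W)%VS.
Proof.
move=> H; apply/span_subvP => _ /allpairsP[[u v] /= [uU vU ->]].
by apply: H; exact: vbasis_mem.
Qed.

Lemma mem_brv U1 U2 u v : u \in U1 -> v \in U2 -> br u v \in brv br U1 U2.
Proof.
move=> uU vU; rewrite (coord_vbasis uU) (coord_vbasis vU).
rewrite (big_morph (fun x => br x _) (fun x y => brDl x y _) (br0l _)).
apply: memv_suml => i _; rewrite brZl memvZ//.
rewrite (big_morph (br _) (brDr _) (br0r _)).
apply: memv_suml => j _; rewrite brZr memvZ//.
apply: memv_span; apply/allpairsP; exists ((vbasis U1)`_i, (vbasis U2)`_j) => /=.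
by split=> //; apply: mem_nth; rewrite size_tuple.
Qed.

Let adE x v : v *m lin1_mx (br x) = br x v.
Proof.
have [f Hf] := exists_linfun (brDr x) (fun c => brZr c x).
have -> : lin1_mx (br x) = lin1_mx f.
  by apply/matrixP => i j; rewrite !mxE Hf.
by rewrite mul_rV_lin1 /= Hf.
Qed.

(** The kernel of [ad] is an abelian ideal. The ideal property comes from the Jacobi identity,
    antisymmetry not being available yet. *)
Lemma ad_kernel_trivial z : is_semisimple br -> (forall w, br z w = 0) -> z = 0.
Proof.
move=> ss zw; have [I HI] : exists I : {vspace g}, forall x,
    (x \in I) = (lin1_mx (br x) == 0).
  apply: exists_ker => [x y|c x].
    by apply/matrixP => i j; rewrite !mxE brDl mxE.
  by apply/matrixP => i j; rewrite !mxE brZl mxE.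
have HI' x : (x \in I) <-> forall v, br x v = 0.
  rewrite HI; split=> [/eqP x0 v|x0]; first by rewrite -adE x0 mulmx0.
  by apply/eqP/row_matrixP => i; rewrite rowE adE x0 row0.
have I0 : I = 0%VS.
  apply: ss.
    move=> x y /HI' y0; apply/HI' => v.
    by rewrite jacobi y0 br0r [br y _]y0 subrr.
  exists 1%N => /=; apply/eqP; rewrite -subv0.
  by apply: brv_sub => u v /HI' u0 _; rewrite u0 mem0v.
have : z \in I by apply/HI'.
by rewrite I0 memv0 => /eqP.
Qed.

(** In this form the Jacobi identity says that [ad] turns brackets into commutators. Thus
    [br x y + br y x] acts trivially, and semisimplicity makes it vanish. *)
Lemma br_antisym : is_semisimple br -> forall x y, br x y = - br y x.
Proof.
move=> ss x y; apply/eqP; rewrite -addr_eq0; apply/eqP.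
apply: ad_kernel_trivial => // w.
by rewrite brDl !jacobi addrA subrK subrr.
Qed.

Lemma killing_invariant x y z : killing br (br x y) z = killing br x (br y z).
Proof.
have adJ u v : lin1_mx (br (br u v)) =
    lin1_mx (br v) *m lin1_mx (br u) - lin1_mx (br u) *m lin1_mx (br v).
  apply/row_matrixP => i; rewrite !rowE adE jacobi mulmxBr !mulmxA.
  by rewrite !adE.
rewrite /killing !adJ mulmxBl mulmxBr !linearB /=; congr (_ - _); last by rewrite mulmxA.
by rewrite -mulmxA mxtrace_mulC mulmxA.
Qed.

Lemma killingDl x y z : killing br (x + y) z = killing br x z + killing br y z.
Proof.
rewrite /killing -mxtraceD -mulmxDl; congr (\tr (_ *m _)).
by apply/matrixP => i j; rewrite !mxE brDl mxE.
Qed.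

Lemma killingZl c x z : killing br (c *: x) z = c * killing br x z.
Proof.
rewrite /killing -mxtraceZ scalemxAl; congr (\tr (_ *m _)).
by apply/matrixP => i j; rewrite !mxE brZl mxE.
Qed.

(* The last nonzero term of the lower central series of [h] is stable under
   [theta], central and made of brackets, hence isotropic for the definite form
   [- killing x (theta y)]. *)
Lemma split_cartan_abelian (theta : 'End(g)) a h : cartan_subalgebra br h ->
  cartan_involution br theta -> abelian_in_p br theta a ->
  zero_root_space br a h -> forall x y, x \in h -> y \in h -> br x y = 0.
Proof.
move=> [hsub [k hk] _] [thetaK thetaM pos] [ap _] ha.
have th x : x \in h -> theta x \in h.
  move=> /ha xa; apply/ha => y ya.
  have -> : y = theta (- y) by rewrite linearN /= ap// opprK.
  by rewrite -thetaM -scaleN1r brZl xa// scaler0 linear0.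
have sub j : (iter j (brv br h) h <= h)%VS.
  elim: j => [|j IH] /=; first exact: subvv.
  by apply: brv_sub => u v uh vj; apply: hsub => //; exact: subvP IH _ vj.
have step j : iter j.+2 (brv br h) h = 0%VS -> iter j.+1 (brv br h) h = 0%VS.
  rewrite iterS; set Z := iter j.+1 _ _ => Z0.
  have hZ u z : u \in h -> z \in Z -> br u z = 0.
    by move=> uh zZ; have := mem_brv uh zZ; rewrite Z0 memv0 => /eqP.
  have tZ z u : z \in Z -> u \in h -> br u (theta z) = 0.
    by move=> zZ uh; rewrite -[u]thetaK -thetaM hZ ?th// linear0.
  apply/eqP; rewrite -subv0; apply/subvP => z zZ; rewrite memv0; apply/negPn/negP => z0.
  have [U HU] := @exists_ker _ _ F^o (fun u => killing br u (theta z)) (fun u v => killingDl u v (theta z)) (fun c u => killingZl c u (theta z)).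
  have ZU : (Z <= U)%VS.
    rewrite /Z iterS; apply: brv_sub => u v uh vj; rewrite HU killing_invariant tZ//.
      by rewrite /killing (_ : lin1_mx (br 0) = 0) ?mulmx0 ?mxtrace0//; apply/matrixP => i i'; rewrite !mxE br0l mxE.
    exact: (subvP (sub j)).
  have := pos z z0; rewrite (eqP (_ : killing br z (theta z) == 0)) ?oppr0 ?ltxx//.
  by rewrite -HU (subvP ZU).
have h1 : iter 1 (brv br h) h = 0%VS.
  case: k hk => [|k]; last by elim: k => [//|k IH] /step.
  move=> /= h0; apply/eqP; rewrite -subv0; apply: brv_sub => u v.
  by rewrite h0 memv0 => /eqP -> _; rewrite br0l mem0v.
move=> x y xh yh; have := mem_brv xh yh.
by rewrite [brv _ _ _]h1 memv0 => /eqP.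
Qed.

(* By Fitting's lemma [y] may be changed modulo [U] so that [h] acts on it
   nilpotently; then it lies in [h], which is its own normalizer. *)
Lemma cartan_quotient h U y : is_semisimple br -> cartan_subalgebra br h ->
  (forall u v, u \in h -> v \in h -> br u v = 0) ->
  (forall u v, u \in h -> v \in U -> br u v \in U) ->
  (forall u, u \in h -> br u y \in U) ->
  exists2 y', y' \in h & y' - y \in U.
Proof.
move=> ss [_ _ hnorm] hab hU yU.
pose H i := (vbasis h)`_i.
have Hh (i : 'I_(\dim h)) : H i \in h.
  by apply: vbasis_mem; apply: mem_nth; rewrite size_tuple.
have [||| y' y'U [m Hm]] := @fitting_family _ n (\dim h) (fun i => lin1_mx (br (H i))) U y.
- move=> i j; apply/row_matrixP => k; rewrite !rowE !mulmxA !adE.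
  have := jacobi (H j) (H i) (delta_mx 0 k); rewrite (hab (H j) (H i))// br0l => /esym/eqP.
  by rewrite subr_eq0 => /eqP.
- by move=> i u uU; rewrite adE hU.
- by move=> i; rewrite adE yU.
exists y' => //.
(* Induction on the total nilpotency order: the bracket of [H i] with [v] has a smaller order at [i]
   and no larger one elsewhere, as the [H j] act by commuting maps. So [[h, v]] lies in [h] by
   induction, and then so does [v]. *)
have [N] := ubnP (\sum_i m i); elim: N m y' Hm {y'U} => // N IH m v Hm mN.
apply: hnorm => u uh; rewrite br_antisym// memvN (coord_vbasis uh).
rewrite (big_morph (fun x => br x _) (fun x y => brDl x y _) (br0l _)).
apply: memv_suml => i _; rewrite brZl memvZ// -/(H i).
case mi: (m i) => [|k].
  by have := Hm i; rewrite mi /= => ->; rewrite br0r mem0v.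
apply: (IH (fun j => if j == i then k else m j)).
  move=> j; have comm (l : nat) w : iter l (mulmxr (lin1_mx (br (H j)))) (br (H i) w) =
      br (H i) (iter l (mulmxr (lin1_mx (br (H j)))) w).
    elim: l => //= l ->; rewrite !adE.
    have := jacobi (H i) (H j) (iter l (mulmxr (lin1_mx (br (H j)))) w).
    by rewrite (hab (H i) (H j))// br0l => /esym/eqP; rewrite subr_eq0 => /eqP.
  case: eqP => [->|_]; last by rewrite comm Hm br0r.
  by have := Hm i; rewrite mi iterSr /= adE.
move: mN; rewrite (bigD1 i)//= mi addSn ltnS; apply: leq_ltn_trans.
rewrite (bigD1 i)//= eqxx leq_add2l.
by apply: eq_leq; apply: eq_bigr => j /negPf ->.
Qed.

End Cartan.

(** * The Cayley criterion *)

Section Condensation.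
Context {R : realType}.

Lemma interval_uncountable (e : R) : 0 < e -> ~ countable [set t : R | 0 < t < e].
Proof.
move=> e0 /countable_lebesgue_measure0.
have -> : [set t : R | 0 < t < e] = [set` `]0, e[].
  by apply/seteqP; split=> t /=; rewrite in_itv.
rewrite lebesgue_measure_itv /= lte_fin e0 -EFinD => /eqP.
by rewrite eqe subr0 gt_eqF.
Qed.

(** Nothing is assumed of [f]. If every point of its graph were isolated, a basic open set together
    with a rational interval would determine [t0], and the interval from 0 to [e] would be
    countable. *)
Lemma condensation_point (T : topologicalType) (f : R -> T) (e : R) :
  @second_countable T -> 0 < e ->
  exists2 t0, 0 < t0 < e & forall U, nbhs (f t0) U -> forall d : R, 0 < d ->
    exists t, [/\ t != t0, 0 < t < e, `|t - t0| < d & U (f t)].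
Proof.
move=> [B cB [Bopen Bnbhs]] e0; apply: contrapT => noc.
have [fB fBinj] := countable_injP B cB.
have code t0 : exists c : set T * (rat * nat), 0 < t0 < e ->
    [/\ B c.1, c.1 (f t0), `|t0 - ratr c.2.1| < c.2.2.+1%:R^-1 &
      forall t, 0 < t < e -> `|t - ratr c.2.1| < c.2.2.+1%:R^-1 -> c.1 (f t) -> t = t0].
  have [t0e|] := boolP (0 < t0 < e); last by exists (set0, (0, 0%N)).
  have [U [d [Ut d0 H]]] : exists U (d : R), [/\ nbhs (f t0) U, 0 < d &
      forall t, 0 < t < e -> `|t - t0| < d -> U (f t) -> t = t0].
    apply: contrapT => H; apply: noc; exists t0 => // U Ut d d0.
    apply: contrapT => H'; apply: H; exists U, d; split=> // t te td Uft.
    by apply/eqP; apply/negPn/negP => tt0; apply: H'; exists t; split.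
  have [V [BV Vt] VU] := Bnbhs _ _ Ut.
  (* Radius below [d / 2]: two points in the same rational interval are then less than [d] apart. *)
  have [n Hn] : exists n, (n.+1%:R^-1 : R) < d / 2.
    have d20 : 0 < d / 2 by rewrite divr_gt0.
    exists (Num.truncn (d / 2)^-1); rewrite invf_plt ?posrE//.
    exact: truncnS_gt.
  have n0 : 0 < (n.+1%:R^-1 : R) by rewrite invr_gt0 ltr0n.
  have [|q] := @rat_in_itvoo R (t0 - n.+1%:R^-1) (t0 + n.+1%:R^-1).
    by rewrite ltrD2l gtrN.
  rewrite in_itv /= => /andP[q1 q2].
  have tq : `|t0 - ratr q| < n.+1%:R^-1 by rewrite distrC ltr_distl q1.
  exists (V, (q, n)) => _ /=; split=> // t te tq' Vf.
  apply: H => //; last exact: VU.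
  apply: le_lt_trans (ler_distD (ratr q) _ _) _; rewrite [d]splitr.
  by apply: ltrD; [exact: lt_trans Hn | rewrite distrC; exact: lt_trans Hn].
have [c Hc] := choice code.
apply: (interval_uncountable e0); apply/countable_injP.
exists (fun t => pickle (fB (c t).1, (c t).2)) => s t.
rewrite !inE => /= se te /(pcan_inj pickleK)[/fBinj e1 e2].
have [Bs s1 s2 s3] := Hc s se; have [Bt t1 t2 t3] := Hc t te.
have {}e1 : (c s).1 = (c t).1 by apply: e1; rewrite inE.
by apply: t3; rewrite -?e2 -?e1.
Qed.

End Condensation.

(** * The two implications on the level of the group *)

Section CayleyCriterion.
Context {R : realType} {b : ground}.
Local Notation F := (base_field R b).
Variables (G : lieGroup F) (N : nat) (T : G -> 'M[F]_N).
Local Notation E := 'rV[F]_(lie_dim G).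
Local Notation M := 'M[F]_N.
Local Notation phi := (lie_chart1 G).
Local Notation psi := (chart_inv (lie_chart1 G)).
Local Notation o := (lie_chart1 G 1%g).
Variable D : E -> M.
Hypothesis T1 : T 1%g = 1%:M.
Hypothesis TM : forall x y, T (x * y)%g = T x *m T y.
Hypothesis TD : fdiff (T \o psi) o D.
Hypothesis Tcont : forall v, chart_img phi v -> {for v, continuous (T \o psi)}.

Let DD : forall x y, D (x + y) = D x + D y. Proof. exact: fdiffD TD. Qed.
Let DZ : forall k x, D (k *: x) = k *: D x. Proof. exact: fdiffZ TD. Qed.

Let DN x : D (- x) = - D x.
Proof. by rewrite -scaleN1r DZ scaleN1r. Qed.

Let TV g : T g *m T g^-1%g = 1%:M.
Proof. by rewrite -TM mulgV. Qed.

Let VT g : T g^-1%g *m T g = 1%:M.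
Proof. by rewrite -TM mulVg. Qed.

Definition chart_hom (v : E) : M := T (psi (o + v)).

Lemma chart_hom_fdiff : fdiff chart_hom 0 D.
Proof.
have TD' := TD; rewrite -[X in fdiff _ X]add0r in TD'.
apply: (fdiff_eq (f := fun z => (T \o psi) (z + o))); last exact: fdiff_shift.
by move=> v; rewrite /chart_hom /= addrC.
Qed.

Lemma hom_local : exists d C : R,
  [/\ 0 < d, 0 <= C & C * d <= 1 / 2] /\
  [/\ forall v : E, nr v < d -> chart_img phi (o + v),
      forall v : E, nr v < d -> local_mul 0 v = v,
      forall u : E, nr u < d -> local_mul u 0 = u &
   [/\ forall u v w : E, nr u < d -> nr v < d -> nr w < d ->
         nr (local_mul u v) < d -> nr (local_mul v w) < d ->
         local_mul (local_mul u v) w = local_mul u (local_mul v w),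
      forall u u' v v' : E, nr u < d -> nr u' < d -> nr v < d -> nr v' < d ->
        nr (local_mul u v - local_mul u' v - (local_mul u v' - local_mul u' v'))
          <= C * (nr (u - u') * nr (v - v')),
      chart_hom 0 = 1%:M,
      forall u v : E, nr u < d -> nr v < d ->
        chart_hom (local_mul u v) = chart_hom u *m chart_hom v &
      forall u : E, nr u < d -> {for u, continuous chart_hom}]].
Proof.
have [d [C [dC himg hmul hmix]]] := local_group G.
exists d, C; split=> //; split=> //.
- move=> v vd; have [_ h] := chart_imgP (himg v vd).
  by rewrite /local_mul addr0 psi_o mul1g h addrC addKr.
- move=> v vd; have [_ h] := chart_imgP (himg v vd).
  by rewrite /local_mul addr0 psi_o mulg1 h addrC addKr.
split=> //.
- move=> u v w ud vd wd uvd vwd.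
  by rewrite {1}/local_mul hmul// [in RHS]/local_mul hmul// mulgA.
- by rewrite /chart_hom addr0 psi_o.
- by move=> u v ud vd; rewrite /chart_hom hmul// TM.
move=> u ud; apply/nr_cvgP => e e0.
have [d1 d10 H] := (nr_cvgP _ _).1 (Tcont (himg u ud)) e e0.
exists d1 => // y yd; apply: H.
by rewrite opprD addrACA subrr add0r.
Qed.

(** Composing with the projection onto [h] presents the conjugated image of [h] as the range of a
    linear map on all of [E]. *)
Lemma conj_closed_range (h : {vspace E}) (g : G) X :
  (forall e : R, 0 < e -> exists2 B, (exists2 y, y \in h & B = T g *m D y *m T g^-1%g)
     & nm (X - B) <= e) ->
  exists2 y, y \in h & X = T g *m D y *m T g^-1%g.
Proof.
move=> H; pose D' v := T g *m D (projv h v) *m T g^-1%g.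
have [|||v ->] := @linear_closed_range R b _ N D' _ _ X.
- by move=> u v; rewrite /D' linearD DD mulmxDr mulmxDl.
- by move=> c v; rewrite /D' linearZ DZ -scalemxAr -scalemxAl.
- move=> e /H[B [y yh ->] He]; exists y.
  by rewrite /D' projv_id.
by exists (projv h v); rewrite ?memv_proj.
Qed.

Lemma hom_conj (g : G) y : T g *m D y *m T g^-1%g = D (Ad g y).
Proof. by rewrite (hom_Ad TM TD) -mulmxA TV mulmx1. Qed.

Lemma cayley_of_triple (h : {vspace E}) :
  (forall x : E, exists (g : G) (H : E), H \in h /\ x = Ad g H) ->
  (forall x y z, x \in h -> y \in h -> z \in h ->
     exists2 w, w \in h & D x *m D y *m D z = D w) ->
  exists2 e : R, 0 < e & forall x : E, nr x < e ->
    1%:M - D x \in unitmx /\ exists g, T g = cayley_mx (D x).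
Proof.
move=> conj S3.
have [d [C [[d0 C0 Cd] [himg mu0l mu0r [muA mix r0 rM rc]]]]] := hom_local.
have [q [qD qZ [c c0 qc] Dq]] := linear_section DD DZ.
have [K K0 DK] := fdiff_bound TD.
(* The roots satisfy [nm (Q n) <= 8 * a / 2 ^+ n], and [8 * a <= 1 / 4] is what [local_exp_rep]
   asks; the bound with [c] ensures [4 * (4 * c * a) < d] for the vectors [w n]. *)
pose s := Num.min (1 / 32) (d / (32 * c)).
have c320 : 0 < 32 * c by rewrite mulr_gt0.
have s0 : 0 < s by rewrite lt_min !divr_gt0.
exists (s / (N%:R * K + 1)).
  by rewrite divr_gt0// ltr_wpDl// mulr_ge0// ltW.
move=> x; rewrite ltr_pdivlMr ?ltr_wpDl ?mulr_ge0 ?(ltW K0)// => xs.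
set A := D x; set a := nm A.
have as_ : a < s.
  apply: le_lt_trans xs; rewrite /a /nm mulrDr mulr1 ler_wpDr ?nr_ge0//.
  by rewrite [leRHS]mulrCA ler_wpM2l// [leRHS]mulrC; exact: DK.
have a0 : 0 <= a by exact: nm_ge0.
have a32 : a <= 1 / 32 by apply: le_trans (ltW as_) _; rewrite ge_min lexx.
have ad : 32 * c * a < d.
  by rewrite mulrC -ltr_pdivlMr//; apply: lt_le_trans as_ _; rewrite ge_min lexx orbT.
split; first by apply: unit_1B; rewrite -/a; lra.
have [g [H [Hh xE]]] := conj x.
pose S X := exists2 y, y \in h & X = T g *m D y *m T g^-1%g.
have SA : S A by exists H => //; rewrite hom_conj -xE.
have [|||||B [B0 SB Bn BS BC]] := @cayley_roots R b N S _ _ _ _ A SA.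
- move=> X Y [y yh ->] [z zh ->]; exists (y + z); first exact: memvD.
  by rewrite DD mulmxDr mulmxDl.
- move=> t X [y yh ->]; exists (toF t *: y); first exact: memvZ.
  by rewrite DZ -scalemxAr -scalemxAl.
- move=> X Y Z [y yh ->] [z zh ->] [w wh ->].
  have [v vh vE] := S3 y z w yh zh wh; exists v => //.
  have can P : T g^-1%g *m (T g *m P) = P by rewrite mulmxA VT mul1mx.
  by rewrite -vE -!mulmxA !can.
- by move=> X HX; apply: conj_closed_range.
- by rewrite -/a; lra.
have BD n : exists y, B n = D y.
  by have [y _ ->] := SB n; exists (Ad g y); rewrite hom_conj.
(* To first order the Cayley transform of [B n] is [1 + 2 B n], so [2 B n] is the tangent direction
   of the root. The error is exactly [2 B B (1 - B)^-1], of order [4 ^- n]. *)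
pose w n := q (B n + B n).
pose Q n := cayley_mx (B n) - 1%:M.
have p0 n : 0 < (2 ^+ n : R) by rewrite exprn_gt0.
have p1 n : (2 ^+ n : R)^-1 <= 1 by rewrite invf_le1// exprn_ege1// ler1n.
have i0 n : 0 < (2 ^+ n : R)^-1 by rewrite invr_gt0.
have e4 n : (4 ^+ n : R)^-1 = (2 ^+ n)^-1 * (2 ^+ n)^-1.
  by rewrite -invfM -exprMn; congr (_ ^+ _)^-1; ring.
have nB0 n := nm_ge0 (B n).
have Bn2 n : nm (B n) <= 1 / 2.
  apply: le_trans (Bn n) _; rewrite -/a.
  have : 2 * a * (2 ^+ n)^-1 <= 2 * a * 1 by have := p1 n; nra.
  lra.
have Dw n : D (w n) = B n + B n.
  by have [y yE] := BD n; rewrite /w yE -DD Dq.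
pose J n := invmx (1%:M - B n).
have Bu n : 1%:M - B n \in unitmx by apply: unit_1B; have := Bn2 n; lra.
have QE n : Q n = (B n + B n) *m J n.
  apply: (can_inj (mulmxK (Bu n))); rewrite mulmxKV// /Q mulmxBl mulmxKV//.
  by rewrite mul1mx opprB addrC subrKA.
have DQ n : D (w n) - Q n = - ((B n + B n) *m B n *m J n).
  apply: (can_inj (mulmxK (Bu n))); rewrite Dw mulmxBl QE mulNmx !mulmxKV//.
  by rewrite mulmxBr mulmx1 addrAC subrr add0r.
have nBB n : nm (B n + B n) <= 2 * nm (B n).
  by apply: le_trans (nmD _ _) _; lra.
have [||||||e [_ _ eE]] := @local_exp_rep R b _ N (@local_mul R b G) chart_hom D d C
  d0 C0 Cd mu0l mu0r muA mix r0 rM rc chart_hom_fdiff w Q (cayley_mx A)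
  (4 * c * a) (16 * c * (a * a * a)) (16 * (a * a)).
- move=> n; apply: le_trans (qc _) _.
  have h1 : c * nm (B n + B n) <= c * (2 * (2 * a / 2 ^+ n)).
    by rewrite ler_wpM2l ?(ltW c0)// (le_trans (nBB n))// ler_wpM2l// Bn.
  by apply: le_trans h1 _; rewrite le_eqVlt; apply/orP; left; apply/eqP; ring.
(* By the recursion, [2 B_n - 4 B_(n+1) = - 2 B_n B_(n+1) B_(n+1)], which is cubic and therefore
   more than small enough. *)
- move=> n; have -> : w n - (w n.+1 + w n.+1) =
      q (- (B n *m B n.+1 *m B n.+1 + B n *m B n.+1 *m B n.+1)).
    have qN u v : q (u - v) = q u - q v by rewrite -scaleN1r qD qZ scaleN1r.
    by rewrite /w -qD -qN; congr (q _); rewrite BS opprD addrACA !opprD !addNKr.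
  apply: le_trans (qc _) _; rewrite nmN.
  set Z := B n *m B n.+1 *m B n.+1.
  have h1 := nmD Z Z; have h2 := nmM (B n *m B n.+1) (B n.+1).
  have h3 := nmM (B n) (B n.+1); have h4 := Bn n; have h5 := Bn n.+1.
  rewrite e4; have := i0 n; have := p1 n; have := nB0 n; have := nB0 n.+1.
  have h6 : nm (B n.+1) <= a * (2 ^+ n)^-1.
    by apply: le_trans h5 _; rewrite exprS invfM -/a le_eqVlt; apply/orP; left; apply/eqP; field.
  move: h2 h3 h4 h6; rewrite -/Z -/a; have := nm_ge0 (B n *m B n.+1).
  move: (2 ^+ n)^-1 (nm (B n)) (nm (B n.+1)) (nm (B n *m B n.+1)) (nm Z) h1.
  move=> i u y xy z h1 xy0 h2 h3 h4 h6 y0 u0 i1 i0'.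
  have ai : 0 <= a * i by rewrite mulr_ge0// ltW.
  have h7 : u * y <= (2 * (a * i)) * (a * i) by apply: ler_pM => //; lra.
  have h8 : xy * y <= (2 * (a * i) * (a * i)) * (a * i) by apply: ler_pM => //; lra.
  have h9 : c * nm (Z + Z) <= c * (4 * (a * a * a) * (i * i * i)).
    rewrite ler_wpM2l ?(ltW c0)//; lra.
  apply: le_trans h9 _.
  have -> : 16 * c * (a * a * a) * (i * i) = c * (16 * (a * a * a) * (i * i)) by ring.
  rewrite ler_wpM2l ?(ltW c0)//.
  have a3 : 0 <= a * a * a by apply: mulr_ge0 => //; exact: mulr_ge0.
  have i3 : i * i * i <= i * i by rewrite -[leRHS]mulr1 ler_wpM2l// mulr_ge0 ?ltW.
  have i2 : 0 <= i * i by rewrite mulr_ge0 ?ltW.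
  by nra.
- lra.
- move=> n; rewrite QE; apply: le_trans (nm_invmx _ (Bn2 n)) _.
  have := nBB n; have := Bn n; rewrite -/a; have := i0 n; nra.
- by move=> n; rewrite /Q subrKC BC.
- move=> n; rewrite DQ nmN; apply: le_trans (nm_invmx _ (Bn2 n)) _.
  have h1 := nmM (B n + B n) (B n); have h2 := nBB n; have h3 := Bn n.
  have h4 : nm (B n + B n) * nm (B n) <= (2 * nm (B n)) * nm (B n) by rewrite ler_wpM2r.
  have h5 : nm (B n) * nm (B n) <= (2 * a / 2 ^+ n) * (2 * a / 2 ^+ n) by apply: ler_pM.
  rewrite e4; lra.
by exists (psi (o + e)).
Qed.

Lemma cube_of_cayley :
  (exists2 e : R, 0 < e & forall x : E, nr x < e ->
    1%:M - D x \in unitmx /\ exists g, T g = cayley_mx (D x)) ->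
  forall x, exists w, D x *m D x *m D x = D w.
Proof.
move=> [e e0 cay] x; set A := D x; pose al := nm A.
have al0 : 0 <= al by exact: nm_ge0.
pose n1 := nm (1%:M : M); have n10 : 0 <= n1 by exact: nm_ge0.
(* The first bound puts [t x] in the domain of the hypothesis; the second makes [nm (t A) <= 1 / 4],
   so that [1 - t A] and [1 + t A] have bounded inverses. *)
pose d := Num.min (e / (nr x + 1)) (1 / 4 / (al + 1)).
have x1 : 0 < nr x + 1 by rewrite ltr_wpDl ?nr_ge0.
have al1 : 0 < al + 1 by rewrite ltr_wpDl.
have d0 : 0 < d by rewrite lt_min !divr_gt0.
have tA t : 0 < t < d -> nm (toF t *: A) <= 1 / 4.
  move=> /andP[t0 td]; rewrite nmZ gtr0_norm// -/al.
  have : t < 1 / 4 / (al + 1) by apply: lt_le_trans td _; rewrite ge_min lexx orbT.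
  by rewrite ltr_pdivlMr// => h; nra.
(* The implication is placed under the existential to obtain a total choice; outside the interval
   the value is arbitrary. *)
have gex t : exists g : G, 0 < t < d -> T g = cayley_mx (toF t *: A).
  have [td|] := boolP (0 < t < d); last by exists 1%g.
  have /andP[t0 td'] := td.
  have [|_ [g Hg]] := cay (toF t *: x); last by exists g; rewrite Hg DZ.
  rewrite nrZt gtr0_norm//; have : t < e / (nr x + 1).
    by apply: lt_le_trans td' _; rewrite ge_min lexx.
  by rewrite ltr_pdivlMr// => h; have := nr_ge0 x; nra.
have [gam Hgam] := choice gex.
have inv_m t (Y : M) : 0 < t < d -> nm (Y *m invmx (1%:M - toF t *: A)) <= 2 * nm Y.
  by move=> /tA h; apply: nm_invmx; lra.
have inv_p t : 0 < t < d -> nm (invmx (1%:M + toF t *: A)) <= 2 * n1.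
  move=> /tA h; rewrite -[invmx _]mul1mx -[toF t *: A]opprK.
  by apply: nm_invmx; rewrite nmN; lra.
have um t : 0 < t < d -> 1%:M - toF t *: A \in unitmx.
  by move=> /tA h; apply: unit_1B; lra.
have up t : 0 < t < d -> 1%:M + toF t *: A \in unitmx.
  by move=> /tA h; rewrite -[_ *: A]opprK; apply: unit_1B; rewrite nmN; lra.
(* The logarithmic derivative of [t] to [cayley_mx (t A)], that is [2 A (1 - t^2 A^2)^-1]. *)
pose X t := invmx (1%:M + toF t *: A) *m (A + A) *m invmx (1%:M - toF t *: A).
have nAA : nm (A + A) <= 2 * al by apply: le_trans (nmD _ _) _; rewrite -/al; lra.
have tangent ep : 0 < ep -> ep <= d -> exists2 t0, 0 < t0 < ep & exists w, X t0 = D w.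
  move=> ep0 epd.
  have [t0 /andP[t00 t0ep] Ht0] := condensation_point gam (@lie_second_countable _ G) ep0.
  exists t0; first by rewrite t00.
  have t0d : 0 < t0 < d by rewrite t00 (lt_le_trans t0ep).
  have [d' [C' [[d'0 C'0 C'd] [himg mu0l mu0r [muA mix r0 rM rc]]]]] := hom_local.
  apply: (@tangent_in_range R b _ N (@local_mul R b G) chart_hom D d' C'
    d'0 C'0 C'd mu0l mu0r muA mix r0 rM rc chart_hom_fdiff (X t0)) => eta eta0.
  (* [K] bounds the coefficient of [(t - t0)^2] in [rv - 1 - (t - t0) X t0], so [|t - t0| < eta / K]
     makes this remainder at most [eta * |t - t0|]. *)
  pose K := 16 * n1 * al * al + 1.
  have K0 : 0 < K.
    by rewrite ltr_wpDl//; apply: mulr_ge0 => //; apply: mulr_ge0 => //; apply: mulr_ge0.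
  pose U := [set p : G | chart_dom phi ((gam t0)^-1 * p)%g /\
    nr (phi ((gam t0)^-1 * p)%g - o) < eta].
  have Un : nbhs (gam t0) U.
    have c1 : (fun _ : G => (gam t0)^-1)%g @ gam t0 --> ((gam t0)^-1)%g.
      exact: (@cvg_cst G ((gam t0)^-1)%g G (nbhs (gam t0))).
    have c2 : (fun p : G => p) @ gam t0 --> gam t0 by exact: cvg_id.
    have c3 := lie_mul_cvg c1 c2; rewrite mulVg in c3.
    have n1' : nbhs (gam t0) [set p : G | chart_dom phi ((gam t0)^-1 * p)%g].
      exact: (c3 _ (chart_dom_nbhs (phi1_dom G))).
    have pc : nbhs (1%g : G) [set p : G | nr (phi p - o) < eta].
      have o_eta : nbhs (o : E) [set v : E | nr (v - o) < eta].
        by apply: (nbhs_nrP _ _).2; exists eta.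
      exact: (chart_map_continuous (phi1_dom G) o_eta).
    by have n2' := c3 _ pc; exact: filterI n1' n2'.
  have [t [tt0 tep tK [p1 p2]]] := Ht0 U Un (eta / K) (divr_gt0 eta0 K0).
  have td : 0 < t < d by case/andP: tep => -> h; exact: lt_le_trans h epd.
  exists (t - t0), (phi ((gam t0)^-1 * gam t)%g - o).
  rewrite subr_eq0; split=> //.
  have -> : chart_hom (phi ((gam t0)^-1 * gam t)%g - o) = T ((gam t0)^-1 * gam t)%g.
    by rewrite /chart_hom subrKC chart_mapK.
  set rv := T _; have rvE : cayley_mx (toF t0 *: A) *m rv = cayley_mx (toF t *: A).
    by rewrite -!Hgam// /rv -TM mulgA mulgV mul1g.
  have um0 := um _ t0d; have up0 := up _ t0d; have um1 := um _ td.
  have bda : toF t *: A - toF t0 *: A = toF (t - t0) *: A by rewrite rmorphB scalerBl.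
  have im0 := inv_m t0 ((invmx (1%:M + toF t0 *: A) *m (A + A) *m
    invmx (1%:M - toF t *: A)) *m A) t0d.
  have im1 := inv_m t (invmx (1%:M + toF t0 *: A) *m (A + A)) td.
  have ip0 := inv_p _ t0d.
  rewrite /X; move: rvE um0 up0 um1 bda im0 im1 ip0.
  set ta := toF (t - t0).
  move: (toF t0 *: A) (toF t *: A) => a b' rvE um0 up0 um1 bda im0 im1 ip0.
  have comm : (1%:M - a) *m (1%:M + a) = (1%:M + a) *m (1%:M - a).
    rewrite mulmxBl mulmxDl !mul1mx mulmxDr mulmxBr !mulmx1.
    by rewrite opprD addrA addrK addrA subrK.
  have e1 : (1%:M + a) *m rv *m (1%:M - b') = (1%:M - a) *m (1%:M + b').
    have : (1%:M - a) *m (cayley_mx a *m rv) *m (1%:M - b') =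
        (1%:M - a) *m cayley_mx b' *m (1%:M - b') by rewrite rvE.
    rewrite /cayley_mx -!mulmxA mulVmx// mulmx1 !mulmxA comm.
    by rewrite -[_ *m _ *m invmx _]mulmxA mulmxV// mulmx1 => ->.
  (* The products [a *m b'] cancel and leave exactly [2 (b' - a)], so the factor [ta] comes out
     without any expansion. *)
  have e2 : (1%:M + a) *m (rv - 1%:M) *m (1%:M - b') = ta *: (A + A).
    have -> : (1%:M + a) *m (rv - 1%:M) *m (1%:M - b') =
        (1%:M + a) *m rv *m (1%:M - b') - (1%:M + a) *m (1%:M - b').
      by rewrite [_ *m (rv - _)]mulmxBr mulmx1 mulmxBl.
    have p1' : (1%:M - a) *m (1%:M + b') = 1%:M + b' - (a + a *m b').
      by rewrite mulmxBl mul1mx mulmxDr mulmx1.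
    have p2' : (1%:M + a) *m (1%:M - b') = 1%:M - b' + (a - a *m b').
      by rewrite mulmxDl mul1mx mulmxBr mulmx1.
    rewrite e1 p1' p2' scalerDr -bda; move: (a *m b') (1%:M : M) => c' u'.
    by apply/matrixP => i j; rewrite !mxE; ring.
  have ZE : rv - 1%:M = ta *: (invmx (1%:M + a) *m (A + A) *m invmx (1%:M - b')).
    rewrite scalemxAl scalemxAr -e2 !mulmxA mulVmx// mul1mx.
    by rewrite -mulmxA mulmxV// mulmx1.
  have res : invmx (1%:M - b') - invmx (1%:M - a) =
      ta *: (invmx (1%:M - b') *m A *m invmx (1%:M - a)).
    rewrite scalemxAl scalemxAr -bda.
    have -> : b' - a = (1%:M - a) - (1%:M - b').
      by rewrite opprB [RHS]addrC addrA subrK.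
    by rewrite mulmxBr mulmxBl mulVmx// mul1mx mulmxK.
  rewrite ZE -scalerBr -mulmxBr res -scalemxAr /ta !nmZ !mulmxA.
  have T0 : 0 <= `|t - t0| by [].
  set Y := nm _; have Yb : Y <= K.
    apply: le_trans im0 _.
    have h1 := nmM (invmx (1%:M + a) *m (A + A) *m invmx (1%:M - b')) A.
    have h2 := nmM (invmx (1%:M + a)) (A + A).
    have h3 : nm (invmx (1%:M + a)) * nm (A + A) <= (2 * n1) * (2 * al).
      by apply: ler_pM => //; exact: nm_ge0.
    have h4 : nm (invmx (1%:M + a) *m (A + A) *m invmx (1%:M - b')) * nm A <=
        (8 * n1 * al) * al by apply: ler_wpM2r => //; lra.
    rewrite /K; lra.
  rewrite mulrC ler_wpM2r//; apply: le_trans (ler_wpM2l T0 Yb) _.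
  by rewrite -ler_pdivlMr// ltW.
apply: (linear_closed_range DD DZ) => ep ep0.
pose BX := 8 * n1 * al * (al * al * al * al).
have BX0 : 0 <= BX by rewrite /BX; repeat apply: mulr_ge0 => //.
have BX1 : 0 < BX + 1 by rewrite ltr_wpDl.
pose ep' := Num.min d (Num.min 1 (ep / (BX + 1))).
have ep'0 : 0 < ep' by rewrite lt_min d0 lt_min ltr01 divr_gt0.
have [|t0 /andP[t00 t0ep] [w XE]] := tangent ep' ep'0.
  by rewrite ge_min lexx.
have t0d : 0 < t0 < d by rewrite t00 (lt_le_trans t0ep)// ge_min lexx.
have t01 : t0 <= 1 by apply: le_trans (ltW t0ep) _; rewrite !ge_min lexx orbT.
have t0e : t0 * (BX + 1) <= ep.
  by rewrite -ler_pdivlMr//; apply: le_trans (ltW t0ep) _; rewrite !ge_min lexx !orbT.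
(* Equivalently [X t0 (1 - t0^2 A^2) = 2 A]. Hence [(X t0 - 2 A) / (2 t0^2) = X t0 A A / 2], which
   lies in the range of [D], differs from [A A A] by [t0^2 X t0 A A A A / 2], and this tends to 0
   with [t0]. *)
have XX : X t0 = (A + A) + toF (t0 * t0) *: (X t0 *m A *m A).
  have := mulmxKV (up _ t0d) (X t0 *m (1%:M - toF t0 *: A)).
  have um0 := um _ t0d; have up0 := up _ t0d.
  have -> : toF (t0 * t0) *: (X t0 *m A *m A) = X t0 *m (toF t0 *: A) *m (toF t0 *: A).
    by rewrite -!scalemxAr -scalemxAl scalerA -rmorphM.
  have ac : toF t0 *: A *m (A + A) = (A + A) *m (toF t0 *: A).
    by rewrite -scalemxAl -scalemxAr mulmxDl mulmxDr.
  rewrite /X; move: (toF t0 *: A) um0 up0 ac => a um0 up0 ac _.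
  set Y := invmx (1%:M + a) *m (A + A).
  have h : (Y *m invmx (1%:M - a)) *m (1%:M - a) *m (1%:M + a) = A + A.
    rewrite mulmxKV// /Y -mulmxA mulmxDr mulmx1 -ac -{1}[A + A]mul1mx -mulmxDl.
    by rewrite mulmxA mulVmx// mul1mx.
  rewrite -{1}h; move: (Y *m invmx (1%:M - a)) => Z.
  by rewrite mulmxBr mulmx1 mulmxDr mulmx1 mulmxBl addrA subrK subrK.
pose k := 1 / 2 / (t0 * t0).
have tt0 : t0 * t0 != 0 by rewrite mulf_neq0// gt_eqF.
exists (toF k *: (w - (x + x))); rewrite DZ DD DN DD -XE -/A.
have -> : X t0 - (A + A) = toF (t0 * t0) *: (X t0 *m A *m A).
  by rewrite {1}XX addrC addKr.
rewrite scalerA -rmorphM /k divfK//.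
have -> : A *m A *m A - toF (1 / 2) *: (X t0 *m A *m A) =
    - (toF (1 / 2 * (t0 * t0)) *: (X t0 *m A *m A *m A *m A)).
  have E3 : X t0 *m A *m A = A *m A *m A + A *m A *m A +
      toF (t0 * t0) *: (X t0 *m A *m A *m A *m A).
    by rewrite {1}XX !mulmxDl -!scalemxAl.
  rewrite [in LHS]E3 !scalerDr scalerA -rmorphM opprD addrA -scalerDl -rmorphD /= (_ : 1 / 2 + 1 / 2 = 1); last by field.
  by rewrite rmorph1 scale1r subrr sub0r.
rewrite nmN nmZ ger0_norm; last by rewrite !mulr_ge0// ltW.
have nX : nm (X t0) <= 8 * n1 * al.
  apply: le_trans (inv_m _ _ t0d) _; have h2 := nmM (invmx (1%:M + toF t0 *: A)) (A + A).
  have h3 : nm (invmx (1%:M + toF t0 *: A)) * nm (A + A) <= (2 * n1) * (2 * al).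
    by apply: ler_pM; rewrite ?nm_ge0 ?inv_p.
  lra.
have nP : nm (X t0 *m A *m A *m A *m A) <= BX.
  have m1 Z c : nm Z <= c -> nm (Z *m A) <= c * al.
    by move=> Zc; apply: le_trans (nmM _ _) _; rewrite ler_wpM2r.
  have := m1 _ _ (m1 _ _ (m1 _ _ (m1 _ _ nX))); rewrite /BX; lra.
have P0 := nm_ge0 (X t0 *m A *m A *m A *m A).
have h : t0 * t0 * nm (X t0 *m A *m A *m A *m A) <= t0 * BX.
  by apply: ler_pM => //; [rewrite mulr_ge0 ?ltW | rewrite ger_pMr].
have := mulr_ge0 (ltW t00) BX0; lra.
Qed.


End CayleyCriterion.

(** * Polarization and the criterion for matrices over the ground field *)

Section Criterion.
Context {R : realType} {b : ground}.
Local Notation F := (base_field R b).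
Variables (G : lieGroup F) (N : nat) (T : G -> 'M[F]_N).
Local Notation E := 'rV[F]_(lie_dim G).
Local Notation M := 'M[F]_N.
Local Notation phi := (lie_chart1 G).
Local Notation psi := (chart_inv (lie_chart1 G)).
Local Notation o := (lie_chart1 G 1%g).
Variable D : E -> M.
Hypothesis T1 : T 1%g = 1%:M.
Hypothesis TM : forall x y, T (x * y)%g = T x *m T y.
Hypothesis TD : fdiff (T \o psi) o D.
Hypothesis Tcont : forall v, chart_img phi v -> {for v, continuous (T \o psi)}.

Let DD : forall x y, D (x + y) = D x + D y. Proof. exact: fdiffD TD. Qed.
Let DZ : forall k x, D (k *: x) = k *: D x. Proof. exact: fdiffZ TD. Qed.

Let DN x : D (- x) = - D x.
Proof. by rewrite -scaleN1r DZ scaleN1r. Qed.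

Lemma cube_add (A B : M) : A *m B = B *m A ->
  (A + B) *m (A + B) *m (A + B) =
  A *m A *m A + (A *m A *m B) *+ 3 + (A *m B *m B) *+ 3 + B *m B *m B.
Proof.
move=> AB; rewrite !mulmxDl !mulmxDr -AB !mulmxDl.
have -> : A *m B *m A = A *m A *m B by rewrite -mulmxA -AB mulmxA.
have -> : B *m B *m A = A *m B *m B by rewrite -mulmxA -AB mulmxA -AB.
move: (A *m A *m A) (A *m A *m B) (A *m B *m B) (B *m B *m B) => x y z t.
by apply/matrixP => i j; rewrite !mxE; ring.
Qed.

Lemma sum_in_range X Y : (exists w, X = D w) -> (exists w, Y = D w) ->
  exists w, X + Y = D w.
Proof. by move=> [v ->] [w ->]; exists (v + w); rewrite DD. Qed.

Lemma scale_in_range k X : (exists w, X = D w) -> exists w, k *: X = D w.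
Proof. by move=> [v ->]; exists (k *: v); rewrite DZ. Qed.

(** Polarization in two steps: [(x + y)^3 - (x - y)^3 - 2 y^3 = 6 x^2 y], and then
    [(x + y)^2 z - x^2 z - y^2 z = 2 x y z]. Cubes are available for all vectors, so [x - y] need
    not satisfy [P]. *)
Lemma triple_of_cube (P : E -> Prop) :
  (forall x, exists w, D x *m D x *m D x = D w) ->
  (forall x y, P x -> P y -> D x *m D y = D y *m D x) ->
  (forall x y, P x -> P y -> P (x + y)) ->
  forall x y z, P x -> P y -> P z -> exists w, D x *m D y *m D z = D w.
Proof.
move=> cube comm PD.
have square x y : P x -> P y -> exists w, D x *m D x *m D y = D w.
  move=> Px Py; have AB := comm x y Px Py.
  have c1 := cube (x + y); have c2 := cube (x - y); have c3 := cube y.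
  have AB' : D x *m (- D y) = - D y *m D x by rewrite mulmxN AB mulNmx.
  rewrite DD (cube_add AB) in c1; rewrite DD DN (cube_add AB') in c2.
  have -> : D x *m D x *m D y = 6^-1 *: (
     (D x *m D x *m D x + (D x *m D x *m D y) *+ 3 + (D x *m D y *m D y) *+ 3
        + D y *m D y *m D y) +
     ((-1) *: (D x *m D x *m D x + (D x *m D x *m - D y) *+ 3
        + (D x *m - D y *m - D y) *+ 3 + - D y *m - D y *m - D y)
      + (- 2) *: (D y *m D y *m D y))).
    rewrite !(mulmxN, mulNmx) !opprK.
    move: (D x *m D x *m D x) (D x *m D x *m D y) (D x *m D y *m D y) (D y *m D y *m D y).
    by move=> p q r s; apply/matrixP => i j; rewrite !mxE; field.
  by apply: scale_in_range; repeat (apply: sum_in_range => //; try apply: scale_in_range => //).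
move=> x y z Px Py Pz.
have s1 := square (x + y) z (PD _ _ Px Py) Pz.
have s2 := square x z Px Pz; have s3 := square y z Py Pz.
have -> : D x *m D y *m D z = 2^-1 *: (D (x + y) *m D (x + y) *m D z +
    (-1) *: (D x *m D x *m D z + D y *m D y *m D z)).
  rewrite DD !mulmxDl !mulmxDr !mulmxDl (comm y x Py Px).
  move: (D x *m D x *m D z) (D x *m D y *m D z) (D y *m D y *m D z) => p q r.
  by apply/matrixP => i j; rewrite !mxE; field.
apply: scale_in_range; apply: sum_in_range => //.
by apply: scale_in_range; exact: sum_in_range.
Qed.

Theorem cayley_criterion (h : {vspace E}) :
  is_semisimple (lie_bracket G) -> cartan_subalgebra (lie_bracket G) h ->
  (forall x y, x \in h -> y \in h -> lie_bracket G x y = 0) ->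
  (forall x : E, exists (g : G) (H : E), H \in h /\ x = Ad g H) ->
  (exists2 e : R, 0 < e & forall x : E, nr x < e ->
    1%:M - D x \in unitmx /\ exists g, T g = cayley_mx (D x)) <->
  (forall x y z, x \in h -> y \in h -> z \in h ->
     exists2 w, w \in h & D x *m D y *m D z = D w).
Proof.
move=> ss hc hab conj; split; last exact: cayley_of_triple.
move=> cay.
have D0 : D 0 = 0 by rewrite -[X in D X](scale0r 0) DZ scale0r.
have br x y : D (lie_bracket G x y) = D x *m D y - D y *m D x.
  exact: (hom_bracket T1 TM TD).
have comm x y : x \in h -> y \in h -> D x *m D y = D y *m D x.
  move=> xh yh; apply/eqP; rewrite -subr_eq0 -br hab// D0 //.
have cube := cube_of_cayley T1 TM TD Tcont cay.
have hD x y : x \in h -> y \in h -> x + y \in h by exact: memvD.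
move=> x y z xh yh zh.
have [w wE] := triple_of_cube cube comm hD xh yh zh.
have [U HU] := exists_ker DD DZ.
have [||w' w'h w'U] := @cartan_quotient F (lie_dim G) (lie_bracket G)
  (@lie_bracketDl _ _ G) (@lie_bracketZl _ _ G) (@lie_bracketDr _ _ G)
  (@lie_bracketZr _ _ G) (@lie_jacobi _ _ G) h U w ss hc hab.
- move=> u v uh; rewrite !HU br => /eqP ->.
  by rewrite mulmx0 mul0mx subrr.
- move=> u uh; rewrite HU br -wE subr_eq0; apply/eqP.
  by rewrite !mulmxA (comm u x)// -2!mulmxA (mulmxA (D u)) (comm u y)// -!mulmxA (comm u z).
exists w' => //; rewrite wE; apply/eqP; rewrite eq_sym -subr_eq0 -DN -DD -HU //.
Qed.

End Criterion.

(** * Complex matrices as matrices over the ground field *)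

Section Realification.
Context {R : realType}.

Definition emb_size (b : ground) (m : nat) : nat :=
  match b with Reals => (m + m)%N | Complexes => m end.

(* Over the real numbers, C^m is read as R^(2 m). *)
Definition emb (b : ground) (m : nat) :
    'M[R[i]]_m -> 'M[base_field R b]_(emb_size b m) :=
  match b with
  | Reals => fun A =>
      block_mx (map_mx (@complex.Re R) A) (map_mx (@complex.Im R) A)
               (- map_mx (@complex.Im R) A) (map_mx (@complex.Re R) A)
  | Complexes => id
  end.

Lemma ReD (x y : R[i]) : complex.Re (x + y) = complex.Re x + complex.Re y.
Proof. by case: x y => [? ?] []. Qed.

Lemma ImD (x y : R[i]) : complex.Im (x + y) = complex.Im x + complex.Im y.
Proof. by case: x y => [? ?] []. Qed.

Lemma ReM (x y : R[i]) : complex.Re (x * y) =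
  complex.Re x * complex.Re y - complex.Im x * complex.Im y.
Proof. by case: x y => [? ?] []. Qed.

Lemma ImM (x y : R[i]) : complex.Im (x * y) =
  complex.Re x * complex.Im y + complex.Im x * complex.Re y.
Proof. by case: x y => [? ?] []. Qed.

Lemma map_ReM m n p (A : 'M[R[i]]_(m, n)) (B : 'M[R[i]]_(n, p)) :
  map_mx (@complex.Re R) (A *m B) =
  map_mx (@complex.Re R) A *m map_mx (@complex.Re R) B -
  map_mx (@complex.Im R) A *m map_mx (@complex.Im R) B.
Proof.
apply/matrixP => i j; rewrite !mxE (big_morph _ ReD (erefl : complex.Re (0 : R[i]) = 0)).
by rewrite -sumrB; apply: eq_bigr => k _; rewrite ReM !mxE.
Qed.

Lemma map_ImM m n p (A : 'M[R[i]]_(m, n)) (B : 'M[R[i]]_(n, p)) :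
  map_mx (@complex.Im R) (A *m B) =
  map_mx (@complex.Re R) A *m map_mx (@complex.Im R) B +
  map_mx (@complex.Im R) A *m map_mx (@complex.Re R) B.
Proof.
apply/matrixP => i j; rewrite !mxE (big_morph _ ImD (erefl : complex.Im (0 : R[i]) = 0)).
by rewrite -big_split; apply: eq_bigr => k _; rewrite ImM !mxE.
Qed.

Section Emb.
Context {b : ground} {m : nat}.
Local Notation emb := (emb b (m := m)).
Implicit Types A B : 'M[R[i]]_m.

Lemma embD A B : emb (A + B) = emb A + emb B.
Proof.
rewrite /emb; case: b => //=; rewrite add_block_mx -opprD.
by congr (block_mx _ _ (- _) _); apply/matrixP => i j; rewrite !mxE ?ReD ?ImD.
Qed.

Lemma embZ (c : base_field R b) A : emb (scalar_to_C c *: A) = c *: emb A.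
Proof.
rewrite /emb /scalar_to_C; case: b c => //= c; rewrite scale_block_mx scalerN.
by congr (block_mx _ _ (- _) _); apply/matrixP => i j; rewrite !mxE ?ReM ?ImM /= mul0r ?subr0 ?addr0.
Qed.

Lemma emb0 : emb 0 = 0.
Proof. by apply: (addrI (emb 0)); rewrite -embD !addr0. Qed.

Lemma embN A : emb (- A) = - emb A.
Proof. by apply: (addrI (emb A)); rewrite -embD !subrr emb0. Qed.

Lemma emb1 : emb 1%:M = 1%:M.
Proof.
rewrite /emb; case: b => //=.
have -> : map_mx (@complex.Re R) (1%:M : 'M[R[i]]_m) = 1%:M.
  by apply/matrixP => i j; rewrite !mxE; case: (i == j).
have -> : map_mx (@complex.Im R) (1%:M : 'M[R[i]]_m) = 0.
  by apply/matrixP => i j; rewrite !mxE; case: (i == j).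
by rewrite oppr0 -scalar_mx_block.
Qed.

Lemma embM A B : emb (A *m B) = emb A *m emb B.
Proof.
rewrite /emb; case: b => //=; rewrite mulmx_block map_ReM map_ImM.
rewrite !mulNmx !mulmxN opprD; congr (block_mx _ _ _ _).
  by rewrite addrC.
by rewrite addrC.
Qed.

Lemma emb_inj : injective emb.
Proof.
rewrite /emb; case: b => //= A B /eq_block_mx[/matrixP e1 /matrixP e2 _ _].
apply/matrixP => i j; have := e1 i j; have := e2 i j; rewrite !mxE.
by case: (A i j) (B i j) => [? ?] [? ?] /= -> ->.
Qed.

Lemma emb_unit A : (emb A \in unitmx) = (A \in unitmx).
Proof.
apply/idP/idP => [eA|Au].
  rewrite -row_free_unit -kermx_eq0; apply/eqP/emb_inj.
  rewrite emb0 -(mulmxK eA (emb (kermx A))) -embM mulmx_ker emb0 mul0mx //.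
have : emb A *m emb (invmx A) = 1%:M by rewrite -embM mulmxV// emb1.
by case/mulmx1_unit.
Qed.

Lemma emb_inv A : A \in unitmx -> emb (invmx A) = invmx (emb A).
Proof.
move=> Au; have eA : emb A \in unitmx by rewrite emb_unit.
by apply: (can_inj (mulmxK eA)); rewrite -embM mulVmx// emb1 mulVmx.
Qed.

Lemma emb_cayley A : 1%:M - A \in unitmx -> emb (cayley A) = cayley_mx (emb A).
Proof.
move=> Au; rewrite /cayley /cayley_mx embM emb_inv// !embD embN emb1 //.
Qed.

Lemma gl_coordK A : gl_uncoord (gl_coord b A) = A.
Proof.
rewrite /gl_uncoord /gl_coord; case: b => //=.
by apply/matrixP => i j; rewrite mxE row_mxKl row_mxKr !mxE; case: (A i j).
Qed.

(** [gl_space] is defined by cases on [b], so all properties are proved together. They carry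
    differentiability of [rho] in the coordinates [gl_coord] over to the matrices
    [emb b (rho g)]. *)
Lemma emb_uncoord_lin : [/\
  forall u v : gl_space R b m, emb (gl_uncoord (u + v)) = emb (gl_uncoord u) + emb (gl_uncoord v),
  forall k (u : gl_space R b m), emb (gl_uncoord (k *: u)) = k *: emb (gl_uncoord u) &
  exists2 K, 0 < K & forall u : gl_space R b m, nr (emb (gl_uncoord u)) <= K * nr u].
Proof.
rewrite /emb /gl_uncoord /gl_space; case: b => /=; last first.
  by split=> //; exists 1 => // u; rewrite mul1r.
have E (u : 'M[R]_(m, m + m)) :
  block_mx
    (map_mx (@complex.Re R) (\matrix_(i, j) (lsubmx u i j +i* rsubmx u i j)%C))
    (map_mx (@complex.Im R) (\matrix_(i, j) (lsubmx u i j +i* rsubmx u i j)%C))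
    (- map_mx (@complex.Im R) (\matrix_(i, j) (lsubmx u i j +i* rsubmx u i j)%C))
    (map_mx (@complex.Re R) (\matrix_(i, j) (lsubmx u i j +i* rsubmx u i j)%C)) =
  block_mx (lsubmx u) (rsubmx u) (- rsubmx u) (lsubmx u).
  by congr (block_mx _ _ (- _) _); apply/matrixP => i j; rewrite !mxE.
split.
- move=> u v; rewrite !E add_block_mx -opprD.
  by congr (block_mx _ _ (- _) _); apply/matrixP => i j; rewrite !mxE.
- move=> k u; rewrite !E scale_block_mx scalerN.
  by congr (block_mx _ _ (- _) _); apply/matrixP => i j; rewrite !mxE.
exists 1 => // u; rewrite mul1r E.
apply: (@nr_mx_le R Reals) => [|i j]; first exact: (@nr_ge0 R Reals (gl_space R Reals m) u).
rewrite !mxE; case: (fintype.split i) => i'; rewrite mxE; case: (fintype.split j) => j'.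
- by rewrite mxE; exact: (@nr_entry R Reals m (m + m) u).
- by rewrite mxE; exact: (@nr_entry R Reals m (m + m) u).
- by rewrite !mxE (@nrN R Reals (base_field R Reals)^o); exact: (@nr_entry R Reals m (m + m) u).
- by rewrite mxE; exact: (@nr_entry R Reals m (m + m) u).
Qed.

End Emb.

End Realification.

Section Abelian.
Context {R : realType}.

(** In the complex and compact cases [h] is by assumption its own centralizer. In the non-compact
    case it only centralizes [a], and the Cartan involution is needed. *)
Lemma cartan_g0_abelian (b : ground) (G : lieGroup (base_field R b))
    (h : {vspace lie_alg G}) :
  cartan_subalgebra (lie_bracket G) h -> is_g0 h h ->
  forall x y, x \in h -> y \in h -> lie_bracket G x y = 0.
Proof.
have self (F : numFieldType) (L : lieGroup F) (k : {vspace lie_alg L}) :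
    zero_root_space (lie_bracket L) k k ->
    forall x y, x \in k -> y \in k -> lie_bracket L x y = 0.
  by move=> H x y xk /H; exact.
case: b G h => G h hc /=; last exact: self.
move=> [[_]|[_ [theta [a [inv [ab _] _ g0]]]]]; first exact: self.
exact: (split_cartan_abelian (@lie_bracketDl R Reals G) (@lie_bracketZl R Reals G)
  (@lie_bracketDr R Reals G) (@lie_bracketZr R Reals G) (@lie_jacobi R Reals G) hc inv ab g0).
Qed.

End Abelian.

Theorem theorem5p2 (R : realType) (b : ground) (G : lieGroup (base_field R b))
    (h g0 : {vspace lie_alg G})
    (Gss : is_semisimple (lie_bracket G))
    (hcartan : cartan_subalgebra (lie_bracket G) h)
    (g0_zero : is_g0 h g0) (g0_h : g0 = h)
    (gAd : forall x : lie_alg G, exists (g : G) (H : lie_alg G), H \in h /\ x = Ad g H)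
    (m : nat) (rho : G -> 'M[R[i]]_m) (rho_rep : is_representation rho) :
  is_cayley rho <-> drhoS3 rho h `<=` [set drho rho x | x in [set` h]].
Proof.
have hab := cartan_g0_abelian hcartan; rewrite {}g0_h in g0_zero.
have {hab g0_zero} hab := hab g0_zero.
have [rho1 rhoM /(_ _ (lie_chart1_atlas G)) rhoC] := rho_rep.
pose phi := lie_chart1 G; pose o := phi 1%g.
pose f v := gl_coord b (rho (chart_inv phi v)).
pose T g := emb b (rho g).
pose D x := emb b (drho rho x).
have T1 : T 1%g = 1%:M by rewrite /T rho1 emb1.
have TM x y : T (x * y)%g = T x *m T y by rewrite /T rhoM embM.
have [LD LZ LB] := @emb_uncoord_lin R b m.
have TE : T \o chart_inv phi = (fun u => emb b (gl_uncoord u)) \o f.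
  by apply/funext => v; rewrite /= /f gl_coordK.
have fo : fdiff f o (fun x => 'D_x f o).
  exact: (Ck_fdiff (rv_basis _) (chart_img_nbhs (chart_img_map (phi1_dom G))) (rhoC 1%N)).
have TD : fdiff (T \o chart_inv phi) o D.
  by rewrite TE; exact: (fdiff_comp fo (fdiff_lin (f o) LD LZ LB)).
have Tcont v : chart_img phi v -> {for v, continuous (T \o chart_inv phi)}.
  move=> vphi; rewrite TE; apply: continuous_comp.
    by have [fc _] := rhoC 0%N; exact: fc.
  exact: (fdiff_cont (fdiff_lin (f v) LD LZ LB)).
have crit := cayley_criterion T1 TM TD Tcont Gss hcartan hab gAd.
(* Being an injective unital ring map that preserves and reflects invertibility, [emb] transports
   the condition in both directions. *)
have cay A : (1%:M - A \in unitmx /\ range rho (cayley A)) <->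
    (1%:M - emb b A \in unitmx /\ exists g, T g = cayley_mx (emb b A)).
  rewrite -(emb1 (b := b)) -embN -embD emb_unit.
  split=> -[Au]; first by move=> [g _ gA]; split=> //; exists g; rewrite /T gA emb_cayley.
  move=> [g gA]; split=> //; exists g => //; apply: (emb_inj (b := b)).
  by rewrite emb_cayley.
have -> : is_cayley rho <-> (exists2 e : R, 0 < e & forall x : lie_alg G, nr x < e ->
    1%:M - D x \in unitmx /\ exists g, T g = cayley_mx (D x)).
  split.
    move=> [U [oU HU]]; have [e e0 He] := (nbhs_nrP _ _).1 (open_nbhs_nbhs oU).
    by exists e => // x xe; apply/cay/HU/He; rewrite subr0.
  move=> [e e0 He]; exists [set x | nr x < e]; split.
    split; last by rewrite /= nr0.
    rewrite openE => x /= xe.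
    have : nr (x - 0) < e by rewrite subr0.
    move=> /nbhs_nr_ball; apply: filterS => y /=.
    by rewrite subr0.
  by move=> x /= xe; apply/cay/He.
(* Passing to the span adds nothing to single products, as [drho] is linear over the ground field
   and [h] is a subspace. *)
rewrite crit; split.
  move=> H _ [k [c [x [y [z [hxyz ->]]]]]].
  have Hi i : exists w, w \in h /\ drho rho (x i) *m drho rho (y i) *m drho rho (z i) = drho rho w.
    have [xh yh zh] := hxyz i; have [w wh wE] := H _ _ _ xh yh zh.
    by exists w; split=> //; apply: (emb_inj (b := b)); rewrite !embM.
  have [w Hw] := choice Hi.
  exists (\sum_i c i *: w i); first by apply: memv_suml => i _; rewrite memvZ// (Hw i).1.
  apply: (emb_inj (b := b)); rewrite -/(D _).
  have D0 : D 0 = 0 by exact: fdiff0 TD.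
  rewrite (big_morph D (fdiffD TD) D0) (big_morph (emb b (m := m)) embD emb0).
  by apply: eq_bigr => i _; rewrite embZ (Hw i).2 (fdiffZ TD).
move=> H x y z xh yh zh.
have [|w wh wE] := H (drho rho x *m drho rho y *m drho rho z).
  exists 1%N, (fun=> 1), (fun=> x), (fun=> y), (fun=> z); split=> //.
  rewrite big_ord1; have -> : @scalar_to_C R b 1 = 1 by rewrite /scalar_to_C; case: (b).
  by rewrite scale1r.
by exists w => //; rewrite /D wE !embM.
Qed.
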